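(* Let $n>1$, $p$ an odd prime with $p>n$, $q=p^a$, $t\in\mathbb{F}_q^*$. Write $\det(I-AT)=1+b_1T+\dots+b_{2n+1}T^{2n+1}$. Then $\mathrm{ord}_pb_m=\frac{m(m-1)}{2n}$ for $m\in\{1,n,n+1,2n,2n+1\}$.
   Context: $\mathrm{ord}_p(p)=1$; $\mathbb{Z}_q$ is the ring of integers of the unramified extension $\mathbb{Q}_q$ of $\mathbb{Q}_p$ of degree $a$, with Frobenius $\sigma$ extended to $\mathbb{Q}_q(\zeta_p,\widetilde\gamma)$ fixing $\zeta_p,\widetilde\gamma$. Let $\gamma\in\mathbb{C}_p$ be a root of $\sum_{k\ge0}x^{p^k}/p^k$ with $\mathrm{ord}_p\gamma=\frac1{p-1}$, $\widetilde\gamma^n=\gamma$, $\Theta(x)=\exp(\sum_{k\ge0}(\gamma x)^{p^k}/p^k)$, $\bar t\in\mathbb{Z}_q$ the Teichmüller lift of $t$, $F_t=\Theta(x^n)\Theta(y)\Theta(\bar t/(xy))$. Weight $\omega(a,b)=\frac an+b+\frac{2n+1}n\max\{0,-a,-b\}$. $\mathcal{C}_0$ is the space of series $\sum_{(a,b)}\xi(a,b)\widetilde\gamma^{n\omega(a,b)}x^ay^b$, $\xi(a,b)\in\mathbb{Z}_q[\widetilde\gamma]$, $|\xi(a,b)|_p\to0$ as $\omega(a,b)\to\infty$. $\alpha_1=\sigma^{-1}\circ\psi_p\circ F_t$ on $\mathcal{C}_0$, with $\psi_p(\sum c_{a,b}x^ay^b)=\sum c_{pa,pb}x^ay^b$.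 With $\gamma_i=\sum_{k=0}^i\gamma^{p^k}/p^k$: $D_x=x\partial_x+\sum_{i\ge0}\gamma_ip^i(nx^{np^i}-\sigma^i(\bar t)x^{-p^i}y^{-p^i})$, $D_y=y\partial_y+\sum_{i\ge0}\gamma_ip^i(y^{p^i}-\sigma^i(\bar t)x^{-p^i}y^{-p^i})$. $\varepsilon_i=x^i$ ($0\le i\le n$), $\varepsilon_i=x^{i-n}y$ ($n+1\le i\le2n$), $\widetilde\varepsilon_i=\widetilde\gamma^i\varepsilon_i$. One has $\mathcal{C}_0=\bigoplus_{i=0}^{2n}\mathbb{Z}_q[\widetilde\gamma]\widetilde\varepsilon_i\oplus(D_x\mathcal{C}_0+D_y\mathcal{C}_0)$; define $\widetilde A(\widetilde\varepsilon_j,\widetilde\varepsilon_i)$ by $\alpha_1(\widetilde\varepsilon_i)\equiv\sum_j\widetilde A(\widetilde\varepsilon_j,\widetilde\varepsilon_i)\widetilde\varepsilon_j\pmod{D_x\mathcal{C}_0+D_y\mathcal{C}_0}$, and let $A=(A_{ij})_{0\le i,j\le2n}$ with $A_{ij}=\widetilde A(\widetilde\varepsilon_j,\widetilde\varepsilon_i)$. *)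

(* Defs.v *)
From HB Require Import structures.
From mathcomp Require Import all_boot all_order all_algebra finmap.
From mathcomp Require Import all_classical all_reals all_analysis.
From mathcomp Require summability.

Set Implicit Arguments.
Unset Strict Implicit.
Unset Printing Implicit Defensive.

Import Order.TTheory GRing.Theory Num.Theory.
Import numFieldNormedType.Exports.

Local Open Scope classical_set_scope.
Local Open Scope ring_scope.

Definition algebraic_over (K : fieldType) (E : set K) : set K :=
  [set x | exists P : {poly K}, [/\ P != 0, P \is a polyOver [in E] & root P x]].

Definition abv_closure (R : realType) (K : fieldType) (abv : K -> R)
    (E : set K) : set K :=
  [set x | forall e : R, 0 < e -> exists2 y, E y & abv (x - y) < e].

Definition abv_cvg (R : realType) (K : fieldType) (abv : K -> R)
    (I : Type) (D : set_system I) (f : I -> K) (l : K) :=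
  abv (f i - l) @[i --> D] --> (0 : R).

Definition abv_complete (R : realType) (K : fieldType) (abv : K -> R) :=
  forall u : nat -> K,
    (forall e : R, 0 < e -> exists N, forall i j,
       (N <= i)%N -> (N <= j)%N -> abv (u i - u j) < e) ->
    exists l, abv_cvg abv \oo u l.

(** A field of type [padicComplexType R p] is a copy of C_p: it is algebraically
    closed and complete for a non-archimedean absolute value [pabs] extending
    the p-adic absolute value of Q, and the elements algebraic over Q_p (the
    closure of Q) are dense in it.  So it is the completion of an algebraic
    closure of Q_p.  The class [NormedZmodule] cannot be used for [pabs], because
    it requires the norm of [x *+ k] to be [k] times the norm of [x]. *)
HB.mixin Record isPadicComplex (R : realType) (p : nat) K of GRing.Field K := {
  pabs : K -> R;
  pabs_ge0 : forall x : K, 0 <= pabs x;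
  pabs_eq0 : forall x : K, pabs x = 0 -> x = 0;
  pabsM : forall x y : K, pabs (x * y) = pabs x * pabs y;
  pabsD_max : forall x y : K, pabs (x + y) <= Num.max (pabs x) (pabs y);
  pabs_p : pabs p%:R = p%:R^-1;
  pabs_complete : abv_complete pabs;
  padic_closed : GRing.closed_field_axiom K;
  padic_dense :
    abv_closure pabs
      (algebraic_over (abv_closure pabs (range (@ratr K)))) = [set: K]
}.

#[short(type="padicComplexType")]
HB.structure Definition PadicComplex (R : realType) (p : nat) :=
  {K of GRing.Field K & isPadicComplex R p K}.

Section Padic.
Context {R : realType} {p : nat} {K : padicComplexType R p}.
Implicit Types (x c : K) (E : set K).

Definition pcvg (I : Type) (D : set_system I) (f : I -> K) (l : K) :=
  abv_cvg (@pabs R p K) D f l.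

(** Unconditional sum over a (possibly infinite) index type: the limit along
    the directed family of the finite subsets of the index type (0 by
    convention if there is no limit). *)
Definition usum (I : choiceType) (f : I -> K) : K :=
  xget 0 [set s | pcvg summability.totally (summability.partial_sum f) s].

Definition ordp x : \bar R :=
  if x == 0 then +oo%E else (- (ln (pabs x) / ln p%:R))%:E.

Definition Qp : set K := abv_closure (@pabs R p K) (range (@ratr K)).

Definition is_subfield E := divring_closed [in E].

Definition has_degree (a : nat) E :=
  exists e : 'I_a -> K, (forall i, E (e i)) /\
    forall x, E x -> exists! c : {ffun 'I_a -> K},
      (forall i, Qp (c i)) /\ x = \sum_i c i * e i.

(** Unramified means that E and Q_p have the same value group; the residue
    field of Q_p is perfect, so nothing needs to be said on separability. *)
Definition is_unramified_ext (a : nat) E :=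
  [/\ is_subfield E, Qp `<=` E, has_degree a E & pabs @` E = pabs @` Qp].

Definition integers E : set K := E `&` [set x | pabs x <= 1].

Definition is_reduction E (F : fieldType) (red : K -> F) :=
  [/\ red 1 = 1,
      {in integers E &, {morph red : x y / x + y}},
      {in integers E &, {morph red : x y / x * y}} &
      red @` integers E = [set: F]].

Definition is_teichmuller (q : nat) E (F : fieldType) (red : K -> F)
    (t : F) (tbar : K) :=
  [/\ integers E tbar, tbar ^+ q = tbar & red tbar = t].

Definition adjoin E (G : set K) : set K := smallest is_subfield (E `|` G).

(** [sigma] restricts to an automorphism of E(zeta, gammat) which is the
    Frobenius on the unramified extension E and fixes zeta and gammat. *)
Definition is_frobenius E (zeta gammat : K) (sigma : K -> K) :=
  let L := adjoin E [set zeta; gammat] in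
  [/\ set_bij L L sigma,
      {in L &, {morph sigma : x y / x + y}} /\
      {in L &, {morph sigma : x y / x * y}},
      {in Qp, forall x, sigma x = x},
      (forall x, integers E x ->
         exists2 y, integers E y & sigma x = x ^+ p + p%:R * y) &
      sigma zeta = zeta /\ sigma gammat = gammat].

(** Doubly infinite Laurent series in x, y, given by their coefficients; the
    index [u] stands for the monomial x^u.1 y^u.2. *)
Definition laurent : Type := int * int -> K.

Definition lmonom (u : int * int) : laurent := fun v => (v == u)%:R.

Definition lmul (f g : laurent) : laurent :=
  fun u => usum (fun v : int * int => f v * g (u - v)).

(** The power series [th] evaluated at c x^u.1 y^u.2, where u <> 0. *)
Definition lsubst (th : nat -> K) (c : K) (u : int * int) : laurent :=
  fun v => usum (fun i : nat => if u *+ i == v then th i * c ^+ i else 0).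

(** Coefficients of exp(g(x)) for a power series g with g(0) = 0; since x^m
    divides g(x)^m, only m <= i contributes to the coefficient of x^i. *)
Definition fps_exp (g : nat -> K) (i : nat) : K :=
  \sum_(m < i.+1) ((\poly_(j < i.+1) g j) ^+ m)`_i / m`!%:R.

Definition AH_term (gamma : K) (k : nat) : K := gamma ^+ (p ^ k) / p%:R ^+ k.

(** Each j is p^k for at most one k, and then k <= j. *)
Definition Theta (gamma : K) : nat -> K :=
  fps_exp (fun j => \sum_(k < j.+1 | j == (p ^ k)%N) AH_term gamma k).

Definition F_t (n : nat) (gamma tbar : K) : laurent :=
  lmul (lmul (lsubst (Theta gamma) 1 (n%:Z, 0))
             (lsubst (Theta gamma) 1 (0, 1)))
       (lsubst (Theta gamma) tbar (-1, -1)).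

Definition omega (n : nat) (u : int * int) : rat :=
  u.1%:~R / n%:R + u.2%:~R
  + (2 * n + 1)%:R / n%:R * (Num.max 0 (Num.max (- u.1) (- u.2)))%:~R.

Definition n_omega (n : nat) (u : int * int) : int :=
  u.1 + n%:Z * u.2
  + (2 * n + 1)%N%:Z * Num.max 0 (Num.max (- u.1) (- u.2)).

Lemma n_omegaE (n : nat) (u : int * int) : (0 < n)%N ->
  (n_omega n u)%:~R = n%:R * omega n u.
Proof.
move=> n0; have n1 : n%:R != 0 :> rat by rewrite pnatr_eq0 -lt0n.
rewrite /n_omega /omega !mulrDr [n%:R * (u.1%:~R / _)]mulrC divfK //.
by rewrite mulrA [n%:R * (_ / _)]mulrC divfK // 2!intrD 2!intrM.
Qed.

(** Z_q[gammat], where Z_q is the ring of integers of E. *)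
Definition Zq_adjoin E (gammat : K) : set K :=
  [set x | exists2 P : {poly K},
     P \is a polyOver [in integers E] & x = P.[gammat]].

Definition C0 (n : nat) E (gammat : K) : set laurent :=
  [set f | exists xi : int * int -> K,
    [/\ forall u, Zq_adjoin E gammat (xi u),
        forall e : R, 0 < e -> exists N : rat,
          forall u, N <= omega n u -> pabs (xi u) < e &
        forall u, f u = xi u * gammat ^ n_omega n u]].

Definition psi_p (f : laurent) : laurent := fun u => f (u *+ p).

Definition alpha1 (n : nat) E (gamma gammat zeta tbar : K) (sigma : K -> K)
    (f : laurent) : laurent :=
  fun u => 'pinv_id (adjoin E [set zeta; gammat]) sigma
             (psi_p (lmul (F_t n gamma tbar) f) u).

Definition gamma_ (gamma : K) (i : nat) : K := \sum_(k < i.+1) AH_term gamma k.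

(** The Laurent series sum_i gamma_i p^i (c w^{p^i} - sigma^i(tbar) (xy)^{-p^i}),
    where w is the monomial of exponent u. *)
Definition Hseries (gamma tbar : K) (sigma : K -> K) (c : K) (u : int * int) :
    laurent :=
  fun v => usum (fun i : nat => gamma_ gamma i * p%:R ^+ i *
    (c * lmonom (u *+ p ^ i) v
     - iter i sigma tbar * lmonom ((-1, -1) *+ p ^ i) v)).

Definition D_x (n : nat) (gamma tbar : K) (sigma : K -> K) (f : laurent) :
    laurent :=
  fun v => v.1%:~R * f v
           + lmul (Hseries gamma tbar sigma n%:R (n%:Z, 0)) f v.

Definition D_y (gamma tbar : K) (sigma : K -> K) (f : laurent) : laurent :=
  fun v => v.2%:~R * f v + lmul (Hseries gamma tbar sigma 1 (0, 1)) f v.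

Definition eps (n i : nat) : laurent :=
  if (i <= n)%N then lmonom (i%:Z, 0) else lmonom ((i - n)%N%:Z, 1).

Definition epst (n : nat) (gammat : K) (i : nat) : laurent :=
  fun u => gammat ^+ i * eps n i u.

(** [A i j] is the coefficient of [epst j] in [alpha1 (epst i)] modulo
    D_x C_0 + D_y C_0. *)
Definition is_frobenius_matrix (n : nat) E (gamma gammat zeta tbar : K)
    (sigma : K -> K) (A : 'M[K]_((2 * n).+1)) :=
  (forall i j, Zq_adjoin E gammat (A i j)) /\
  forall i : 'I_(2 * n).+1, exists g h : laurent,
    [/\ C0 n E gammat g, C0 n E gammat h &
      forall u, alpha1 n E gamma gammat zeta tbar sigma (epst n gammat i) u =
        \sum_j A i j * epst n gammat j u
        + (D_x n gamma tbar sigma g u + D_y gamma tbar sigma h u)].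

End Padic.

Arguments laurent {R p} K.

(* Main.v *)
Require Import Defs.
From HB Require Import structures.
From mathcomp Require Import all_boot all_order all_algebra perm finfield finmap.
From mathcomp Require Import all_classical all_reals all_analysis.
From mathcomp Require Import zify ring lra.
From mathcomp Require summability.

Set Implicit Arguments.
Unset Strict Implicit.
Unset Printing Implicit Defensive.

Import Order.TTheory GRing.Theory Num.Theory.

Local Open Scope classical_set_scope.
Local Open Scope ring_scope.

(** Write pi for [gammat], so that |pi|^(n(p-1)) = 1/p.  For every j <= 2n there is
    a functional l_j on series which kills D_x C_0 + D_y C_0, takes the value
    delta_ij / pi^j at [eps i], and satisfies
    |l_j(x^u)| <= |pi|^((p-1)(j-w) + 1 - w) or |pi|^(-w), according to whether the
    scaled weight w = n omega(u) is below j or not.  It is the fixed point of a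
    contraction obtained by solving, for each exponent off the basis, one equation
    of D_x or D_y for its dominant term; the remaining equations hold because D_x
    and D_y commute.  Hence A_ij = l_j(alpha_1(pi^i eps_i)), and the coefficients of
    F_t give |A_ij| <= |pi|^((p-1)j), with equality if pj = i mod n and i, j lie in
    the same block {0}, {1..n} or {n+1..2n}, and with strict inequality unless
    pj = i mod n and the block of i does not come after that of j.

    Expand the m-th coefficient of det(1 - AT) over the pairs of a permutation s and
    an m-element set J outside of which s is the identity.  If {0..m-1} is stable
    under multiplication by p modulo n inside the blocks, which holds for the given
    m, then a single pair gives a term of largest absolute value: J = {0..m-1}, with
    s this multiplication.  Its absolute value is |pi|^((p-1)m(m-1)/2). *)

(** * The absolute value *)

(** Two operators give more equations than unknowns. The contraction needs two norms. The bound
    claimed for l_j is only preserved by the fixed point map, since several entries of an equation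
    can have the same size for it; strictness comes from a second weight, built on a rank that
    breaks these ties.

    The congruence pj = i mod n comes from the monomials x^n, y, 1/(xy) of F_t. A coefficient
    reaches the size given by its weight only if it uses as few factors 1/(xy) as possible, and then
    the power of x left over is a multiple of n. In the critical cases the size is attained, because
    the indices of the coefficients of [Theta] involved stay below p, where the Artin-Hasse
    coefficients are units.

    The inverse of sigma in alpha_1 is a separate obstacle: sigma is an algebraic automorphism with
    no continuity assumed, while the coefficients of F_t are infinite sums. They are shown to lie in
    sigma(Z_q[pi]), where norms are preserved. This rests on pi^(n(p-1)) lying in Q_p, which is
    extracted from the equation of gamma by rational approximation. *)

Section Abs.
Context {R : realType} {p : nat} {K : padicComplexType R p}.
Hypothesis p_prime : prime p.
Implicit Types (x y z : K) (C e : R).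

Lemma pabs1 : pabs (1 : K) = 1.
Proof.
have h : pabs (1 : K) * pabs (1 : K) = pabs (1 : K) by rewrite -pabsM mulr1.
have [h0|h0] := eqVneq (pabs (1 : K)) 0; last first.
  by apply: (mulfI h0); rewrite mulr1.
by move: (oner_neq0 K); rewrite (pabs_eq0 _ h0) eqxx.
Qed.

Lemma pabs0 : pabs (0 : K) = 0.
Proof.
apply/eqP/negPn/negP => h.
have : pabs (0 : K) * pabs (p%:R : K) = pabs (0 : K) * 1.
  by rewrite -pabsM mul0r mulr1.
move/(mulfI h); rewrite pabs_p => /(congr1 (fun x : R => x^-1)).
rewrite invrK invr1 => /eqP; rewrite -[1]/(1%:R) eqr_nat => /eqP p1.
by move: p_prime; rewrite p1.
Qed.

Lemma pabs_eq0E x : (pabs x == 0) = (x == 0).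
Proof. by apply/eqP/eqP => [/(@pabs_eq0 R p K)//|->]; rewrite pabs0. Qed.

Lemma pabs_gt0 x : (0 < pabs x) = (x != 0).
Proof. by rewrite lt_def pabs_ge0 andbT pabs_eq0E. Qed.

Lemma pabsV x : pabs x^-1 = (pabs x)^-1.
Proof.
have [->|x0] := eqVneq x 0; first by rewrite invr0 pabs0 invr0.
have h : pabs x != 0 by rewrite pabs_eq0E.
by apply: (mulfI h); rewrite -pabsM !divff // pabs1.
Qed.

Lemma pabs_div x y : pabs (x / y) = pabs x / pabs y.
Proof. by rewrite pabsM pabsV. Qed.

Lemma pabsX x k : pabs (x ^+ k) = pabs x ^+ k.
Proof. by elim: k => [|k IH]; rewrite ?expr0 ?pabs1 // !exprS pabsM IH. Qed.

Lemma pabsN x : pabs (- x) = pabs x.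
Proof.
rewrite -mulN1r pabsM.
have : pabs (-1 : K) ^+ 2 == 1 by rewrite -pabsX sqrrN expr1n pabs1.
rewrite sqrf_eq1 => /orP[/eqP->|/eqP h]; first by rewrite mul1r.
by have := pabs_ge0 (-1 : K); rewrite h lerNr oppr0 ler10.
Qed.

Lemma pabsB_sym x y : pabs (x - y) = pabs (y - x).
Proof. by rewrite -pabsN opprB. Qed.

Lemma pabsD_le x y C : pabs x <= C -> pabs y <= C -> pabs (x + y) <= C.
Proof. by move=> hx hy; apply: le_trans (pabsD_max _ _) _; rewrite ge_max hx. Qed.

Lemma pabsB_le x y C : pabs x <= C -> pabs y <= C -> pabs (x - y) <= C.
Proof. by move=> hx hy; apply: pabsD_le; rewrite ?pabsN. Qed.

Lemma pabsD_lt x y C : pabs x < C -> pabs y < C -> pabs (x + y) < C.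
Proof.
by move=> hx hy; apply: le_lt_trans (pabsD_max _ _) _; rewrite gt_max hx.
Qed.

Lemma pabs_sum_le (I : Type) (s : seq I) (P : pred I) (f : I -> K) C :
  0 <= C -> (forall i, P i -> pabs (f i) <= C) ->
  pabs (\sum_(i <- s | P i) f i) <= C.
Proof.
by move=> C0 h; apply: (big_ind (fun x => pabs x <= C)) => [|x y|//];
  [rewrite pabs0|exact: pabsD_le].
Qed.

Lemma pabs_sum_le_seq (I : eqType) (s : seq I) (f : I -> K) C :
  0 <= C -> (forall i, i \in s -> pabs (f i) <= C) ->
  pabs (\sum_(i <- s) f i) <= C.
Proof. by move=> C0 h; rewrite big_seq; apply: pabs_sum_le. Qed.

Lemma pabs_dominant x y : pabs y < pabs x -> pabs (x + y) = pabs x.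
Proof.
move=> h; apply/eqP; rewrite eq_le; apply/andP; split.
  by apply: pabsD_le => //; exact: ltW.
rewrite leNgt; apply/negP => h'; have : pabs (x + y - y) < pabs x.
  by apply: pabsD_lt => //; rewrite pabsN.
by rewrite addrK ltxx.
Qed.

Lemma pabs_nat_le1 k : pabs (k%:R : K) <= 1.
Proof.
elim: k => [|k IH]; first by rewrite pabs0 ler01.
by rewrite -addn1 natrD; apply: pabsD_le; rewrite ?pabs1.
Qed.

Lemma pabs_int_le1 (z : int) : pabs (z%:~R : K) <= 1.
Proof.
case: z => k; first exact: pabs_nat_le1.
by rewrite NegzE mulrNz pabsN; exact: pabs_nat_le1.
Qed.

Lemma pabs_p_lt1 : pabs (p%:R : K) < 1.
Proof. by rewrite pabs_p invf_lt1 ?ltr1n ?prime_gt1 // ltr0n prime_gt0. Qed.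

Lemma pabs_nat_coprime k : coprime p k -> pabs (k%:R : K) = 1.
Proof.
move=> cop; apply/eqP; rewrite eq_le pabs_nat_le1 /= leNgt; apply/negP => h.
have [u v e _] := egcdnP k (prime_gt0 p_prime).
move: e; rewrite (eqP cop) addn1 => e.
have : pabs (1 : K) < 1.
  have -> : (1 : K) = (u * p)%:R - (v * k)%:R.
    by rewrite e -addn1 natrD [_ + 1]addrC addrK.
  rewrite !natrM; apply: pabsD_lt; rewrite ?pabsN pabsM.
    by apply: le_lt_trans pabs_p_lt1; rewrite ler_piMl ?pabs_ge0 ?pabs_nat_le1.
  by apply: le_lt_trans h; rewrite ler_piMl ?pabs_ge0 ?pabs_nat_le1.
by rewrite pabs1 ltxx.
Qed.

Lemma pabs_nat_lt k : (0 < k < p)%N -> pabs (k%:R : K) = 1.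
Proof.
case/andP => k0 kp; apply: pabs_nat_coprime.
by rewrite prime_coprime // gtnNdvd.
Qed.

Lemma pabs_natE k : (0 < k)%N -> pabs (k%:R : K) = p%:R ^- logn p k.
Proof.
move=> k0; have [m cop {1}->] := pfactor_coprime p_prime k0.
by rewrite natrM pabsM natrX pabsX pabs_p exprVn pabs_nat_coprime ?mul1r.
Qed.

Lemma natr_neq0 k : (0 < k)%N -> (k%:R : K) != 0.
Proof.
move=> k0; rewrite -pabs_gt0 pabs_natE // invr_gt0 exprn_gt0 //.
by rewrite ltr0n prime_gt0.
Qed.

Lemma intr_eq0K (z : int) : ((z%:~R : K) == 0) = (z == 0).
Proof.
case: z => [[|k]|k] //; first by rewrite [LHS]eqxx.
  by rewrite -[Posz k.+1%N]/(k.+1%:Z) (negbTE (natr_neq0 (ltn0Sn k))).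
by rewrite NegzE mulrNz oppr_eq0 (negbTE (natr_neq0 (ltn0Sn k))).
Qed.

Lemma pabs_cases (x : K) : range (@ratr K) x -> x != 0 ->
  exists z : int, pabs x = (p%:R : R) ^ z.
Proof.
case=> q _ <- q0; rewrite /ratr pabs_div.
have int_case (d : int) : d != 0 -> exists z : int, pabs (d%:~R : K) = (p%:R : R) ^ z.
  move=> d0; exists (- (logn p `|d|)%:Z).
  have -> : pabs (d%:~R : K) = pabs (`|d|%N%:R : K).
    by case: (d) => k //; rewrite NegzE mulrNz pabsN abszN.
  by rewrite pabs_natE ?absz_gt0 // exprnN.
have n0 : numq q != 0 by apply: contraNneq q0 => h; rewrite /ratr h mul0r.
have [z1 ->] := int_case _ n0; have [z2 ->] := int_case _ (denq_neq0 q).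
exists (z1 - z2); rewrite expfzDr ?invr_expz //.
by rewrite pnatr_eq0 -lt0n prime_gt0.
Qed.

End Abs.

(** * Unconditional sums *)

Section Psum.
Context {R : realType} {p : nat} {K : padicComplexType R p}.
Hypothesis p_prime : prime p.

(** Since [usum] defaults to 0 without a limit, an equation for it says nothing about convergence;
    this relation records convergence and value together. The non-strict bound is the one that
    ultrametric estimates carry to the limit unchanged. *)
Definition psum (I : choiceType) (f : I -> K) (s : K) :=
  forall e : R, 0 < e -> exists A : {fset I}, forall B : {fset I},
    (A `<=` B)%fset -> pabs (\sum_(i <- B) f i - s) <= e.

Definition null_family (I : choiceType) (f : I -> K) :=
  forall e : R, 0 < e -> exists A : {fset I}, forall i, i \notin A -> pabs (f i) <= e.

Lemma le_eps0 (x : R) : 0 <= x -> (forall e, 0 < e -> x <= e) -> x = 0.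
Proof.
move=> x0 h; apply/eqP; rewrite eq_le x0 andbT leNgt; apply/negP => xp.
by have := h (x / 2) (divr_gt0 xp (ltr0Sn _ 1)); lra.
Qed.

Lemma pabs_small_eq (x y : K) :
  (forall e : R, 0 < e -> pabs (x - y) <= e) -> x = y.
Proof.
move=> h; apply/eqP; rewrite -subr_eq0 -(pabs_eq0E p_prime); apply/eqP.
exact: le_eps0 (pabs_ge0 _) h.
Qed.

Lemma psum_unique (I : choiceType) (f : I -> K) s t :
  psum f s -> psum f t -> s = t.
Proof.
move=> hs ht; apply: pabs_small_eq => e e0.
have [A hA] := hs _ e0; have [B hB] := ht _ e0.
have -> : s - t = (\sum_(i <- (A `|` B)%fset) f i - t)
                  - (\sum_(i <- (A `|` B)%fset) f i - s) by ring.
by apply: pabsB_le; [apply: hB; exact: fsubsetUr|apply: hA; exact: fsubsetUl].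
Qed.

Lemma psum_pcvg (I : choiceType) (f : I -> K) s :
  psum f s <-> pcvg summability.totally (summability.partial_sum f) s.
Proof.
have E (B : {fset I}) : summability.partial_sum f B = \sum_(i <- B) f i.
  by rewrite /summability.partial_sum big_seq_fsetE.
have F := @summability.totally_filter I.
split=> [h|h e e0].
  apply/cvgrPdist_le => e e0; have [A hA] := h _ e0.
  exists A => // B /= AB; rewrite sub0r normrN ger0_norm ?pabs_ge0 // E.
  exact: hA.
have /cvgrPdist_le/(_ _ e0) [A _ hA] := h.
exists A => B AB; have := hA B AB.
by rewrite sub0r normrN ger0_norm ?pabs_ge0 // E.
Qed.

Lemma psum_usumE (I : choiceType) (f : I -> K) s : psum f s -> usum f = s.
Proof.
move=> h; rewrite /usum; case: xgetP => [x _ /= hx|/(_ s) /=].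
  by apply: (psum_unique (f := f)) => //; apply/psum_pcvg.
by case; apply/psum_pcvg.
Qed.

Lemma sum_fsetD (I : choiceType) (f : I -> K) (A B : {fset I}) : (A `<=` B)%fset ->
  \sum_(i <- B) f i - \sum_(i <- A) f i = \sum_(i <- B | i \notin A) f i.
Proof.
move=> AB; rewrite (bigID (mem A)) /= -big_filter.
have -> : \sum_(i <- [seq i <- B | i \in A]) f i = \sum_(i <- A) f i.
  apply: perm_big; apply: uniq_perm; rewrite ?filter_uniq ?fset_uniq // => i.
  by rewrite mem_filter; apply: andb_idr; apply: (fsubsetP AB).
by rewrite [X in X - _]addrC addrK.
Qed.

Lemma sum_off_le (I : choiceType) (f : I -> K) (A B : {fset I}) (e : R) : 0 <= e ->
  (forall i, i \notin A -> pabs (f i) <= e) -> (A `<=` B)%fset ->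
  pabs (\sum_(i <- B) f i - \sum_(i <- A) f i) <= e.
Proof. by move=> e0 h AB; rewrite sum_fsetD //; apply: pabs_sum_le. Qed.

Lemma inv_succ_small (e : R) : 0 < e -> exists n : nat, forall m, (n <= m)%N -> m.+1%:R^-1 <= e.
Proof.
move=> e0; exists (Num.bound e^-1) => m nm.
rewrite invf_ple ?posrE ?ltr0n //.
have h : e^-1 < (Num.bound e^-1)%:R by rewrite archi_boundP // invr_ge0 ltW.
by apply: le_trans (ltW h) _; rewrite ler_nat; apply: leqW.
Qed.

(** The ultrametric inequality carries the explicit rate [b] over to the limit itself. The rate, not
    just convergence, is what the later constructions use. *)
Lemma cauchy_limit (u : nat -> K) (b : nat -> R) :
  (forall e, 0 < e -> exists N, forall m, (N <= m)%N -> b m <= e) ->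
  (forall i j, (i <= j)%N -> pabs (u j - u i) <= b i) ->
  exists l, forall i, pabs (l - u i) <= b i.
Proof.
move=> hb hu.
have [|l hl] := @pabs_complete R p K u.
  move=> e e0; have [N hN] := hb _ (divr_gt0 e0 (ltr0Sn _ 1)); exists N => i j Ni Nj.
  have h k : (N <= k)%N -> pabs (u k - u N) < e.
    by move=> Nk; apply: le_lt_trans (le_trans (hu _ _ Nk) (hN _ (leqnn N))) _; lra.
  have -> : u i - u j = (u i - u N) + - (u j - u N) by ring.
  by apply: pabsD_lt; rewrite ?pabsN; apply: h.
exists l => i; rewrite leNgt; apply/negP => h.
have e0 : 0 < pabs (l - u i) - b i by rewrite subr_gt0.
have /cvgrPdist_lt/(_ (pabs (l - u i))) := hl.
case=> [|N _ hN].
  by apply: le_lt_trans h; apply: le_trans (hu _ _ (leqnn i)); exact: pabs_ge0.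
have := hN (maxn N i) (leq_maxl _ _).
rewrite /= sub0r normrN ger0_norm ?pabs_ge0 // => h1.
have : pabs (l - u i) < pabs (l - u i).
  have {1}-> : l - u i = - (u (maxn N i) - l) + (u (maxn N i) - u i) by ring.
  apply: pabsD_lt; rewrite ?pabsN //.
  by apply: le_lt_trans h; apply: hu; exact: leq_maxr.
by rewrite ltxx.
Qed.

(** In a complete ultrametric field terms tending to 0 suffice: enlarging a finite set that contains
    all the large terms changes the sum by at most the largest added term. *)
Lemma null_psum (I : choiceType) (f : I -> K) : null_family f -> psum f (usum f).
Proof.
move=> hf; suff [s hs] : exists s, psum f s by rewrite (psum_usumE hs).
have /choice [A hA] : forall n : nat, exists A : {fset I},
    forall i, i \notin A -> pabs (f i) <= n.+1%:R^-1.
  by move=> n; apply: hf; rewrite invr_gt0 ltr0n.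
(* The sets [A n] need not be nested. Their successive unions are, which makes the sums over them a
   Cauchy sequence. *)
pose B := fix B n := if n is m.+1 then (B m `|` A n)%fset else A 0%N.
have AB n : (A n `<=` B n)%fset by case: n => [|n] /=; rewrite ?fsubset_refl ?fsubsetUr.
have BB i j : (i <= j)%N -> (B i `<=` B j)%fset.
  move=> /subnK <-; elim: (j - i)%N => [|k IH]; first exact: fsubset_refl.
  by apply: fsubset_trans IH _; exact: fsubsetUl.
have hB n i : i \notin B n -> pabs (f i) <= n.+1%:R^-1.
  by move=> h; apply: hA; apply: contra h; apply: (fsubsetP (AB n)).
have [|i j ij|l hl] := @cauchy_limit (fun n => \sum_(i <- B n) f i) (fun n => n.+1%:R^-1).
- by move=> e e0; exact: inv_succ_small.
- by apply: sum_off_le (hB i) (BB _ _ ij); rewrite invr_ge0 ler0n.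
exists l => e e0; have [n hn] := inv_succ_small e0; exists (B n) => C BC.
have -> : \sum_(i <- C) f i - l
    = (\sum_(i <- C) f i - \sum_(i <- B n) f i) - (l - \sum_(i <- B n) f i) by ring.
apply: le_trans (hn n (leqnn n)).
by apply: pabsB_le (hl n); apply: sum_off_le (hB n) BC; rewrite invr_ge0 ler0n.
Qed.

Lemma psum_le (I : choiceType) (f : I -> K) s (C : R) : 0 <= C ->
  psum f s -> (forall i, pabs (f i) <= C) -> pabs s <= C.
Proof.
move=> C0 hs hf; rewrite leNgt; apply/negP => h.
have [A /(_ A (fsubset_refl A)) hA] := hs _ (le_lt_trans C0 h).
pose e := C; have /eqP s0 : s != 0 by rewrite -(pabs_gt0 p_prime) (le_lt_trans C0).
have e0 : 0 < pabs s / 2 by apply: divr_gt0 => //; exact: le_lt_trans h.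
have [{hA} A /(_ A (fsubset_refl A)) hA] := hs _ e0.
have : pabs s < pabs s.
  have {1}-> : s = \sum_(i <- A) f i - (\sum_(i <- A) f i - s) by ring.
  apply: pabsD_lt; first by apply: le_lt_trans h; apply: pabs_sum_le.
  by rewrite pabsN; apply: le_lt_trans hA _; lra.
by rewrite ltxx.
Qed.

Lemma psum_eq (I : choiceType) (f g : I -> K) s : f =1 g -> psum f s -> psum g s.
Proof. by move=> /funext ->. Qed.

Lemma psumD (I : choiceType) (f g : I -> K) s t :
  psum f s -> psum g t -> psum (fun i => f i + g i) (s + t).
Proof.
move=> hs ht e e0; have [A hA] := hs _ e0; have [B hB] := ht _ e0.
exists (A `|` B)%fset => C; rewrite fsubUset => /andP[AC BC].
by rewrite big_split /= opprD addrACA; apply: pabsD_le; [apply: hA|apply: hB].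
Qed.

Lemma psumZ (I : choiceType) (f : I -> K) s c :
  psum f s -> psum (fun i => c * f i) (c * s).
Proof.
move=> hs e e0; have [->|c0] := eqVneq c 0.
  by exists fset0 => B _; rewrite mul0r big1 ?subr0 ?pabs0 ?ltW // => i; rewrite mul0r.
have cp : 0 < pabs c by rewrite pabs_gt0.
have [A hA] := hs _ (divr_gt0 e0 cp); exists A => B AB.
by rewrite -mulr_sumr -mulrBr pabsM mulrC -ler_pdivlMr //; apply: hA.
Qed.

Lemma psumN (I : choiceType) (f : I -> K) s :
  psum f s -> psum (fun i => - f i) (- s).
Proof. by move=> /(psumZ (-1)); rewrite mulN1r; apply: psum_eq => i; rewrite mulN1r. Qed.

Lemma psumB (I : choiceType) (f g : I -> K) s t :
  psum f s -> psum g t -> psum (fun i => f i - g i) (s - t).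
Proof. by move=> hs /psumN; exact: psumD. Qed.

Lemma psum_finite (I : choiceType) (f : I -> K) (A : {fset I}) :
  (forall i, i \notin A -> f i = 0) -> psum f (\sum_(i <- A) f i).
Proof.
move=> h e e0; exists A => B AB; rewrite sum_fsetD //.
by rewrite big1 ?pabs0 ?ltW.
Qed.

Lemma psum_single (I : choiceType) (f : I -> K) i0 :
  (forall i, i != i0 -> f i = 0) -> psum f (f i0).
Proof.
move=> h; have := @psum_finite I f [fset i0]%fset.
by rewrite big_seq_fset1; apply => i; rewrite inE; exact: h.
Qed.

Lemma usum_single (I : choiceType) (f : I -> K) i0 :
  (forall i, i != i0 -> f i = 0) -> usum f = f i0.
Proof. by move=> /psum_single/psum_usumE. Qed.

Lemma psum_zero (I : choiceType) (f : I -> K) : (forall i, f i = 0) -> psum f 0.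
Proof.
by move=> h; have := @psum_finite I f fset0; rewrite big_seq_fset0; apply => i _.
Qed.

Lemma psum_sum (I J : choiceType) (r : seq J) (f : J -> I -> K) (s : J -> K) :
  (forall j, psum (f j) (s j)) ->
  psum (fun i => \sum_(j <- r) f j i) (\sum_(j <- r) s j).
Proof.
move=> h; elim: r => [|j r IH].
  by rewrite big_nil; apply: psum_zero => i; rewrite big_nil.
by rewrite big_cons; apply: psum_eq (psumD (h j) IH) => i; rewrite big_cons.
Qed.

Lemma psum_isolate (I : choiceType) (f : I -> K) s i0 :
  psum f s -> psum (fun i => if i == i0 then 0 else f i) (s - f i0).
Proof.
move=> hs.
have h := @psum_single I (fun i => if i == i0 then f i else 0) i0.
move: h; rewrite /= eqxx => h.
apply: psum_eq (psumB hs (h _)) => [i|i /negbTE -> //].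
by case: ifP; rewrite ?subrr ?subr0.
Qed.

Lemma psum_dominant (I : choiceType) (f : I -> K) s i0 (C : R) : 0 <= C ->
  psum f s -> (forall i, i != i0 -> pabs (f i) <= C) -> pabs (s - f i0) <= C.
Proof.
move=> C0 hs h; apply: psum_le (psum_isolate i0 hs) _ => // i.
by have [_|/h //] := eqVneq i i0; rewrite pabs0.
Qed.

Lemma psum_reindex (I J : choiceType) (h : J -> I) (h' : I -> J) (f : I -> K) s :
  cancel h h' -> cancel h' h -> psum f s -> psum (fun j => f (h j)) s.
Proof.
move=> hK h'K hs e e0; have [A hA] := hs _ e0.
exists [fset h' x | x in A]%fset => B AB.
have -> : \sum_(j <- B) f (h j) = \sum_(i <- [fset h x | x in B]%fset) f i.
  by rewrite big_imfset //= => x y _ _ /(can_inj hK).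
apply: hA; apply/fsubsetP => i iA; apply/imfsetP; exists (h' i); rewrite ?h'K //=.
by apply: (fsubsetP AB); apply: in_imfset.
Qed.

(** For a finite set of rows one finite set of columns serves all of them. The errors of the rows do
    not add up, by the ultrametric inequality, so each row may converge at its own rate. *)
Lemma psum_fubini (I J : choiceType) (f : I -> J -> K) (g : I -> K) s :
  psum (fun u : I * J => f u.1 u.2) s -> (forall i, psum (f i) (g i)) -> psum g s.
Proof.
move=> hs hg e e0; have [A hA] := hs _ e0.
exists [fset u.1 | u in A]%fset => B AB.
have /choice [D hD] : forall i, exists D : {fset J}, forall C,
    (D `<=` C)%fset -> pabs (\sum_(j <- C) f i j - g i) <= e.
  by move=> i; apply: hg.
pose C := ([fset u.2 | u in A] `|` \bigcup_(i <- B) D i)%fset.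
have hC i : i \in B -> (D i `<=` C)%fset.
  move=> iB; apply: fsubset_trans (fsubsetUr _ _).
  exact: (@bigfcup_sup _ _ _ i).
have -> : \sum_(i <- B) g i - s = (\sum_(i <- B) \sum_(j <- C) f i j - s)
    - \sum_(i <- B) (\sum_(j <- C) f i j - g i).
  by rewrite sumrB; ring.
apply: pabsB_le.
  have -> : \sum_(i <- B) \sum_(j <- C) f i j = \sum_(u <- (B `*` C)%fset) f u.1 u.2.
    by rewrite big_imfset2 //= => -[? ?] [? ?] _ _ /= [-> ->].
  apply: hA; apply/fsubsetP => u uA; rewrite in_fsetM; apply/andP; split.
    by apply: (fsubsetP AB); apply: in_imfset.
  by apply/fsetUP; left; apply: in_imfset.
apply: pabs_sum_le_seq; rewrite ?ltW // => i iB.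
by apply: hD; apply: hC.
Qed.

(** Off the finite set of pairs with x in A and y - x in B one of the two factors is small, and the
    other is at most 1. *)
Lemma null_conv (V : zmodType) (a : V -> R) (b : V -> R)
   (f : V -> V -> K) (C : R) : 0 <= C ->
  (forall x, 0 <= a x <= 1) -> (forall x, 0 <= b x <= 1) ->
  (forall e, 0 < e -> exists A : {fset V}, forall x, x \notin A -> a x <= e) ->
  (forall e, 0 < e -> exists A : {fset V}, forall x, x \notin A -> b x <= e) ->
  (forall x y, pabs (f x y) <= C * (a x * b (y - x))) ->
  null_family (fun u : V * V => f u.1 u.2).
Proof.
move=> C0 ha hb na nb hf e e0.
have C1 : 0 < C + 1 by rewrite ltr_wpDl.
have [A hA] := na _ (divr_gt0 e0 C1); have [B hB] := nb _ (divr_gt0 e0 C1).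
exists [fset (x, (x + y)%R) | x in A, y in B]%fset => -[x y] /= hxy.
apply: le_trans (hf x y) _.
suff h : a x * b (y - x) <= e / (C + 1).
  apply: (@le_trans _ _ ((C + 1) * (a x * b (y - x)))).
    rewrite ler_wpM2r ?ler_wpDr // mulr_ge0 //; first by case/andP: (ha x).
    by case/andP: (hb (y - x)).
  by rewrite mulrC -ler_pdivlMr.
have /andP[a0 a1] := ha x; have /andP[b0 b1] := hb (y - x).
have [xA|xA] := boolP (x \in A); last first.
  by apply: le_trans (hA _ xA); rewrite ler_piMr.
have [yB|yB] := boolP (y - x \in B); last first.
  by apply: le_trans (hB _ yB); rewrite ler_piMl.
case/negP: hxy; apply/imfset2P; exists x => //=; exists (y - x) => //=.
by rewrite addrC subrK.
Qed.

End Psum.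

(** * Truncated power series and the Artin-Hasse exponential *)

Section EqX.
Context {A : comNzRingType}.
Implicit Types P Q : {poly A}.

(** Congruence modulo X^n. Identities of power series are proved on polynomial truncations of
    arbitrary order. *)
Definition eqX n P Q := forall k, (k < n)%N -> P`_k = Q`_k.

Lemma eqX_refl n P : eqX n P P. Proof. by []. Qed.

Lemma eqX_sym n P Q : eqX n P Q -> eqX n Q P.
Proof. by move=> h k kn; rewrite h. Qed.

Lemma eqX_trans n P Q S : eqX n P Q -> eqX n Q S -> eqX n P S.
Proof. by move=> h1 h2 k kn; rewrite h1 // h2. Qed.

Lemma eqXD n P Q P' Q' : eqX n P Q -> eqX n P' Q' -> eqX n (P + P') (Q + Q').
Proof. by move=> h1 h2 k kn; rewrite !coefD h1 // h2. Qed.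

Lemma eqXM n P Q P' Q' : eqX n P Q -> eqX n P' Q' -> eqX n (P * P') (Q * Q').
Proof.
move=> h1 h2 k kn; rewrite !coefM; apply: eq_bigr => -[j /= jk] _.
by rewrite h1 ?h2 //; [apply: leq_ltn_trans kn; exact: leq_subr
  | exact: leq_trans jk kn].
Qed.

Lemma eqX_exp n P Q m : eqX n P Q -> eqX n (P ^+ m) (Q ^+ m).
Proof. by move=> h; elim: m => [|m IH]; rewrite ?expr0 // !exprS; apply: eqXM. Qed.

Lemma eqX_sum n (I : Type) (s : seq I) (r : pred I) (F G : I -> {poly A}) :
  (forall i, r i -> eqX n (F i) (G i)) ->
  eqX n (\sum_(i <- s | r i) F i) (\sum_(i <- s | r i) G i).
Proof. by move=> h k kn; rewrite !coef_sum; apply: eq_bigr => i ri; apply: h. Qed.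

Lemma eqXZ n P Q c : eqX n P Q -> eqX n (c *: P) (c *: Q).
Proof. by move=> h k kn; rewrite !coefZ h. Qed.

Lemma eqX_Xderiv n P Q : eqX n P Q -> eqX n ('X * P^`()) ('X * Q^`()).
Proof. by move=> h [|k] kn; rewrite !coefXM //= !coef_deriv h. Qed.

Lemma eqX_comp n P Q m : (0 < m)%N ->
  eqX n P Q -> eqX n (P \Po 'X^m) (Q \Po 'X^m).
Proof.
move=> m0 h k kn; rewrite !coef_comp_poly_Xn //; case: ifP => // _.
by rewrite h // (leq_ltn_trans (leq_div _ _)).
Qed.

Lemma eqX_expX0 n P m : P`_0 = 0 -> (n <= m)%N -> eqX n (P ^+ m) 0.
Proof.
move=> P0 nm.
have -> : P = 'X * \poly_(i < size P) P`_i.+1.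
  apply/polyP => -[|k]; rewrite coefXM //= coef_poly.
  by case: ltnP => // h; rewrite nth_default // leqW.
move=> k kn; rewrite exprMn coefXnM coef0 ifT //.
exact: leq_trans kn nm.
Qed.

End EqX.

(** * Exponential series through the equation X B' = H B *)

Section ExpODE.
Context {R : realType} {p : nat} {K : padicComplexType R p}.
Hypothesis p_prime : prime p.
Implicit Types (g : nat -> K) (G : {poly K}).

Definition expt n G : {poly K} := \sum_(m < n) (m`!%:R)^-1 *: G ^+ m.

Lemma expt_deriv n G : (expt n.+1 G)^`() = G^`() * expt n G.
Proof.
elim: n => [|n IH].
  by rewrite /expt big_ord_recl !big_ord0 addr0 expr0 linearZ /= derivC scaler0 mulr0.
rewrite /expt big_ord_recr /= linearD /= -/(expt n.+1 G) IH.
rewrite [X in _ = _ * X]/expt big_ord_recr /= -/(expt n G) mulrDr; congr (_ + _).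
rewrite linearZ /= deriv_exp /= -scalerMnr scalerMnl -scalerAr; congr (_ *: _).
rewrite factS natrM invfM -mulr_natl mulrA divff ?mul1r //.
by apply: natr_neq0.
Qed.

Lemma expt_eqX n m M G G' : (n <= m)%N -> (n <= M)%N -> G`_0 = 0 -> eqX n G G' ->
  eqX n (expt m G) (expt M G').
Proof.
move=> nm nM G0 GG.
have h l (L : {poly K}) : (n <= l)%N -> L`_0 = 0 -> eqX n (expt l L) (expt n L).
  move=> nl L0; rewrite /expt -(subnKC nl) big_split_ord /=.
  rewrite -[X in eqX _ _ X]addr0; apply: eqXD; first exact: eqX_refl.
  move=> k kn; rewrite coef0 coef_sum big1 // => i _; rewrite coefZ.
  by rewrite (eqX_expX0 L0 _ kn) ?coef0 ?mulr0 // leq_addr.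
case: n nm nM GG h => [|n] nm nM GG h; first by move=> k; rewrite ltn0.
have G'0 : G'`_0 = 0 by rewrite -(GG 0%N).
apply: eqX_trans (h _ _ nm G0) _; apply: eqX_sym; apply: eqX_trans (h _ _ nM G'0) _.
by apply: eqX_sym; apply: eqX_sum => i _; apply: eqXZ; exact: eqX_exp.
Qed.

Lemma fps_exp_poly g n : g 0%N = 0 ->
  eqX n (\poly_(k < n) fps_exp g k) (expt n (\poly_(k < n) g k)).
Proof.
move=> g0 k kn; rewrite coef_poly kn /fps_exp.
have h : eqX k.+1 (expt k.+1 (\poly_(j < k.+1) g j)) (expt n (\poly_(j < n) g j)).
  apply: expt_eqX => //; first by rewrite coef_poly.
  by move=> j jk; rewrite !coef_poly jk (leq_trans jk kn).
rewrite -(h k (ltnSn k)) /expt coef_sum; apply: eq_bigr => i _.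
by rewrite coefZ mulrC.
Qed.

Lemma fps_exp_ode g n : g 0%N = 0 ->
  eqX n ('X * (\poly_(k < n) fps_exp g k)^`())
        (\poly_(k < n) (k%:R * g k) * \poly_(k < n) fps_exp g k).
Proof.
move=> g0.
have h := @fps_exp_poly g n g0.
set G := \poly_(k < n) g k in h *; have G0 : G`_0 = 0 by rewrite coef_poly g0 if_same.
have h1 : eqX n (expt n G) (expt n.+1 G) by apply: expt_eqX.
apply: eqX_trans (eqX_Xderiv (eqX_trans h h1)) _.
rewrite expt_deriv mulrA; apply: eqXM; last exact: eqX_sym.
move=> [|k] kn; rewrite coefXM [RHS]coef_poly kn /= ?mul0r //.
by rewrite coef_deriv coef_poly kn mulr_natl.
Qed.

(** As H has no constant term, the coefficient of X^(k+1) in the equation expresses (k+1) B_(k+1) by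
    lower coefficients, and k+1 is invertible in K. *)
Lemma ode_unique n (H B C : {poly K}) : H`_0 = 0 -> B`_0 = C`_0 ->
  eqX n ('X * B^`()) (H * B) -> eqX n ('X * C^`()) (H * C) -> eqX n B C.
Proof.
move=> H0 BC hB hC k; elim/ltn_ind: k => -[|k] IH kn //.
have e (P : {poly K}) : eqX n ('X * P^`()) (H * P) ->
    k.+1%:R * P`_k.+1 = \sum_(j < k.+1) H`_j.+1 * P`_(k - j).
  move=> /(_ _ kn); rewrite coefXM /= coef_deriv mulr_natl => ->.
  by rewrite coefM big_ord_recl H0 mul0r add0r.
apply: (mulfI (natr_neq0 p_prime (ltn0Sn k) : (k.+1%:R : K) != 0)).
rewrite (e _ hB) (e _ hC); apply: eq_bigr => j _; congr (_ * _).
by apply: IH; rewrite ?ltnS ?leq_subr // (leq_trans _ kn) // ltnS ltnW // ltnS leq_subr.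
Qed.

Lemma ode_exp n (H B : {poly K}) m :
  eqX n ('X * B^`()) (H * B) -> eqX n ('X * (B ^+ m)^`()) (m%:R *: H * B ^+ m).
Proof.
case: m => [|m] h.
  by rewrite expr0 derivC mulr0 scale0r mul0r.
rewrite deriv_exp /=.
have -> : 'X * (B^`() * B ^+ m *+ m.+1) = ('X * B^`()) * (m.+1%:R *: B ^+ m).
  by rewrite scaler_nat !mulrnAr mulrA.
have -> : m.+1%:R *: H * B ^+ m.+1 = (H * B) * (m.+1%:R *: B ^+ m).
  by rewrite exprS -scalerAl -scalerAr mulrA.
by apply: eqXM.
Qed.

Lemma ode_mul n (H L B C : {poly K}) :
  eqX n ('X * B^`()) (H * B) -> eqX n ('X * C^`()) (L * C) ->
  eqX n ('X * (B * C)^`()) ((H + L) * (B * C)).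
Proof.
move=> hB hC; rewrite derivM mulrDr.
have -> : 'X * (B^`() * C) + 'X * (B * C^`()) = ('X * B^`()) * C + ('X * C^`()) * B by ring.
have -> : (H + L) * (B * C) = (H * B) * C + (L * C) * B by ring.
by apply: eqXD; apply: eqXM.
Qed.

Lemma ode_comp n m (H B : {poly K}) : (0 < m)%N ->
  eqX n ('X * B^`()) (H * B) ->
  eqX n ('X * (B \Po 'X^m)^`()) (m%:R *: (H \Po 'X^m) * (B \Po 'X^m)).
Proof.
move=> m0 h; rewrite deriv_comp derivXn.
have -> : 'X * ((B^`() \Po 'X^m) * ('X^(m.-1) *+ m)) = m%:R *: (('X * B^`()) \Po 'X^m).
  rewrite comp_polyM comp_polyX scaler_nat !mulrnAr; congr (_ *+ _).
  have -> : 'X^m = 'X * 'X^(m.-1) :> {poly K} by rewrite -exprS prednK.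
  by ring.
rewrite -scalerAl -comp_polyM; apply: eqXZ; exact: eqX_comp.
Qed.

End ExpODE.

(** * Integrality of the Artin-Hasse exponential, after Dwork *)

Section ArtinHasse.
Context {R : realType} {p : nat} {K : padicComplexType R p}.
Hypothesis p_prime : prime p.
Hypothesis p_odd : odd p.

Definition AH_log (j : nat) : K := \sum_(k < j.+1 | j == (p ^ k)%N) AH_term 1 k.

Lemma p_gt1 : (1 < p)%N. Proof. exact: prime_gt1. Qed.

Lemma AH_log0 : AH_log 0 = 0.
Proof.
by rewrite /AH_log big1 // => k /eqP/esym/eqP; rewrite expn_eq0 -leqn0 leqNgt prime_gt0.
Qed.

Definition is_ppow j := j == (p ^ logn p j)%N.

(** The Euler operator X d/dX turns the sum of x^(p^k)/p^k into the sum of x^(p^k), so the recursion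
    for the coefficients of [Theta] only involves 0 and 1. *)
Lemma AH_log_coef j : j%:R * AH_log j = (is_ppow j)%:R.
Proof.
have hp : (p%:R : K) != 0 by apply: natr_neq0 => //; exact: prime_gt0.
rewrite /AH_log /is_ppow; case: eqP => [e|ne]; last first.
  rewrite big1 ?mulr0 // => k /eqP e; case: ne.
  by rewrite {2}e pfactorK.
have kj : (logn p j < j.+1)%N by rewrite ltnS {2}e ltnW // ltn_expl // p_gt1.
rewrite (bigD1 (Ordinal kj)) /=; last exact/eqP.
rewrite big1 => [|k /andP[/eqP e' /eqP ne]]; last first.
  by case: ne; apply/val_inj => /=; rewrite {2}e' pfactorK.
rewrite addr0 /AH_term expr1n mul1r -natrX -e divff //.
by rewrite natr_neq0 // e expn_gt0 prime_gt0.
Qed.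

Lemma Theta_scale (c : K) k : Theta c k = c ^+ k * Theta 1 k.
Proof.
have comp_scaleX (P : {poly K}) i : (P \Po (c *: 'X))`_i = c ^+ i * P`_i.
  rewrite comp_polyE coef_sum.
  have E j : (P`_j *: (c *: 'X) ^+ j)`_i = c ^+ i * P`_j *+ (i == j).
    rewrite exprZn !coefZ coefXn; case: eqP => [->|_]; rewrite ?mulr1 ?mulr0 //.
    by rewrite mulrC.
  rewrite (eq_bigr (fun j : 'I__ => c ^+ i * P`_j *+ (i == j)))=> [|j _]; last exact: E.
  have [h|h] := ltnP i (size P).
    rewrite (bigD1 (Ordinal h)) //= eqxx big1 ?addr0 // => j ne.
    by rewrite (_ : (i == j) = false) //; apply/negbTE; apply: contra ne => /eqP e;
      apply/eqP/val_inj.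
  rewrite nth_default // mulr0 big1 // => j _.
  by rewrite (_ : (i == j) = false) //; apply/negbTE; rewrite neq_ltn ltnNge; apply/orP;
    right; exact: leq_trans h.
rewrite /Theta /fps_exp mulr_sumr; apply: eq_bigr => m _; rewrite mulrA; congr (_ / _).
set L := \poly_(j < k.+1) _; set P := \poly_(j < k.+1) _.
have -> : L = P \Po (c *: 'X).
  apply/polyP => j; rewrite comp_scaleX !coef_poly; case: ifP => _; last by rewrite mulr0.
  rewrite mulr_sumr; apply: eq_bigr => i /eqP e.
  by rewrite /AH_term expr1n mulrA mulr1 -e.
by rewrite -(rmorphXn (comp_poly (c *: 'X)) m P) /= comp_scaleX.
Qed.

Lemma Theta10 : Theta (1 : K) 0 = 1.
Proof.
rewrite /Theta /fps_exp big_ord_recl big_ord0 expr0 coef1 /=.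
by rewrite fact0 divr1 addr0.
Qed.

Lemma Theta_rec i : i.+1%:R * Theta (1 : K) i.+1 =
  \sum_(j < i.+1) (is_ppow j.+1)%:R * Theta 1 (i - j).
Proof.
have := @fps_exp_ode _ _ K p_prime AH_log i.+2 AH_log0 i.+1 (ltnSn _).
rewrite coefXM /= coef_deriv coef_poly ltnSn -[_ *+ i.+1]mulr_natl => ->.
rewrite coefM big_ord_recl !coef_poly /= mul0r mul0r add0r.
apply: eq_bigr => j _; rewrite !coef_poly /bump leq0n add1n subSS.
rewrite ltnS (ltn_ord j) AH_log_coef.
by rewrite ifT // ltnS; apply: leq_trans (leq_subr _ _) _.
Qed.

(** The only power of p met by the recursion below degree p is 1. There the series agrees with exp,
    and the factorials are units. *)
Lemma Theta_small k : (k < p)%N -> pabs (Theta (1 : K) k) = 1.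
Proof.
elim: k => [|k IH] kp; first by rewrite Theta10 pabs1.
have := congr1 pabs (Theta_rec k); rewrite pabsM pabs_nat_lt //= mul1r => ->.
rewrite big_ord_recl big1 => [|j _].
  by rewrite /is_ppow logn1 expn0 eqxx mul1r addr0 subn0 IH // ltnW.
rewrite lift0 /is_ppow; case: eqP => [e|_]; last by rewrite mul0r.
have : logn p j.+2 = 0%N.
  apply: logn_coprime => //; rewrite ?prime_coprime // gtnNdvd //.
  by apply: leq_trans kp; rewrite ltnS; apply: leq_ltn_trans (ltn_ord j) _.
by move=> h; move: e; rewrite h.
Qed.

Lemma AH_natK k : (0 < k)%N -> (k%:R : K) != 0. Proof. exact: natr_neq0. Qed.

Lemma ratrP (x : K) : range (@ratr K) x <->
  exists m d : int, d != 0 /\ x = m%:~R / d%:~R.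
Proof.
split=> [[q _ <-]|[m [d [d0 ->]]]].
  by exists (numq q), (denq q); split=> //; exact: denq_neq0.
exists (m%:~R / d%:~R) => //; rewrite /ratr.
set q : rat := m%:~R / d%:~R.
have e : numq q * d = m * denq q.
  apply/eqP; rewrite -(eqr_int rat) !intrM.
  rewrite -eqr_div ?intr_eq0 ?denq_neq0 //.
  by rewrite divq_num_den.
by apply/eqP; rewrite eqr_div ?intr_eq0K ?denq_neq0 // -!intrM e.
Qed.

Lemma israt_int (z : int) : range (@ratr K) z%:~R.
Proof. by apply/ratrP; exists z, 1; rewrite divr1. Qed.

Lemma israt_nat n : range (@ratr K) n%:R.
Proof. exact: (israt_int n). Qed.

Lemma israt_add (x y : K) :
  range (@ratr K) x -> range (@ratr K) y -> range (@ratr K) (x + y).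
Proof.
move=> /ratrP [m [d [d0 ->]]] /ratrP [m' [d' [d'0 ->]]]; apply/ratrP.
exists (m * d' + m' * d), (d * d'); split; first by rewrite mulf_neq0.
by rewrite addf_div ?intr_eq0K // intrD !intrM.
Qed.

Lemma israt_mul (x y : K) :
  range (@ratr K) x -> range (@ratr K) y -> range (@ratr K) (x * y).
Proof.
move=> /ratrP [m [d [d0 ->]]] /ratrP [m' [d' [d'0 ->]]]; apply/ratrP.
exists (m * m'), (d * d'); split; first by rewrite mulf_neq0.
by rewrite !intrM invfM mulrACA.
Qed.

Lemma israt_opp (x : K) : range (@ratr K) x -> range (@ratr K) (- x).
Proof. by move=> h; rewrite -mulN1r; apply: israt_mul => //; exact: (israt_int (-1)). Qed.

Lemma israt_inv (x : K) : range (@ratr K) x -> range (@ratr K) x^-1.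
Proof.
move=> /ratrP [m [d [d0 ->]]]; apply/ratrP; have [->|m0] := eqVneq m 0.
  by exists 0, 1; rewrite !mul0r invr0.
by exists d, m; rewrite invf_div.
Qed.

Lemma israt_exp (x : K) n : range (@ratr K) x -> range (@ratr K) (x ^+ n).
Proof.
move=> h; elim: n => [|n IH]; first exact: (israt_nat 1).
by rewrite exprS; exact: israt_mul.
Qed.

Lemma israt_sum (I : Type) (s : seq I) (P : pred I) (F : I -> K) :
  (forall i, P i -> range (@ratr K) (F i)) -> range (@ratr K) (\sum_(i <- s | P i) F i).
Proof.
move=> h; apply: (big_ind (fun x => range (@ratr K) x)) => //.
  exact: (israt_nat 0).
exact: israt_add.
Qed.

Lemma Theta1_rat k : range (@ratr K) (Theta (1 : K) k).
Proof.
elim/ltn_ind: k => -[|k] IH; first by rewrite Theta10; exact: (israt_nat 1).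
rewrite -(mulKf (AH_natK (ltn0Sn k)) (Theta 1 _)) Theta_rec.
apply: israt_mul; first by apply: israt_inv; exact: israt_nat.
apply: israt_sum => j _; apply: israt_mul; first exact: israt_nat.
by apply: IH; rewrite ltnS leq_subr.
Qed.

(** The property of the coefficients of P under which P(X)^p = P(X^p) modulo p. *)
Definition frob_fixed (x : K) := pabs x <= 1 /\ pabs (x ^+ p - x) <= p%:R^-1.

Definition bnd (e : R) (P : {poly K}) := forall k, pabs P`_k <= e.

Lemma bndD e P Q : bnd e P -> bnd e Q -> bnd e (P + Q).
Proof. by move=> h1 h2 k; rewrite coefD; apply: pabsD_le. Qed.

Lemma bndM e P Q : 0 <= e -> bnd e P -> bnd 1 Q -> bnd e (P * Q).
Proof.
move=> e0 h1 h2 k; rewrite coefM; apply: pabs_sum_le => // j _.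
by rewrite pabsM -[e]mulr1; apply: ler_pM; rewrite ?pabs_ge0.
Qed.

Lemma bnd1X P k : bnd 1 P -> bnd 1 (P ^+ k).
Proof.
move=> h; elim: k => [|k IH]; last by rewrite exprS; apply: bndM.
by move=> j; rewrite expr0 coef1; exact: pabs_nat_le1.
Qed.

Lemma bnd_sum e (I : Type) (s : seq I) (r : pred I) (F : I -> {poly K}) : 0 <= e ->
  (forall i, r i -> bnd e (F i)) -> bnd e (\sum_(i <- s | r i) F i).
Proof.
by move=> e0 h k; rewrite coef_sum; apply: pabs_sum_le => // i /h.
Qed.

Lemma pV_ge0 : 0 <= (p%:R : R)^-1. Proof. by rewrite invr_ge0 ler0n. Qed.

Lemma pabs_dvd k : (p %| k)%N -> pabs (k%:R : K) <= p%:R^-1.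
Proof.
move=> /dvdnP [q ->]; rewrite natrM pabsM pabs_p ler_piMl ?pV_ge0 //.
exact: pabs_nat_le1.
Qed.

Lemma bnd_freshman_gen k P Q : (0 < k)%N ->
  (forall i, (0 < i < k)%N -> (p %| 'C(k, i))%N) -> bnd 1 P -> bnd 1 Q ->
  bnd p%:R^-1 ((P + Q) ^+ k - P ^+ k - Q ^+ k).
Proof.
case: k => // m _ hm hP hQ; rewrite exprDn.
rewrite big_ord_recl big_ord_recr /= subn0 bin0 mulr1n expr0 mulr1 subnn expr0 mul1r.
rewrite binn mulr1n.
set S := \sum_(i < m) _.
have -> : P ^+ m.+1 + (S + Q ^+ m.+1) - P ^+ m.+1 - Q ^+ m.+1 = S by ring.
apply: bnd_sum; first by rewrite invr_ge0.
move=> i _ k; rewrite /bump leq0n add1n coefMn -[X in pabs X]mulr_natl pabsM -[_^-1]mulr1.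
apply: ler_pM; rewrite ?pabs_ge0 //; last by apply: (bndM ler01); exact: bnd1X.
by apply: pabs_dvd; apply: hm; rewrite /= ltnS ltn_ord.
Qed.

Lemma bnd_freshman P Q : bnd 1 P -> bnd 1 Q ->
  bnd p%:R^-1 ((P + Q) ^+ p - P ^+ p - Q ^+ p).
Proof.
by apply: bnd_freshman_gen => [|i]; [exact: prime_gt0|exact: prime_dvd_bin].
Qed.

Lemma frob_fixedD x y : frob_fixed x -> frob_fixed y -> frob_fixed (x + y).
Proof.
move=> [x1 hx] [y1 hy]; split; first exact: pabsD_le.
have bC (z : K) : pabs z <= 1 -> bnd 1 z%:P.
  by move=> z1 k; rewrite coefC; case: eqP; rewrite ?pabs0.
have := bnd_freshman (bC _ x1) (bC _ y1) 0.
rewrite -!polyC_exp -polyCD -polyC_exp -!polyCB coefC /= => h.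
have -> : (x + y) ^+ p - (x + y) = ((x + y) ^+ p - x ^+ p - y ^+ p)
   + ((x ^+ p - x) + (y ^+ p - y)) by ring.
by apply: pabsD_le => //; apply: pabsD_le.
Qed.

Lemma frob_fixedM x y : frob_fixed x -> frob_fixed y -> frob_fixed (x * y).
Proof.
move=> [x1 hx] [y1 hy]; split; first by rewrite pabsM mulr_ile1 ?pabs_ge0.
have -> : (x * y) ^+ p - x * y = x ^+ p * (y ^+ p - y) + (x ^+ p - x) * y.
  by rewrite exprMn; ring.
apply: pabsD_le; rewrite pabsM; last by rewrite -[_^-1]mulr1 ler_pM ?pabs_ge0.
by rewrite -[_^-1]mul1r ler_pM ?pabs_ge0 // pabsX exprn_ile1 ?pabs_ge0.
Qed.

Lemma frob_fixedN x : frob_fixed x -> frob_fixed (- x).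
Proof.
move=> [x1 hx]; split; first by rewrite pabsN.
rewrite exprNn -signr_odd p_odd expr1 mulN1r.
by rewrite -opprD pabsN.
Qed.

Lemma frob_fixed_nat k : frob_fixed k%:R.
Proof.
elim: k => [|k IH].
  by split; rewrite ?pabs0 // expr0n (gtn_eqF (prime_gt0 p_prime)) subrr pabs0 // pV_ge0.
rewrite -addn1 natrD; apply: frob_fixedD => //; split; first by rewrite pabs1.
by rewrite expr1n subrr pabs0 // pV_ge0.
Qed.

Lemma frob_fixed_int (z : int) : frob_fixed z%:~R.
Proof.
case: z => k; first exact: frob_fixed_nat.
by rewrite NegzE mulrNz; apply: frob_fixedN; exact: frob_fixed_nat.
Qed.

Lemma frob_fixedV x : pabs x = 1 -> frob_fixed x -> frob_fixed x^-1.
Proof.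
move=> x1 [_ hx]; have x0 : x != 0 by rewrite -(pabs_gt0 p_prime) x1.
split; first by rewrite pabsV // x1 invr1.
have -> : x^-1 ^+ p - x^-1 = - (x ^+ p - x) * (x^-1 ^+ p * x^-1).
  rewrite mulrA mulNr mulrBl -exprMn divff // expr1n.
  rewrite mulNr mulrBl mul1r opprB [x * _]mulrC -mulrA divff // mulr1 //.
rewrite pabsM pabsN pabsM pabsX pabsV // x1 invr1 expr1n !mulr1 //.
Qed.

Lemma int_pabs_lt1 (z : int) : pabs (z%:~R : K) < 1 -> (p %| `|z|)%N.
Proof.
move=> h; apply/negPn/negP; rewrite -prime_coprime // => /(pabs_nat_coprime (K := K) p_prime) e.
move: h; have -> : pabs (z%:~R : K) = pabs (`|z|%N%:R : K).
  by case: (z) => k //; rewrite NegzE mulrNz pabsN abszN.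
by rewrite e ltxx.
Qed.

(** If p divided the denominator, a norm at most 1 would force it to divide the numerator as well.
    For integers the congruence is Fermat's, obtained from 1 by additivity. *)
Lemma frob_fixed_rat x : range (@ratr K) x -> pabs x <= 1 -> frob_fixed x.
Proof.
case=> q _ <-; rewrite {1}/ratr pabs_div // => h.
have d1 : pabs ((denq q)%:~R : K) = 1.
  apply/eqP; rewrite eq_le pabs_int_le1 //= leNgt; apply/negP => hd.
  have dp : 0 < pabs ((denq q)%:~R : K) by rewrite pabs_gt0 // intr_eq0K // denq_neq0.
  move: h; rewrite ler_pdivrMr // mul1r => h.
  have := coprime_num_den q; rewrite /coprime => /eqP e.
  have : (p %| gcdn `|numq q| `|denq q|)%N.
    by rewrite dvdn_gcd !int_pabs_lt1 //; exact: le_lt_trans h hd.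
  by rewrite e dvdn1 => /eqP p1; move: p_prime; rewrite p1.
rewrite /ratr; apply: frob_fixedM; first exact: frob_fixed_int.
by apply: frob_fixedV => //; exact: frob_fixed_int.
Qed.

Lemma bnd_frobenius (P : {poly K}) : (forall k, frob_fixed P`_k) ->
  bnd p%:R^-1 (P ^+ p - (P \Po 'X^p)).
Proof.
elim/poly_ind: P => [|P c IH] hP.
  by rewrite expr0n (gtn_eqF (prime_gt0 p_prime)) comp_poly0 subrr => k;
    rewrite coef0 pabs0 // pV_ge0.
have hP' k : frob_fixed P`_k by have := hP k.+1; rewrite coefD coefMX coefC addr0.
have hc : frob_fixed c by have := hP 0%N; rewrite coefD coefMX coefC /= add0r.
have b1 : bnd 1 (P * 'X) by move=> [|k]; rewrite coefMX ?pabs0 //; case: (hP' k).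
have b2 : bnd 1 c%:P by move=> k; rewrite coefC; case: eqP; rewrite ?pabs0 //; case: hc.
rewrite comp_poly_MXaddC.
have -> : (P * 'X + c%:P) ^+ p - ((P \Po 'X^p) * 'X^p + c%:P) =
   ((P * 'X + c%:P) ^+ p - (P * 'X) ^+ p - c%:P ^+ p)
   + (((P ^+ p - (P \Po 'X^p)) * 'X^p) + (c%:P ^+ p - c%:P)).
  by rewrite exprMn; ring.
apply: bndD; first exact: bnd_freshman.
apply: bndD.
  move=> k; rewrite coefMXn; case: ifP => _; first by rewrite pabs0 // pV_ge0.
  exact: (IH hP').
rewrite -polyC_exp -polyCB => k; rewrite coefC; case: eqP => _; first by case: hc.
by rewrite pabs0 // pV_ge0.
Qed.

(** With Legendre's formula this keeps the exponent of p in l! strictly below l, so that p divides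
    p^l / l!. *)
Lemma sum_div_lt l N : (0 < l)%N -> (\sum_(1 <= k < N) l %/ p ^ k < l)%N.
Proof.
elim/ltn_ind: l N => l IH [|[|N]] l0; [by rewrite big_geq|by rewrite big_geq|].
rewrite big_ltn // expn1 -[1.+1]addn1 -[N.+2]addn1 big_addn addn1 subn1 /=.
rewrite (eq_bigr (fun k => (l %/ p) %/ p ^ k)%N) => [|k _]; last first.
  by rewrite addn1 expnS divnMA.
have h2 : (l %/ p * 2 <= l)%N.
  by apply: leq_trans (leq_trunc_div l p); rewrite leq_mul2l prime_gt1 ?orbT.
have [e|lp] := posnP (l %/ p).
  by rewrite e big1 // => k _; rewrite div0n.
have := IH _ _ N.+1 lp; rewrite ltn_Pdiv ?prime_gt1 // => /(_ isT); lia.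
Qed.

Lemma pabs_exp_fact l : (0 < l)%N -> pabs (p%:R ^+ l / l`!%:R : K) <= p%:R^-1.
Proof.
move=> l0; rewrite pabs_div // pabsX pabs_p pabs_natE ?fact_gt0 // invrK.
have p0 : (p%:R : R) != 0 by rewrite pnatr_eq0 -lt0n prime_gt0.
have h : (logn p l`! < l)%N by rewrite logn_fact //; exact: sum_div_lt.
move: (logn p l`!) h => a h; have e : l = (a + (l - a.+1).+1)%N by lia.
rewrite {}e; move: (l - a.+1)%N => b.
rewrite exprD mulrAC -exprMn mulVf // expr1n mul1r exprS ler_piMr ?pV_ge0 //.
by rewrite exprn_ile1 ?pV_ge0 // invf_le1 ?ler1n ?prime_gt0 // ltr0n prime_gt0.
Qed.

Lemma expP_ode n (c : K) : eqX n ('X * (\poly_(k < n) (c ^+ k / k`!%:R))^`())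
   (c *: 'X * \poly_(k < n) (c ^+ k / k`!%:R)).
Proof.
move=> [|k] kn; rewrite -scalerAl coefZ !coefXM /= ?mulr0 // coef_deriv !coef_poly kn (ltnW kn).
rewrite -[LHS]mulr_natr exprS factS natrM invfM.
have := AH_natK (ltn0Sn k); move: (k.+1%:R) => a a0.
by rewrite [a^-1 * _]mulrC -!mulrA mulVf // mulr1.
Qed.

(* Dwork: writing A for the Artin-Hasse series, A(x)^p = A(x^p) exp(p x), since
   both sides solve the same first order equation. *)
Lemma AH_dwork n (A := \poly_(k < n) Theta (1 : K) k)
    (e := \poly_(k < n) (p%:R ^+ k / k`!%:R : K)) :
  eqX n (A ^+ p) ((A \Po 'X^p) * e).
Proof.
pose H : {poly K} := \poly_(k < n) (k%:R * AH_log k).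
have hA : eqX n ('X * A^`()) (H * A) by apply: (fps_exp_ode p_prime AH_log0).
have p0 := prime_gt0 p_prime.
case: n @A @e @H hA => [|n] A e H hA; first by move=> k; rewrite ltn0.
have A0 : A`_0 = 1 by rewrite coef_poly /= Theta10.
apply: (ode_unique p_prime (H := p%:R *: H)).
- by rewrite coefZ coef_poly /= mul0r mulr0.
- rewrite coef0M coef_comp_poly_Xn // dvdn0 div0n A0 coef_poly /= expr0 divr1 mulr1.
  by rewrite -!horner_coef0 horner_exp horner_coef0 A0 expr1n.
- exact: ode_exp.
have h1 := ode_mul (ode_comp p0 hA) (@expP_ode n.+1 p%:R).
apply: eqX_trans h1 _; apply: eqXM; last exact: eqX_refl.
move=> k kn; rewrite coefD !coefZ coef_comp_poly_Xn // coefX -mulrDr; congr (_ * _).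
rewrite !coef_poly kn (AH_log_coef k).
case: (boolP (p %| k)%N) => pk; last first.
  rewrite add0r /is_ppow; congr (_%:R).
  have -> : logn p k = 0%N by apply: logn_coprime; rewrite prime_coprime.
  by rewrite expn0 eq_sym.
rewrite (leq_ltn_trans (leq_div _ _) kn) AH_log_coef /is_ppow.
rewrite (_ : (k == 1%N) = false) ?addr0; last first.
  by apply/eqP => k1; move: pk; rewrite k1 dvdn1 => /eqP p1; move: p_prime; rewrite p1.
congr (_%:R); move: pk => /dvdnP [q ->]; rewrite mulnK //.
have [->|q0] := posnP q; first by rewrite mul0n.
have lp : logn p p = 1%N by rewrite -{2}(expn1 p) pfactorK.
by rewrite lognM // lp addn1 expnSr eqn_pmul2r.
Qed.

(** Modulo X^(m+1) the new monomial enters a power linearly, and multiplied by a power of the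
    constant term, which is 1. With k = p this isolates an unknown top coefficient as p c. *)
Lemma exp_monom_coef (P : {poly K}) (c : K) m k : (0 < m)%N -> P`_0 = 1 ->
  ((P + c *: 'X^m) ^+ k)`_m = (P ^+ k)`_m + c *+ k.
Proof.
move=> m0 P0; elim: k => [|k IH]; first by rewrite addr0.
have e : eqX m ((P + c *: 'X^m) ^+ k) (P ^+ k).
  apply: eqX_exp => j jm; rewrite coefD coefZ coefXn.
  by rewrite (ltn_eqF jm) mulr0 addr0.
have Pk0 : (P ^+ k)`_0 = 1 by rewrite -!horner_coef0 horner_exp horner_coef0 P0 expr1n.
rewrite exprSr mulrDr coefD -scalerAr coefZ coefMXn ltnn subnn (e _ m0) Pk0 mulr1.
rewrite exprSr !coefM !big_ord_recr /= subnn P0 !mulr1 IH.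
rewrite (eq_bigr (fun j : 'I_m => (P ^+ k)`_j * P`_(m - j))) => [|j _].
  by rewrite mulrSr !addrA.
by rewrite (e _ (ltn_ord j)).
Qed.

(** Compare the coefficients of X^m in A(X)^p = A(X^p) exp(pX). The unknown one enters as p times
    itself on the left, while A(X^p) only sees lower ones. All the rest is divisible by p: by the
    Frobenius congruence for the lower coefficients, which are p-integral rationals by induction,
    and because p divides p^l / l! for l > 0. Dividing by p gives the claim. *)
Lemma Theta1_le1 k : pabs (Theta (1 : K) k) <= 1.
Proof.
elim/ltn_ind: k => -[|m'] IH; first by rewrite Theta10 pabs1.
set m := m'.+1 in IH *.
pose A0 : {poly K} := \poly_(k < m) Theta 1 k.
have p0 := prime_gt0 p_prime.
have AE : \poly_(k < m.+1) Theta 1 k = A0 + Theta 1 m *: 'X^m.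
  apply/polyP => j; rewrite coefD coefZ coefXn !coef_poly ltnS.
  by have [h|h|->] := ltngtP j m; rewrite ?mulr0 ?addr0 ?mulr1 ?add0r // ltnW.
have A00 : A0`_0 = 1 by rewrite coef_poly /= Theta10.
have good j : frob_fixed A0`_j.
  rewrite coef_poly; case: ltnP => jm; last exact: (frob_fixed_nat 0).
  by apply: frob_fixed_rat (IH _ jm); exact: Theta1_rat.
have := @AH_dwork m.+1 m (ltnSn m).
rewrite AE exp_monom_coef // => hD.
have hC : (((A0 + Theta 1 m *: 'X^m) \Po 'X^p) * \poly_(k < m.+1) (p%:R ^+ k / k`!%:R : K))`_m
   = \sum_(j < m.+1) (A0 \Po 'X^p)`_j * (p%:R ^+ (m - j) / (m - j)`!%:R).
  rewrite coefM; apply: eq_bigr => j _; rewrite coef_poly ltnS leq_subr; congr (_ * _).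
  rewrite !coef_comp_poly_Xn //; case: ifP => // pj.
  rewrite coefD coefZ coefXn (ltn_eqF _) ?mulr0 ?addr0 //.
  have := ltn_ord j; rewrite ltnS => jm.
  have [->|j0] := posnP j; first by rewrite div0n.
  by apply: leq_trans jm; rewrite ltn_Pdiv ?prime_gt1.
rewrite hC big_ord_recr /= subnn expr0 fact0 divr1 mulr1 in hD.
have e : p%:R * Theta (1 : K) m = \sum_(j < m) (A0 \Po 'X^p)`_j * (p%:R ^+ (m - j) / (m - j)`!%:R)
    - (A0 ^+ p - (A0 \Po 'X^p))`_m.
  rewrite coefB mulr_natl; apply/eqP; rewrite -subr_eq0; apply/eqP.
  move: hD; move: (\sum_(j < m) _) => S hD.
  transitivity ((A0 ^+ p)`_m + Theta 1 m *+ p - (S + (A0 \Po 'X^p)`_m)); first by ring.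
  by rewrite hD subrr.
have : pabs (p%:R * Theta (1 : K) m) <= p%:R^-1.
  rewrite e; apply: pabsB_le; last exact: bnd_frobenius.
  apply: (pabs_sum_le p_prime) => [|j _]; first exact: pV_ge0.
  rewrite pabsM -[X in _ <= X]mul1r; apply: ler_pM; rewrite ?pabs_ge0 //.
    rewrite coef_comp_poly_Xn //; case: ifP => _; last by rewrite pabs0.
    by case: (good (j %/ p)%N).
  by apply: pabs_exp_fact; rewrite subn_gt0.
rewrite pabsM pabs_p -ler_pdivlMl ?invr_gt0 ?ltr0n // invrK divff //.
by rewrite pnatr_eq0 -lt0n.
Qed.

End ArtinHasse.

(** * The uniformizer and the ring Z_q[pi] *)

Section Gamma.
Context {R : realType} {p : nat} {K : padicComplexType R p}.
Hypothesis p_prime : prime p.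
Hypothesis p_odd : odd p.
Variable gamma : K.
Hypothesis gamma_root : pcvg \oo (series (AH_term gamma)) 0.
Hypothesis gamma_ord : ordp gamma = ((p.-1)%:R^-1)%:E.

Lemma p_ge3 : (2 < p)%N.
Proof. by move: (prime_gt1 p_prime) p_odd; case: p => [|[|[|]]]. Qed.

Lemma subrX_le (x y : K) d : pabs x <= 1 -> pabs y <= 1 ->
  pabs (x ^+ d - y ^+ d) <= pabs (x - y).
Proof.
move=> x1 y1; rewrite subrXX pabsM ler_piMr ?pabs_ge0 //.
apply: (pabs_sum_le p_prime) => // i _; rewrite pabsM !pabsX.
by apply: mulr_ile1; rewrite ?exprn_ge0 ?pabs_ge0 // exprn_ile1 ?pabs_ge0.
Qed.

Lemma gamma_neq0 : gamma != 0.
Proof. by apply/eqP => g0; move: gamma_ord; rewrite /ordp g0 eqxx. Qed.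

Lemma gamma_norm : pabs gamma ^+ p.-1 = p%:R^-1.
Proof.
have g0 : 0 < pabs gamma by rewrite pabs_gt0 // gamma_neq0.
have p1 := prime_gt1 p_prime; have pR : 0 < (p%:R : R) by rewrite ltr0n prime_gt0.
have lp : 0 < ln (p%:R : R) by rewrite ln_gt0 // ltr1n.
have q0 : (p.-1%:R : R) != 0 by rewrite pnatr_eq0 -lt0n -subn1 subn_gt0.
move: gamma_ord; rewrite /ordp (negbTE gamma_neq0) => -[] h.
apply: ln_inj; rewrite ?posrE ?exprn_gt0 ?invr_gt0 // lnXn // lnV ?posrE //.
have -> : ln (pabs gamma) = - (ln p%:R / p.-1%:R).
  by rewrite -h mulrN opprK mulrCA divff ?mulr1 // gt_eqF.
by rewrite mulNrn -[(_ / _) *+ _]mulr_natr divfK.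
Qed.

Lemma gamma_lt1 : pabs gamma < 1.
Proof.
rewrite ltNge; apply/negP => h.
have : 1 <= pabs gamma ^+ p.-1 by rewrite exprn_ege1.
by rewrite gamma_norm -(@pabs_p R p K) leNgt (pabs_p_lt1 p_prime).
Qed.

Lemma gamma_gt0 : 0 < pabs gamma.
Proof. by rewrite pabs_gt0 // gamma_neq0. Qed.

(** Makes the truncated difference p^k - k(p-1), the exponent in the norm of gamma^(p^k)/p^k, a true
    one. *)
Lemma AH_exp_ge k : (k * p.-1 < p ^ k)%N.
Proof.
elim: k => [|k IH] //; rewrite expnS mulSn.
have e := prednK (prime_gt0 p_prime); have N0 : (0 < p ^ k)%N by rewrite expn_gt0 prime_gt0.
rewrite -{3}e mulSn addnC; have := leq_pmulr p.-1 N0; lia.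
Qed.

Lemma pabs_AH_term k : pabs (AH_term gamma k) = pabs gamma ^+ (p ^ k - k * p.-1).
Proof.
rewrite /AH_term pabs_div // !pabsX pabs_p -gamma_norm -exprM.
have g0 : pabs gamma ^+ (k * p.-1) != 0 by rewrite expf_neq0 // gt_eqF // gamma_gt0.
apply: (mulIf g0); rewrite -exprD subnK 1?ltnW ?AH_exp_ge // [(_ * k)%N]mulnC divfK //.
Qed.

Lemma AH_term_mono i j : (i <= j)%N ->
  pabs (AH_term gamma j) <= pabs (AH_term gamma i).
Proof.
move=> /subnK <-; elim: (j - i)%N => [|k IH] //; apply: le_trans IH.
rewrite addSn !pabs_AH_term; apply: ler_wiXn2l; rewrite ?pabs_ge0 ?(ltW gamma_lt1) //.
move: (k + i)%N => m; have := AH_exp_ge m; have := AH_exp_ge m.+1; rewrite expnS mulSn.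
have := p_ge3; rewrite -{3 4 6}(prednK (prime_gt0 p_prime)).
set q := p.-1; set N := (q.+1 ^ m)%N => h1 h2 h3; have : (0 < N)%N by lia.
nia.
Qed.

Lemma gamma_root_small (e : R) : 0 < e ->
  exists N, forall m, (N <= m)%N -> pabs (\sum_(k < m) AH_term gamma k) <= e.
Proof.
move=> e0; have /cvgrPdist_le/(_ _ e0) [N _ hN] := gamma_root.
exists N => m Nm; have := hN m Nm.
by rewrite /= sub0r normrN ger0_norm ?pabs_ge0 // subr0 /series /= big_mkord.
Qed.

(** The full series vanishes at gamma, so the truncation is minus the tail starting at index i+1,
    where the first term is the largest. *)
Lemma gamma_trunc_le i : pabs (gamma_ gamma i) <= pabs (AH_term gamma i.+1).
Proof.
set C := pabs (AH_term gamma i.+1).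
have C0 : 0 < C by rewrite /C pabs_AH_term exprn_gt0 // gamma_gt0.
have [N hN] := gamma_root_small C0.
have {hN} := hN _ (leq_addr i.+1 N); rewrite addnC big_split_ord /= => h.
rewrite /gamma_; set S := \sum_(k < i.+1) _ in h *; set T := \sum_(k < N) _ in h.
have -> : S = (S + T) - T by ring.
apply: (pabsB_le h); apply: (pabs_sum_le p_prime); first exact: ltW.
by move=> k _; apply: AH_term_mono; exact: leq_addr.
Qed.

(** The exponent equals p^(i+1) - (p-1). In the form chosen, an exponent of weight w = n p^i yields
    w + (p-1)(w - n) in powers of pi. *)
Lemma gamma_trunc_bound i : pabs (gamma_ gamma i * p%:R ^+ i) <=
  pabs gamma ^+ (p ^ i + p.-1 * (p ^ i - 1)).
Proof.
rewrite pabsM pabsX pabs_p -gamma_norm -exprM.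
apply: le_trans (ler_wpM2r _ (gamma_trunc_le i)) _; first by rewrite exprn_ge0 ?pabs_ge0.
rewrite pabs_AH_term -exprD; apply: ler_wiXn2l; rewrite ?pabs_ge0 ?(ltW gamma_lt1) //.
have := AH_exp_ge i.+1; have := AH_exp_ge i; rewrite expnS mulSn.
have := p_ge3; rewrite -{3 4 5 7 8 10 12 13}(prednK (prime_gt0 p_prime)).
set q := p.-1; set N := (q.+1 ^ i)%N => h1 h2 h3.
nia.
Qed.

Lemma gamma_trunc0 : gamma_ gamma 0 = gamma.
Proof. by rewrite /gamma_ big_ord_recl big_ord0 addr0 /AH_term expr1 expr0 divr1. Qed.

Local Notation y0 := (gamma ^+ p.-1 / p%:R).

Lemma y0_norm : pabs y0 = 1.
Proof.
rewrite pabs_div // pabsX gamma_norm pabs_p divff // invr_eq0 pnatr_eq0.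
by rewrite -lt0n prime_gt0.
Qed.

(** The repunit (p^k - 1)/(p - 1), for which gamma^(p^k) = gamma (p y0)^(d k). *)
Let d k := (\sum_(i < k) p ^ i)%N.

Lemma d_exp k : (p ^ k = (p.-1 * d k).+1)%N.
Proof. by rewrite -predn_exp prednK // expn_gt0 prime_gt0. Qed.

Lemma AH_term_y0 k :
  exists e, [/\ AH_term gamma k = gamma * (p%:R ^+ e * y0 ^+ d k),
    (k = 0%N -> e = 0%N /\ d k = 0%N), (k = 1%N -> e = 0%N /\ d k = 1%N)
    & ((1 < k)%N -> (0 < e)%N)].
Proof.
have p0 : (p%:R : K) != 0 by rewrite natr_neq0 // prime_gt0.
have dk : (k <= d k)%N.
  rewrite /d; elim: k => [|k IH] //; rewrite big_ord_recr /= -addn1.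
  by apply: leq_add => //; rewrite expn_gt0 prime_gt0.
exists (d k - k)%N; split.
- rewrite /AH_term d_exp exprS exprM -mulrA; congr (_ * _).
  rewrite expr_div_n; have pk : (p%:R : K) ^+ k != 0 by rewrite expf_neq0.
  have e : (p%:R : K) ^+ d k = p%:R ^+ (d k - k) * p%:R ^+ k by rewrite -exprD subnK.
  rewrite e invfM; have p2 : (p%:R : K) ^+ (d k - k) != 0 by rewrite expf_neq0.
  by rewrite [RHS]mulrCA !mulrA mulfK.
- by move=> ->; rewrite /d big_ord0.
- by move=> ->; rewrite /d big_ord_recl big_ord0 expn0.
case: (k) => [|[|m]] // _; rewrite subn_gt0 /d.
elim: m => [|m IH].
  by rewrite !big_ord_recl big_ord0 /= expn0 expn1; have := p_ge3; lia.
rewrite big_ord_recr /= -[X in (X < _)%N]addn1 -addSn.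
by apply: leq_add; rewrite // expn_gt0 prime_gt0.
Qed.

(** Divided by gamma, the equation of gamma reads y0 = -(1 + f(y0)), where all coefficients of f are
    divisible by p. The map q -> -(1 + f(q)) preserves p-integral rationals and improves an
    approximation of y0 by a factor p. *)
Lemma y0_approx l : exists q : K,
  [/\ range (@ratr K) q, pabs q <= 1 & pabs (y0 - q) <= p%:R^-1 ^+ l].
Proof.
elim: l => [|l [q [qr q1 hq]]].
  exists 0; split; first exact: (israt_nat p_prime 0).
    by rewrite pabs0.
  by rewrite subr0 y0_norm expr0.
have /choice [e he] := AH_term_y0.
have C0 : 0 < pabs gamma * p%:R^-1 ^+ l.+1 :> R.
  by rewrite mulr_gt0 ?gamma_gt0 // exprn_gt0 // invr_gt0 ltr0n prime_gt0.
(* The series is cut where the error, divided by gamma, is at most p^-(l+1). The summand 2 splits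
   off the terms k = 0 and k = 1, which give 1 + y0. *)
have [N hN] := gamma_root_small C0; have {hN} := hN _ (leq_addr 2 N).
rewrite (eq_bigr (fun k : 'I__ => gamma * (p%:R ^+ e k * y0 ^+ d k))) => [|k _]; last first.
  by case: (he k).
rewrite -mulr_sumr pabsM ler_pM2l ?gamma_gt0 // addnC big_split_ord /= !big_ord_recl big_ord0 addr0.
have [_ /(_ erefl) [-> ->] _ _] := he 0%N; have [_ _ /(_ erefl) [e1 d1] _] := he 1%N.
rewrite lift0 e1 d1 !expr0 !mul1r expr1.
pose f (y : K) := \sum_(i < N) p%:R ^+ e (i.+2) * y ^+ d (i.+2).
rewrite (_ : \sum_(i < N) _ = f y0); last by apply: eq_bigr => i _.
move=> hf; exists (- (1 + f q)).
have ep i : pabs (p%:R ^+ e i.+2 : K) <= p%:R^-1.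
  have [_ _ _ /(_ isT)] := he i.+2; case: (e _) => // m _.
  rewrite pabsX pabs_p exprS ler_piMr ?pV_ge0 // exprn_ile1 ?pV_ge0 //.
  by rewrite invf_le1 ?ler1n ?ltr0n ?prime_gt0.
have pp : (p%:R^-1 : R) <= 1 by rewrite invf_le1 ?ler1n ?ltr0n ?prime_gt0.
split.
- apply: israt_opp => //; apply: israt_add => //; first exact: (israt_nat p_prime 1).
  apply: israt_sum => // i _; apply: israt_mul => //; apply: israt_exp => //.
  exact: israt_nat.
- rewrite pabsN; apply: pabsD_le; rewrite ?pabs1 //; apply: (pabs_sum_le p_prime) => // i _.
  rewrite pabsM mulr_ile1 ?pabs_ge0 ?(le_trans (ep _)) // pabsX.
  by rewrite exprn_ile1 ?pabs_ge0.
have -> : y0 - - (1 + f q) = (1 + y0 + f y0) - (f y0 - f q) by ring.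
apply: (pabsB_le hf).
rewrite /f -sumrB; apply: (pabs_sum_le p_prime) => [|i _].
  by rewrite exprn_ge0 ?pV_ge0.
rewrite -mulrBr pabsM exprS; apply: ler_pM; rewrite ?pabs_ge0 //.
by apply: le_trans hq; apply: subrX_le => //; rewrite y0_norm.
Qed.

Lemma pV_exp_small (e : R) : 0 < e -> exists l, (p%:R^-1 : R) ^+ l < e.
Proof.
move=> e0; have [n hn] := inv_succ_small e0; exists n.+1.
apply: lt_le_trans (hn n (leqnn n)); have pR : 0 < (p%:R : R) by rewrite ltr0n prime_gt0.
rewrite exprVn ltf_pV2 ?posrE ?ltr0n ?exprn_gt0 //.
by rewrite -natrX ltr_nat ltn_expl // prime_gt1.
Qed.

(** Since gamma^(p-1) = p y0, this is what puts pi^(n(p-1)) into Q_p. *)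
Lemma y0_Qp : Qp y0.
Proof.
move=> e e0; have [l hl] := pV_exp_small e0; have [q [qr _ hq]] := y0_approx l.
by exists q => //; exact: le_lt_trans hq hl.
Qed.

End Gamma.

Section Subfield.
Context {R : realType} {p : nat} {K : padicComplexType R p}.
Variable S : set K.
Hypothesis S_sub : is_subfield S.

Lemma sf1 : S 1. Proof. by case: S_sub => h _ _; move: h; rewrite inE. Qed.
Lemma sfB x y : S x -> S y -> S (x - y).
Proof. by case: S_sub => _ h _ Sx Sy; have := h x y; rewrite !inE; apply. Qed.
Lemma sf_div x y : S x -> S y -> S (x / y).
Proof. by case: S_sub => _ _ h Sx Sy; have := h x y; rewrite !inE; apply. Qed.
Lemma sf0 : S 0. Proof. by rewrite -(subrr 1); apply: sfB; exact: sf1. Qed.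
Lemma sfN x : S x -> S (- x).
Proof. by move=> h; rewrite -sub0r; apply: sfB => //; exact: sf0. Qed.
Lemma sfD x y : S x -> S y -> S (x + y).
Proof. by move=> hx hy; rewrite -[y]opprK; apply: sfB => //; exact: sfN. Qed.
Lemma sfV x : S x -> S x^-1.
Proof. by move=> h; rewrite -div1r; apply: sf_div => //; exact: sf1. Qed.
Lemma sfM x y : S x -> S y -> S (x * y).
Proof. by move=> hx hy; rewrite -[y]invrK; apply: sf_div => //; exact: sfV. Qed.
Lemma sfX x k : S x -> S (x ^+ k).
Proof.
by move=> h; elim: k => [|k IH]; rewrite ?exprS; [exact: sf1|exact: sfM].
Qed.
Lemma sf_sum (I : Type) (s : seq I) (P : pred I) (f : I -> K) :
  (forall i, P i -> S (f i)) -> S (\sum_(i <- s | P i) f i).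
Proof. by move=> h; apply: (big_ind S) => //; [exact: sf0|exact: sfD]. Qed.
Lemma sf_nat k : S k%:R.
Proof. elim: k => [|k IH]; first exact: sf0.
by rewrite -addn1 natrD; apply: sfD => //; exact: sf1. Qed.

End Subfield.

Section QpFacts.
Context {R : realType} {p : nat} {K : padicComplexType R p}.
Hypothesis p_prime : prime p.
Implicit Types x y : K.

Lemma Qp_rat x : range (@ratr K) x -> Qp x.
Proof. by move=> h e e0; exists x => //; rewrite subrr pabs0. Qed.

Lemma QpD x y : Qp x -> Qp y -> Qp (x + y).
Proof.
move=> hx hy e e0; have [q qr hq] := hx _ e0; have [s sr hs] := hy _ e0.
exists (q + s); first exact: israt_add.
by rewrite opprD addrACA; exact: pabsD_lt.
Qed.

Lemma QpM x y : Qp x -> Qp y -> Qp (x * y).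
Proof.
move=> hx hy e e0.
pose M := pabs x + pabs y + 1.
have M0 : 0 < M by rewrite ltr_wpDl // addr_ge0 ?pabs_ge0.
pose e' := Num.min 1 (e / M).
have e'0 : 0 < e' by rewrite lt_min ltr01 divr_gt0.
have [q qr hq] := hx _ e'0; have [s sr hs] := hy _ e'0.
have hM (z : K) : pabs z < e' -> M * pabs z < e.
  by rewrite lt_min => /andP[_]; rewrite ltr_pdivlMr // mulrC.
exists (q * s); first exact: israt_mul.
have -> : x * y - q * s = x * (y - s) + s * (x - q) by ring.
apply: pabsD_lt; rewrite pabsM.
  apply: le_lt_trans (hM _ hs); rewrite ler_wpM2r ?pabs_ge0 // /M.
  by rewrite -addrA lerDl addr_ge0 ?pabs_ge0.
apply: le_lt_trans (hM _ hq); rewrite ler_wpM2r ?pabs_ge0 //.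
have -> : s = y - (y - s) by ring.
have hy1 := pabs_ge0 y; have hx1 := pabs_ge0 x.
by apply: pabsB_le; rewrite /M; [lra|move: hs; rewrite lt_min => /andP[hs _]; lra].
Qed.

Lemma QpX x k : Qp x -> Qp (x ^+ k).
Proof.
move=> h; elim: k => [|k IH]; first by apply: Qp_rat; exact: (israt_nat p_prime 1).
by rewrite exprS; exact: QpM.
Qed.

Lemma Qp_sum (I : Type) (s : seq I) (P : pred I) (f : I -> K) :
  (forall i, P i -> Qp (f i)) -> Qp (\sum_(i <- s | P i) f i).
Proof.
move=> h; apply: (big_ind Qp) => //; last exact: QpD.
by apply: Qp_rat; exact: (israt_nat p_prime 0).
Qed.

Lemma Qp_closed x : (forall e : R, 0 < e -> exists2 y, Qp y & pabs (x - y) < e) -> Qp x.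
Proof.
move=> h e e0; have [y hy xy] := h _ e0; have [q qr yq] := hy _ e0; exists q => //.
have -> : x - q = (x - y) + (y - q) by ring.
exact: pabsD_lt.
Qed.

Lemma Qp_norm x : Qp x -> x != 0 -> exists z : int, pabs x = (p%:R : R) ^ z.
Proof.
move=> hx x0; have xp : 0 < pabs x by rewrite pabs_gt0.
have [q qr hq] := hx _ xp.
have e : pabs q = pabs x.
  have -> : q = x + - (x - q) by ring.
  by apply: pabs_dominant => //; rewrite pabsN.
rewrite -e; apply: pabs_cases => //.
by rewrite -(pabs_gt0 p_prime) e.
Qed.

End QpFacts.

(** * The ring Z_q[pi], its closure and the Frobenius automorphism *)

Section Zq.
Context {R : realType} {p : nat} {K : padicComplexType R p}.
Hypothesis p_prime : prime p.
Variables (E : set K) (F : finFieldType) (red : K -> F) (a N : nat).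
Variables (pi zeta : K) (sigma : K -> K).
Hypothesis E_sub : is_subfield E.
Hypothesis E_Qp : Qp `<=` E.
Hypothesis E_unram : (@pabs R p K) @` E = (@pabs R p K) @` Qp.
Hypothesis a_gt0 : (0 < a)%N.
Hypothesis F_card : #|F| = (p ^ a)%N.
Hypothesis E_red : is_reduction E red.
Hypothesis N_gt0 : (0 < N)%N.
Hypothesis piN_Qp : Qp (pi ^+ N).
Hypothesis piN_norm : pabs pi ^+ N = p%:R^-1.
Hypothesis sigma_frob : is_frobenius E zeta pi sigma.

Notation OE := (integers E).

Lemma pi_gt0 : 0 < pabs pi.
Proof.
rewrite lt_def pabs_ge0 andbT; apply/eqP => h; move: piN_norm.
rewrite h expr0n (gtn_eqF N_gt0) => /esym/eqP; rewrite invr_eq0 pnatr_eq0.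
by rewrite (gtn_eqF (prime_gt0 p_prime)).
Qed.

Lemma pi_neq0 : pi != 0. Proof. by rewrite -(pabs_gt0 p_prime) pi_gt0. Qed.

Lemma pi_lt1 : pabs pi < 1.
Proof.
rewrite ltNge; apply/negP => /(exprn_ege1 N); rewrite piN_norm.
by rewrite -(@pabs_p R p K) leNgt (pabs_p_lt1 p_prime).
Qed.

Lemma pi_exp_small (e : R) : 0 < e -> exists l, pabs pi ^+ l < e.
Proof.
move=> e0; have [l hl] := pV_exp_small p_prime e0; exists (N * l)%N.
by rewrite exprM piN_norm.
Qed.

Lemma int1 : OE 1. Proof. by split; [exact: sf1|rewrite /= pabs1]. Qed.
Lemma int0 : OE 0. Proof. by split; [exact: sf0|rewrite /= pabs0]. Qed.
Lemma intD x y : OE x -> OE y -> OE (x + y).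
Proof. by case=> [Ex x1] [Ey y1]; split; [exact: sfD|exact: pabsD_le]. Qed.
Lemma intN x : OE x -> OE (- x).
Proof. by case=> [Ex x1]; split; [exact: sfN|rewrite /= pabsN]. Qed.
Lemma intB x y : OE x -> OE y -> OE (x - y).
Proof. by move=> h1 h2; apply: intD => //; exact: intN. Qed.
Lemma intM x y : OE x -> OE y -> OE (x * y).
Proof.
case=> [Ex x1] [Ey y1]; split; [exact: sfM|rewrite /= pabsM].
by rewrite mulr_ile1 ?pabs_ge0.
Qed.
Lemma intX x k : OE x -> OE (x ^+ k).
Proof. by move=> h; elim: k => [|k IH]; rewrite ?exprS; [exact: int1|exact: intM]. Qed.
Lemma intV x : OE x -> pabs x = 1 -> OE x^-1.
Proof. by case=> [Ex _] x1; split; [exact: sfV|rewrite /= pabsV // x1 invr1]. Qed.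
Lemma int_Qp x : Qp x -> pabs x <= 1 -> OE x.
Proof. by move=> h x1; split => //; exact: E_Qp. Qed.
Lemma int_nat k : OE k%:R.
Proof. by split; [exact: sf_nat|exact: pabs_nat_le1]. Qed.

(** This is where E being unramified enters: nonzero norms are integral powers of p, so a norm below
    1 is at most 1/p. *)
Lemma int_lt1 x : OE x -> pabs x < 1 -> OE (x / p%:R).
Proof.
move=> [Ex _] x1; split; first by apply: sf_div => //; exact: sf_nat.
have [->|x0] := eqVneq x 0; first by rewrite /= mul0r pabs0.
have pR : 0 < (p%:R : R) by rewrite ltr0n prime_gt0.
have : ((@pabs R p K) @` E) (pabs x) by exists x.
rewrite E_unram => -[y yQ yx].
have y0 : y != 0 by rewrite -(pabs_gt0 p_prime) yx pabs_gt0.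
have [z hz] := Qp_norm p_prime yQ y0.
rewrite /= pabs_div // -yx hz pabs_p invrK.
have zlt : z < 0.
  rewrite ltNge; apply/negP => z0; move: x1; rewrite -yx hz ltNge => /negP; apply.
  by case: (z) z0 => // k _; rewrite -exprnP exprn_ege1 // ler1n prime_gt0.
case: z zlt hz => // k _ hz.
rewrite NegzE -exprnN exprS invfM mulrAC mulVf ?mul1r ?gt_eqF //.
by rewrite invf_le1 ?exprn_gt0 // exprn_ege1 // ler1n prime_gt0.
Qed.

Lemma redD x y : OE x -> OE y -> red (x + y) = red x + red y.
Proof. by case: E_red => _ h _ _ hx hy; rewrite h ?inE. Qed.
Lemma redM x y : OE x -> OE y -> red (x * y) = red x * red y.
Proof. by case: E_red => _ _ h _ hx hy; rewrite h ?inE. Qed.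
Lemma red1 : red 1 = 1. Proof. by case: E_red. Qed.
Lemma red0 : red 0 = 0.
Proof.
have := redD int0 int0; rewrite addr0 => /eqP.
by rewrite -[X in X == _]addr0 (inj_eq (addrI _)) eq_sym => /eqP.
Qed.
Lemma redN x : OE x -> red (- x) = - red x.
Proof.
move=> h; apply/eqP; rewrite -addr_eq0 -redD //; last exact: intN.
by rewrite addNr red0.
Qed.
Lemma redX x k : OE x -> red (x ^+ k) = red x ^+ k.
Proof.
move=> h; elim: k => [|k IH]; first by rewrite !expr0 red1.
by rewrite !exprS redM ?IH //; exact: intX.
Qed.

Lemma red_unit x : OE x -> pabs x = 1 -> red x != 0.
Proof.
move=> h x1; apply/eqP => rx; have xi := intV h x1.
have x0 : x != 0 by rewrite -(pabs_gt0 p_prime) x1.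
have := redM h xi; rewrite divff // red1 rx mul0r => /eqP.
by rewrite oner_eq0.
Qed.

(** That the reduction kills the maximal ideal has to be derived. If red x were nonzero, its power
    of exponent #|F| - 1 would be 1, and x^(#|F|-1) - 1, an element of norm 1, would reduce to 0. *)
Lemma red_small x : OE x -> pabs x < 1 -> red x = 0.
Proof.
move=> h x1; apply/eqP; apply: contraT => rx.
have F1 : (1 < #|F|)%N by rewrite F_card -{1}(expn0 p) ltn_exp2l // prime_gt1.
have q1 : (0 < #|F|.-1)%N by rewrite -ltnS prednK // ltnW.
have e : red x ^+ #|F|.-1 = 1.
  apply: (mulfI rx); rewrite -exprS prednK ?expf_card ?mulr1 //.
  exact: ltnW F1.
have hx : OE (x ^+ #|F|.-1) by exact: intX.
have : red (x ^+ #|F|.-1 - 1) != 0.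
  apply: red_unit; first by apply: intB => //; exact: int1.
  rewrite addrC pabs_dominant ?pabsN ?pabs1 // pabsX.
  by rewrite exprn_ilt1 ?pabs_ge0 // -lt0n.
rewrite redD //; last by apply: intN; exact: int1.
by rewrite redX // e redN ?red1 ?subrr ?eqxx //; exact: int1.
Qed.

Lemma red_eq0 x : OE x -> red x = 0 -> pabs x < 1.
Proof.
move=> h rx; case: (h) => _ /=; rewrite le_eqVlt => /orP[/eqP x1|//].
by move: (red_unit h x1); rewrite rx eqxx.
Qed.

Notation L := (adjoin E [set zeta; pi]).

Lemma L_sub : is_subfield L.
Proof.
split=> [|x y|x y]; rewrite !inE.
- by move=> S [hS _]; exact: sf1.
- by move=> hx hy S hS; apply: sfB; [case: hS|exact: hx|exact: hy].
- by move=> hx hy S hS; apply: sf_div; [case: hS|exact: hx|exact: hy].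
Qed.

Lemma L_E x : E x -> L x. Proof. by move=> h S [_]; apply; left. Qed.
Lemma L_pi : L pi. Proof. by move=> S [_]; apply; right; right. Qed.

Lemma sigma_inj : {in L &, injective sigma}.
Proof. by case: sigma_frob => -[]. Qed.
Lemma sigmaD x y : L x -> L y -> sigma (x + y) = sigma x + sigma y.
Proof. by case: sigma_frob => _ [h _] _ _ _ hx hy; rewrite h ?inE. Qed.
Lemma sigmaM x y : L x -> L y -> sigma (x * y) = sigma x * sigma y.
Proof. by case: sigma_frob => _ [_ h] _ _ _ hx hy; rewrite h ?inE. Qed.
Lemma sigma_Qp x : Qp x -> sigma x = x.
Proof. by case: sigma_frob => _ _ h _ _ hx; rewrite h ?inE. Qed.
Lemma sigma_pi : sigma pi = pi. Proof. by case: sigma_frob => _ _ _ _ []. Qed.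
Lemma sigma_int x : OE x -> exists2 y, OE y & sigma x = x ^+ p + p%:R * y.
Proof. by case: sigma_frob => _ _ _ h _; exact: h. Qed.
Lemma sigma0 : sigma 0 = 0.
Proof. by apply: sigma_Qp; apply: Qp_rat => //; exact: (israt_nat p_prime 0). Qed.
Lemma sigma1 : sigma 1 = 1.
Proof. by apply: sigma_Qp; apply: Qp_rat => //; exact: (israt_nat p_prime 1). Qed.

Lemma sigma_OE x : OE x -> OE (sigma x).
Proof.
move=> h; have [y hy ->] := sigma_int h; apply: intD; first exact: intX.
by apply: intM => //; exact: int_nat.
Qed.

Lemma sigmaX x k : L x -> sigma (x ^+ k) = sigma x ^+ k.
Proof.
move=> h; elim: k => [|k IH]; first by rewrite !expr0 sigma1.
by rewrite !exprS sigmaM ?IH //; exact: (sfX L_sub).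
Qed.

Lemma sigma_sum (I : Type) (s : seq I) (P : pred I) (f : I -> K) :
  (forall i, L (f i)) -> sigma (\sum_(i <- s | P i) f i) = \sum_(i <- s | P i) sigma (f i).
Proof.
move=> h; elim: s => [|i s IH]; first by rewrite !big_nil sigma0.
rewrite !big_cons; case: ifP => // Pi; rewrite sigmaD ?IH //.
by apply: sf_sum => //; exact: L_sub.
Qed.

Notation Zq := (Zq_adjoin E pi).

Lemma ZqP x : Zq x <-> exists (m : nat) (c : nat -> K),
  (forall i, OE (c i)) /\ x = \sum_(i < m) c i * pi ^+ i.
Proof.
split=> [[P hP ->]|[m [c [hc ->]]]].
  exists (size P), (fun i => P`_i); rewrite horner_coef; split=> // i.
  have [h|h] := ltnP i (size P); last by rewrite nth_default //; exact: int0.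
  by move: hP => /(all_nthP 0)/(_ _ h); rewrite inE.
exists (\poly_(i < m) c i); last by rewrite horner_poly.
apply/(all_nthP 0) => i _; rewrite inE coef_poly.
by case: ifP => // _; exact: int0.
Qed.

Lemma Zq_head m (c : nat -> K) :
  \sum_(i < m.+1) c i * pi ^+ i = c 0%N + pi * \sum_(i < m) c i.+1 * pi ^+ i.
Proof.
rewrite big_ord_recl expr0 mulr1 mulr_sumr; congr (_ + _).
by apply: eq_bigr => i _; rewrite lift0 exprS mulrCA.
Qed.

Lemma Zq_int x : OE x -> Zq x.
Proof.
move=> h; apply/ZqP; exists 1%N, (fun _ => x); split => //.
by rewrite big_ord_recl big_ord0 addr0 expr0 mulr1.
Qed.

Lemma Zq_pi x : Zq x -> Zq (pi * x).
Proof.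
move=> /ZqP [m [c [hc ->]]]; apply/ZqP.
exists m.+1, (fun i => if i is j.+1 then c j else 0); split.
  by case=> // ; exact: int0.
by rewrite (Zq_head m (fun i => if i is j.+1 then c j else 0)) add0r.
Qed.

Lemma ZqD x y : Zq x -> Zq y -> Zq (x + y).
Proof.
move=> [P hP ->] [Q hQ ->]; exists (P + Q); last by rewrite hornerD.
have coefO (T : {poly K}) k : T \is a polyOver [in OE] -> OE T`_k.
  move=> hT; have [h|h] := ltnP k (size T); last by rewrite nth_default //; exact: int0.
  by move: hT => /(all_nthP 0)/(_ _ h); rewrite inE.
by apply/(all_nthP 0) => i _; rewrite inE coefD; apply: intD; exact: coefO.
Qed.

Lemma Zq_sum (I : Type) (s : seq I) (P : pred I) (f : I -> K) :
  (forall i, P i -> Zq (f i)) -> Zq (\sum_(i <- s | P i) f i).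
Proof.
by move=> h; apply: (big_ind Zq) => //; [apply: Zq_int; exact: int0|exact: ZqD].
Qed.

Lemma Zq_scale e x : OE e -> Zq x -> Zq (e * x).
Proof.
move=> he /ZqP [m [c [hc ->]]]; apply/ZqP; exists m, (fun i => e * c i); split.
  by move=> i; exact: intM.
by rewrite mulr_sumr; apply: eq_bigr => i _; rewrite mulrA.
Qed.

Lemma Zq_piX k x : Zq x -> Zq (pi ^+ k * x).
Proof. by move=> h; elim: k => [|k IH]; rewrite ?mul1r // exprS -mulrA; exact: Zq_pi. Qed.

Lemma ZqM x y : Zq x -> Zq y -> Zq (x * y).
Proof.
move=> /ZqP [m [c [hc ->]]] hy; rewrite mulr_suml; apply: Zq_sum => i _.
by rewrite -mulrA; apply: Zq_scale => //; exact: Zq_piX.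
Qed.

Lemma ZqN x : Zq x -> Zq (- x).
Proof. by rewrite -mulN1r; apply: Zq_scale; apply: intN; exact: int1. Qed.

Lemma ZqB x y : Zq x -> Zq y -> Zq (x - y).
Proof. by move=> hx hy; apply: ZqD => //; exact: ZqN. Qed.

Lemma Zq_L x : Zq x -> L x.
Proof.
move=> /ZqP [m [c [hc ->]]]; apply: (sf_sum L_sub) => i _.
apply: (sfM L_sub); first by apply: L_E; case: (hc i).
by apply: (sfX L_sub); exact: L_pi.
Qed.

Lemma Zq_le1 x : Zq x -> pabs x <= 1.
Proof.
move=> /ZqP [m [c [hc ->]]]; apply: (pabs_sum_le p_prime) => // i _.
rewrite pabsM mulr_ile1 ?pabs_ge0 //; first by case: (hc i).
by rewrite pabsX exprn_ile1 ?pabs_ge0 // ltW // pi_lt1.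
Qed.

Lemma Zq_split x : Zq x -> exists e y, [/\ OE e, Zq y & x = e + pi * y].
Proof.
move=> /ZqP [[|m] [c [hc ->]]].
  exists 0, 0; split; [exact: int0|apply: Zq_int; exact: int0|].
  by rewrite big_ord0 mulr0 addr0.
exists (c 0%N), (\sum_(i < m) c i.+1 * pi ^+ i); split=> //; last exact: Zq_head.
by apply/ZqP; exists m, (fun i => c i.+1).
Qed.

(** In x = e + pi y the constant e also has norm below 1, hence is divisible by p. And p is pi^N
    times p / pi^N, which lies in Z_q because pi^N is in Q_p. *)
Lemma Zq_small x : Zq x -> pabs x < 1 -> exists2 y, Zq y & x = pi * y.
Proof.
move=> /Zq_split [e [y [he hy ->]]] x1.
have e1 : pabs e < 1.
  have -> : e = (e + pi * y) - pi * y by ring.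
  apply: pabsD_lt => //; rewrite pabsN pabsM.
  apply: le_lt_trans pi_lt1; rewrite ler_piMr ?pabs_ge0 //; exact: Zq_le1.
have hep := int_lt1 he e1.
have pN0 : pi ^+ N != 0 by rewrite expf_neq0 // pi_neq0.
have p0 : (p%:R : K) != 0 by rewrite natr_neq0 // prime_gt0.
have hu : OE (p%:R / pi ^+ N).
  split; first by apply: sf_div => //; [exact: sf_nat|exact: E_Qp].
  by rewrite /= pabs_div // pabsX piN_norm pabs_p divff // invr_eq0 pnatr_eq0 -lt0n prime_gt0.
exists ((p%:R / pi ^+ N) * ((e / p%:R) * pi ^+ N.-1) + y).
  apply: ZqD => //; apply: Zq_scale => //; apply: Zq_scale => //.
  by rewrite -[X in Zq X]mulr1; apply: Zq_piX; apply: Zq_int; exact: int1.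
rewrite mulrDr; congr (_ + _).
have -> : pi * (p%:R / pi ^+ N * (e / p%:R * pi ^+ N.-1)) =
   e * (p%:R / p%:R) * (pi ^+ N.-1.+1 / pi ^+ N) by rewrite exprS; ring.
by rewrite prednK // !divff // !mulr1.
Qed.

(** Both e and its inverse are sent to integral elements. *)
Lemma sigma_norm_unit e : OE e -> pabs e = 1 -> pabs (sigma e) = 1.
Proof.
move=> he e1; have e0 : e != 0 by rewrite -(pabs_gt0 p_prime) e1.
have hi := intV he e1.
have Le := L_E he.1; have Li := L_E hi.1.
have := congr1 pabs (sigmaM Le Li); rewrite divff // sigma1 pabs1 pabsM => h.
have [_ /= h1] := sigma_OE he; have [_ /= h2] := sigma_OE hi.
apply/eqP; rewrite eq_le h1 /= h -[X in _ <= X]mulr1.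
by rewrite ler_wpM2l ?pabs_ge0.
Qed.

Lemma Zq_sigma x : Zq x -> Zq (sigma x).
Proof.
move=> /ZqP [m [c [hc ->]]]; apply/ZqP; exists m, (fun i => sigma (c i)); split.
  by move=> i; exact: sigma_OE.
rewrite sigma_sum => [|i]; last first.
  by apply: (sfM L_sub); [apply: L_E; case: (hc i)|apply: (sfX L_sub); exact: L_pi].
apply: eq_bigr => i _; rewrite sigmaM ?sigmaX ?sigma_pi //; first exact: L_pi.
  by apply: L_E; case: (hc i).
by apply: (sfX L_sub); exact: L_pi.
Qed.

(** In place of continuity, factors pi, which sigma fixes, are divided out one by one until the norm
    is 1. The bound pi^k < |x| makes this stop. *)
Lemma Zq_sigma_norm x : Zq x -> pabs (sigma x) = pabs x.
Proof.
move=> hx; have [->|x0] := eqVneq x 0; first by rewrite sigma0.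
have xp : 0 < pabs x by rewrite pabs_gt0.
have [k hk] := pi_exp_small xp.
elim: k x hx {x0 xp} hk => [|k IH] x hx hk.
  by have := Zq_le1 hx; rewrite leNgt -(expr0 (pabs pi)) hk.
have [x1|x1] := ltP (pabs x) 1.
  have [y hy xy] := Zq_small hx x1.
  rewrite xy sigmaM ?sigma_pi; [|exact: L_pi|exact: Zq_L].
  rewrite !pabsM IH //; move: hk; rewrite xy pabsM exprS ltr_pM2l //.
  exact: pi_gt0.
have {}x1 : pabs x = 1 by apply/eqP; rewrite eq_le x1 Zq_le1.
have [e [y [he hy xe]]] := Zq_split hx.
have py z : Zq z -> pabs (pi * z) < 1.
  move=> hz; rewrite pabsM; apply: le_lt_trans pi_lt1.
  by rewrite ler_piMr ?pabs_ge0 //; exact: Zq_le1.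
have e1 : pabs e = 1.
  have -> : e = x + - (pi * y) by rewrite xe addrK.
  by rewrite pabs_dominant ?x1 // pabsN py.
rewrite x1 xe sigmaD ?sigmaM ?sigma_pi; [|exact: L_pi|exact: Zq_L|exact: L_E he.1|].
  rewrite pabs_dominant sigma_norm_unit //; apply: py; exact: Zq_sigma.
by apply: (sfM L_sub); [exact: L_pi|exact: Zq_L].
Qed.

(** Coefficients of F_t are infinite sums of elements of Z_q[pi], so a priori they only lie in this
    closure. *)
Definition clZq y := forall e : R, 0 < e -> exists2 x, Zq x & pabs (y - x) < e.

Lemma clZq_le1 y : clZq y -> pabs y <= 1.
Proof.
move=> h; have [x hx yx] := h 1 ltr01.
have -> : y = (y - x) + x by ring.
by apply: pabsD_le; [exact: ltW|exact: Zq_le1].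
Qed.

Lemma clZq_psum (I : choiceType) (f : I -> K) s :
  (forall i, Zq (f i)) -> psum f s -> clZq s.
Proof.
move=> hf hs e e0; have e2 : 0 < e / 2 by rewrite divr_gt0.
have [A /(_ A (fsubset_refl A)) hA] := hs _ e2.
exists (\sum_(i <- A) f i); first exact: Zq_sum.
by rewrite pabsB_sym; apply: le_lt_trans hA _; lra.
Qed.

Lemma frob_surj (f : F) : exists g : F, g ^+ p = f.
Proof.
exists (f ^+ (p ^ a.-1)); rewrite -exprM -expnSr prednK // -F_card.
exact: expf_card.
Qed.

(** As sigma(x) = x^p modulo p, the digit is a p-th root of the residue of y. The digits are indexed
    by the finite field, which allows the later grouping by digit. *)
Lemma clZq_digit : exists r : F -> K, (forall f, OE (r f)) /\
  forall y, clZq y -> exists f z, clZq z /\ y = sigma (r f) + pi * z.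
Proof.
have /choice [r hr] : forall f : F, exists x, OE x /\ red x = f.
  move=> f; have : [set: F] f by [].
  by case: E_red => _ _ _ <- [x hx <-]; exists x.
exists r; split=> [f|y hy]; first by case: (hr f).
have [x hx yx] := hy _ pi_gt0.
have [e0 [x' [he0 hx' xe]]] := Zq_split hx.
have [f hf] := frob_surj (red e0).
have [hrf redf] := hr f; have hs := sigma_OE hrf.
have hsm : pabs (e0 - sigma (r f)) < 1.
  apply: red_eq0; first exact: intB.
  rewrite redD //; last exact: intN.
  rewrite redN //; have [w hw ->] := sigma_int hrf.
  have hpw : OE (p%:R * w) by apply: intM => //; exact: int_nat.
  rewrite redD //; last exact: intX.
  rewrite redX // redf hf (red_small hpw) ?addr0 ?subrr //.
  rewrite pabsM; apply: le_lt_trans (pabs_p_lt1 (K := K) p_prime).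
  by rewrite ler_piMr ?pabs_ge0 //; case: hw.
have hlt z : Zq z -> pabs (y - z) < pabs pi -> exists2 z', Zq z' & z - sigma (r f) = pi * z'.
  move=> hz yz; apply: Zq_small; first by apply: ZqB => //; exact: Zq_int.
  have -> : z - sigma (r f) = - (y - z) + (y - x) + (pi * x') + (e0 - sigma (r f)).
    by rewrite xe; ring.
  have hp1 := pi_lt1.
  apply: pabsD_lt => //; apply: pabsD_lt.
    by apply: pabsD_lt; rewrite ?pabsN; apply: lt_trans hp1.
  rewrite pabsM; apply: le_lt_trans hp1.
  by rewrite ler_piMr ?pabs_ge0 //; exact: Zq_le1.
exists f, ((y - sigma (r f)) / pi); split; last first.
  by rewrite mulrC divfK ?pi_neq0 // addrC subrK.
move=> e ep.
have ep' : 0 < Num.min (pabs pi) (e * pabs pi).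
  by rewrite lt_min pi_gt0 mulr_gt0 ?pi_gt0.
have [z hz] := hy _ ep'; rewrite lt_min => /andP[yz1 yz2].
have [z' hz' ez] := hlt z hz yz1; exists z' => //.
have -> : (y - sigma (r f)) / pi - z' = (y - z) / pi.
  have -> : y - sigma (r f) = (y - z) + (z - sigma (r f)) by ring.
  by rewrite ez mulrDl [pi * z']mulrC mulfK ?pi_neq0 // addrK.
by rewrite pabs_div // ltr_pdivrMr // pi_gt0.
Qed.

(* Every element of the closure has a digit expansion in powers of [pi]; since
   [pi ^+ N] lies in [Qp], grouping the finitely many digits turns it into a
   finite sum with coefficients in [Qp], which [sigma] fixes. *)
Lemma clZq_sigma y : clZq y -> exists2 x, Zq x & sigma x = y.
Proof.
move=> hy; have [r [hr hd]] := clZq_digit.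
have hdN M z : clZq z -> exists (g : nat -> F) z', clZq z' /\
    z = \sum_(i < M) pi ^+ i * sigma (r (g i)) + pi ^+ M * z'.
  elim: M z => [|M IH] z hz.
    by exists (fun=> 0), z; rewrite big_ord0 add0r expr0 mul1r.
  have [f [z1 [hz1 ->]]] := hd z hz; have [g [z' [hz' ->]]] := IH z1 hz1.
  exists (fun i => if i is j.+1 then g j else f), z'; split=> //.
  rewrite big_ord_recl expr0 mul1r mulrDr addrA exprS mulrA; congr (_ + _ + _).
  by rewrite mulr_sumr; apply: eq_bigr => i _; rewrite lift0 exprS mulrA.
(* Digits are read in blocks of length N, because pi^N is an element of Q_p. *)
have /choice [G hG] : forall z, exists gz : (nat -> F) * K, clZq z -> clZq gz.2 /\
    z = \sum_(i < N) pi ^+ i * sigma (r (gz.1 i)) + pi ^+ N * gz.2.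
  move=> z; have [hz|hz] := pselect (clZq z); last by exists (fun=> 0, 0).
  by have [g [z' h]] := hdN N z hz; exists (g, z').
pose ys := fix ys l := if l is m.+1 then (G (ys m)).2 else y.
have hys l : clZq (ys l) by elim: l => [|l IH] //=; case: (hG _ IH).
pose g l := (G (ys l)).1.
pose w := pi ^+ N.
have wn : pabs w = p%:R^-1 by rewrite pabsX piN_norm.
have w1 : pabs w < 1 by rewrite wn -(@pabs_p R p K) pabs_p_lt1.
have hexp l : y = \sum_(j < l) w ^+ j * (\sum_(i < N) pi ^+ i * sigma (r (g j i))) + w ^+ l * ys l.
  elim: l => [|l IH]; first by rewrite big_ord0 add0r expr0 mul1r.
  rewrite {1}IH big_ord_recr /= -addrA; congr (_ + _).
  have [_ {1}->] := hG _ (hys l).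
  by rewrite mulrDr exprSr mulrA.
(* Collects the powers of w over the blocks whose digit at position i is f. The limit [d] lies in
   Q_p and so is fixed by sigma; infinitely many digits become finitely many coefficients. *)
pose c (i : nat) (f : F) l := \sum_(j < l | g j i == f) w ^+ j.
have hc i f : exists d, forall l, pabs (d - c i f l) <= p%:R^-1 ^+ l.
  apply: (@cauchy_limit _ _ K (c i f) (fun l => p%:R^-1 ^+ l)).
    move=> e e0; have [l hl] := pV_exp_small p_prime e0; exists l => m lm.
    apply: le_trans (ltW hl); apply: ler_wiXn2l; rewrite ?pV_ge0 //.
    by rewrite invf_le1 ?ler1n ?ltr0n ?prime_gt0.
  move=> k l kl; rewrite /c -(subnKC kl) big_mkcond [X in _ - X]big_mkcond.
  rewrite big_split_ord /= [X in pabs X]addrC addKr -wn.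
  apply: (pabs_sum_le p_prime) => [|j _]; first by rewrite exprn_ge0 ?pabs_ge0.
  case: ifP => _; last by rewrite pabs0 // exprn_ge0 ?pabs_ge0.
  by rewrite pabsX; apply: ler_wiXn2l; rewrite ?pabs_ge0 ?leq_addr // ltW.
have /choice [d hd'] : forall u : nat * F, exists d,
     forall l, pabs (d - c u.1 u.2 l) <= p%:R^-1 ^+ l.
  by move=> [i f]; exact: hc.
have dQ u : Qp (d u).
  apply: Qp_closed => // e e0; have [l hl] := pV_exp_small p_prime e0.
  exists (c u.1 u.2 l); last by apply: le_lt_trans hl; exact: hd'.
  by apply: Qp_sum => // j _; exact: QpX.
have d1 u : pabs (d u) <= 1.
  by have := hd' u 0%N; rewrite expr0 /c big_ord0 subr0.
have hL u : L (d u * pi ^+ u.1 * r u.2).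
  apply: (sfM L_sub); last by apply: L_E; case: (hr u.2).
  apply: (sfM L_sub); first by apply: L_E; exact: E_Qp.
  by apply: (sfX L_sub); exact: L_pi.
exists (\sum_(i < N) \sum_f d (i : nat, f) * pi ^+ i * r f).
  apply: Zq_sum => i _; apply: Zq_sum => f _; rewrite -mulrA; apply: Zq_scale.
    exact: int_Qp.
  by apply: Zq_piX; exact: Zq_int.
rewrite sigma_sum => [|i]; last by apply: (sf_sum L_sub) => f _; exact: (hL (i : nat, f)).
have -> : \sum_(i < N) sigma (\sum_f d (i : nat, f) * pi ^+ i * r f)
  = \sum_(i < N) \sum_f d (i : nat, f) * (pi ^+ i * sigma (r f)).
  apply: eq_bigr => i _; rewrite sigma_sum => [|f]; last exact: (hL (i : nat, f)).
  apply: eq_bigr => f _.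
  have Lr : L (r f) by apply: L_E; case: (hr f).
  have Lp : L (pi ^+ i) by apply: (sfX L_sub); exact: L_pi.
  have Ld : L (d (i : nat, f)) by apply: L_E; exact: E_Qp.
  rewrite -mulrA sigmaM //; last exact: (sfM L_sub).
  by rewrite sigma_Qp // sigmaM // sigmaX ?sigma_pi //; exact: L_pi.
apply: (pabs_small_eq p_prime) => e e0; have [l hl] := pV_exp_small p_prime e0.
apply: le_trans (ltW hl).
have pl0 : 0 <= (p%:R^-1 : R) ^+ l by rewrite exprn_ge0 ?pV_ge0.
rewrite (hexp l) opprD addrA.
apply: pabsB_le; last first.
  rewrite pabsM pabsX wn ler_piMr //; apply: clZq_le1; exact: hys.
have -> : \sum_(j < l) w ^+ j * (\sum_(i < N) pi ^+ i * sigma (r (g j i)))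
    = \sum_(i < N) \sum_f c i f l * (pi ^+ i * sigma (r f)).
  rewrite (eq_bigr (fun j : 'I_l => \sum_(i < N) w ^+ j * (pi ^+ i * sigma (r (g j i))))).
    rewrite exchange_big /=; apply: eq_bigr => i _.
    rewrite (eq_bigr (fun f => \sum_(j < l | g j i == f) w ^+ j * (pi ^+ i * sigma (r f)))).
      by rewrite (partition_big (fun j : 'I_l => g j i) xpredT) //=; apply: eq_bigr => f _;
        apply: eq_bigr => j /eqP ->.
    by move=> f _; rewrite /c mulr_suml.
  by move=> j _; rewrite mulr_sumr.
rewrite -sumrB; apply: (pabs_sum_le p_prime) => // i _.
rewrite -sumrB; apply: (pabs_sum_le p_prime) => // f _.
rewrite -mulrBl -[X in _ <= X]mulr1 pabsM; apply: ler_pM; rewrite ?pabs_ge0 //.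
apply: Zq_le1; apply: Zq_piX; apply: Zq_int; exact: sigma_OE.
Qed.

Lemma clZq_sigma_inv_norm y : clZq y -> pabs ('pinv_id L sigma y) = pabs y.
Proof.
move=> /clZq_sigma [x hx <-]; rewrite pinvKV ?inE; last exact: Zq_L.
  by rewrite Zq_sigma_norm.
exact: sigma_inj.
Qed.

End Zq.

(** * Weights and the Frobenius series F_t *)

Section Zexp.
Implicit Types u v : int * int.

(** The number of factors 1/(xy) in the shortest way to write x^u.1 y^u.2 as a monomial in x, y and
    1/(xy). *)
Definition zexp u : int := Num.max 0 (Num.max (- u.1) (- u.2)).

Lemma zexpP u : [/\ 0 <= zexp u, 0 <= u.1 + zexp u, 0 <= u.2 + zexp u &
  [\/ zexp u = 0, u.1 + zexp u = 0 | u.2 + zexp u = 0]].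
Proof.
rewrite /zexp /Order.max.
case: (ltP (- u.1) (- u.2)) => h1; [case: (ltP 0 (- u.2)) => h2|case: (ltP 0 (- u.1)) => h2];
  split; try lia; first [apply: Or31; lia|apply: Or32; lia|apply: Or33; lia].
Qed.

Lemma zexp_unique u (c : int) : 0 <= c -> 0 <= u.1 + c -> 0 <= u.2 + c ->
  [\/ c = 0, u.1 + c = 0 | u.2 + c = 0] -> zexp u = c.
Proof. by case: (zexpP u) => h1 h2 h3 [h4|h4|h4] h5 h6 h7 [h8|h8|h8]; lia. Qed.

Lemma zexp_le u (c : int) : 0 <= c -> 0 <= u.1 + c -> 0 <= u.2 + c -> zexp u <= c.
Proof. by case: (zexpP u) => h1 h2 h3 [h4|h4|h4] h5 h6 h7; lia. Qed.

Lemma zexpD u v : zexp (u + v) <= zexp u + zexp v.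
Proof.
have [h1 h2 h3 _] := zexpP u; have [h4 h5 h6 _] := zexpP v.
by apply: zexp_le => /=; lia.
Qed.

Lemma pairMn u i : u *+ i = (u.1 * i%:Z, u.2 * i%:Z).
Proof.
elim: i => [|i IH]; first by rewrite mulr0n !mulr0.
by rewrite mulrSr IH; congr (_, _) => /=; rewrite -addn1 PoszD mulrDr mulr1.
Qed.

Lemma zexpMn u i : zexp (u *+ i) = zexp u * i%:Z.
Proof.
rewrite pairMn; have [h1 h2 h3 h4] := zexpP u.
apply: zexp_unique => /=; rewrite -?mulrDl ?mulr_ge0 //.
by case: h4 => ->; rewrite mul0r; [apply: Or31|apply: Or32|apply: Or33].
Qed.

End Zexp.

Section Weight.
Variable n : nat.
Hypothesis n_gt0 : (0 < n)%N.
Implicit Types u v : int * int.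

Definition wt u : nat := `|n_omega n u|%N.

(** The scaled weight is that of the shortest monomial, when x, y and 1/(xy) weigh 1, n and n. The
    constant 2n+1 is the weight of the trivial product of x, y and 1/(xy). *)
Lemma wtE u : (wt u)%:Z = (u.1 + zexp u) + n%:Z * ((u.2 + zexp u) + zexp u).
Proof.
have [h1 h2 h3 _] := zexpP u.
have e : n_omega n u = (u.1 + zexp u) + n%:Z * ((u.2 + zexp u) + zexp u).
  rewrite /n_omega -/(zexp u) PoszD PoszM; ring.
by rewrite /wt gez0_abs e // addr_ge0 // mulr_ge0 // addr_ge0.
Qed.

Lemma n_omega_wt u : n_omega n u = (wt u)%:Z.
Proof.
by rewrite wtE /n_omega -/(zexp u) PoszD PoszM; ring.
Qed.

Lemma wtD u v : (wt u + wt v)%:Z =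
  (wt (u + v))%:Z + (2 * n%:Z + 1) * (zexp u + zexp v - zexp (u + v)).
Proof. by rewrite PoszD !wtE /=; ring. Qed.

Lemma wtD_le u v : (wt (u + v)%R <= wt u + wt v)%N.
Proof.
rewrite -lez_nat wtD lerDl mulr_ge0 //.
by have := zexpD u v; lia.
Qed.

Lemma wtD_eq u v : zexp (u + v) = zexp u + zexp v -> wt (u + v) = (wt u + wt v)%N.
Proof. by move=> h; apply/eqP; rewrite -eqz_nat wtD h subrr mulr0 addr0. Qed.

(** At least one product of x, y and 1/(xy) cancels, and it weighs 2n+1. *)
Lemma wtD_lt u v : zexp (u + v) != zexp u + zexp v -> (wt (u + v)%R + (2 * n + 1) <= wt u + wt v)%N.
Proof.
move=> h; rewrite -lez_nat wtD PoszD lerD2l.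
have h1 : 1 <= zexp u + zexp v - zexp (u + v) by have := zexpD u v; lia.
by nia.
Qed.

Lemma wtMn u i : wt (u *+ i) = (wt u * i)%N.
Proof. by apply/eqP; rewrite -eqz_nat PoszM !wtE zexpMn pairMn /=; apply/eqP; ring. Qed.

Lemma wt_ge u : [/\ u.1 + zexp u <= (wt u)%:Z, u.2 + zexp u <= (wt u)%:Z & zexp u <= (wt u)%:Z].
Proof.
have [h1 h2 h3 _] := zexpP u; rewrite wtE.
have n1 : 1 <= n%:Z by lia.
by split; nia.
Qed.

Lemma wt_finite (M : nat) : exists A : {fset int * int}, forall u, u \notin A -> (M < wt u)%N.
Proof.
pose s : seq int := [seq (i%:Z - M%:Z) | i <- iota 0 (M + M).+1].
exists [fset ((x, y) : (int * int)%type) | x in s, y in s]%fset => u h; rewrite ltnNge;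
  apply/negP => wM.
case/negP: h; have [h1 h2 h3 _] := zexpP u; have [h4 h5 h6] := wt_ge u.
have hs (z : int) : - M%:Z <= z <= M%:Z -> z \in s.
  move=> hz; apply/mapP; exists `|(z + M%:Z)%R|%N; last by lia.
  by rewrite mem_iota; lia.
apply/imfset2P; exists u.1; first by apply: hs; lia.
by exists u.2; [apply: hs; lia|case: (u)].
Qed.

End Weight.

(** * Sizes of the coefficients of F_t *)

Section FrobeniusSeries.
Context {R : realType} {p : nat} {K : padicComplexType R p}.
Hypothesis p_prime : prime p.
Hypothesis p_odd : odd p.
Variables (n : nat) (gamma pi tbar : K).
Hypothesis n_gt0 : (0 < n)%N.
Hypothesis pi_gamma : pi ^+ n = gamma.
Hypothesis pi_gt0 : 0 < pabs pi.
Hypothesis pi_lt1 : pabs pi < 1.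
Hypothesis pi_small : forall e : R, 0 < e -> exists l, pabs pi ^+ l < e.
Hypothesis tbar_le1 : pabs tbar <= 1.
Local Notation r := (pabs pi).

Lemma r_mono i j : (i <= j)%N -> r ^+ j <= r ^+ i.
Proof. by move=> ij; apply: ler_wiXn2l; rewrite ?ltW. Qed.

Lemma r_exp_ge0 i : 0 <= r ^+ i. Proof. by rewrite exprn_ge0 // ltW. Qed.
Lemma r_exp_gt0 i : 0 < r ^+ i. Proof. by rewrite exprn_gt0. Qed.

Lemma pabs_Theta_le i : pabs (Theta gamma i) <= r ^+ (n * i).
Proof.
rewrite Theta_scale // -pi_gamma pabsM !pabsX -exprM ler_piMr ?r_exp_ge0 //.
exact: Theta1_le1.
Qed.

Lemma pabs_Theta_small i : (i < p)%N -> pabs (Theta gamma i) = r ^+ (n * i).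
Proof.
by move=> h; rewrite Theta_scale // -pi_gamma pabsM !pabsX -exprM Theta_small ?mulr1.
Qed.

Lemma lsubst_at (th : nat -> K) (c : K) (u : int * int) i :
  u != 0 -> lsubst th c u (u *+ i) = th i * c ^+ i.
Proof.
move=> u0; rewrite /lsubst (@usum_single _ _ _ p_prime _ _ i) ?eqxx // => j ji.
case: eqP => // e; case/eqP: ji; move: e; rewrite !pairMn => -[e1 e2].
apply/eqP; rewrite -eqz_nat; apply/eqP.
have [u1|u1] := eqVneq u.1 0; last exact: (mulfI u1).
have u2 : u.2 != 0 by apply: contra u0 => /eqP u2; apply/eqP; case: (u) u1 u2 => /= ? ? -> ->.
exact: (mulfI u2).
Qed.

Lemma lsubst_off (th : nat -> K) (c : K) (u v : int * int) :
  (forall i, v <> u *+ i) -> lsubst th c u v = 0.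
Proof.
move=> h; apply: psum_usumE => //; apply: psum_zero => // i.
by case: eqP => // e; case: (h i).
Qed.

Definition Ft_term (v x : int * int) : K :=
  lsubst (Theta gamma) 1 (n%:Z, 0) (x.1, 0) * lsubst (Theta gamma) 1 (0, 1) (0, x.2)
  * lsubst (Theta gamma) tbar (-1, -1) (v - x).

Lemma lmul_XY x :
  lmul (lsubst (Theta gamma) 1 (n%:Z, 0)) (lsubst (Theta gamma) 1 (0, 1)) x =
  lsubst (Theta gamma) 1 (n%:Z, 0) (x.1, 0) * lsubst (Theta gamma) 1 (0, 1) (0, x.2).
Proof.
rewrite /lmul (@usum_single _ _ _ p_prime _ _ (x.1, 0)); last first.
  move=> y yx.
  have [y2|y2] := eqVneq y.2 0; last first.
    rewrite lsubst_off ?mul0r // => i; rewrite pairMn => e; case/eqP: y2.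
    by rewrite e /= mul0r.
  rewrite [X in _ * X]lsubst_off ?mulr0 // => i; rewrite pairMn => -[e _].
  case/eqP: yx; case: (y) e y2 => y1 y2' /= e ->; congr (_, _).
  by apply/eqP; rewrite eq_sym -subr_eq0 e mul0r.
by congr (_ * lsubst _ _ _ _); case: x => x1 x2; congr (_, _) => /=; rewrite ?subrr ?subr0.
Qed.

Lemma F_tE v : F_t n gamma tbar v = usum (Ft_term v).
Proof. have E : lmul (lsubst (Theta gamma) 1 (n%:Z, 0)) (lsubst (Theta gamma) 1 (0, 1)) =
  fun x => lsubst (Theta gamma) 1 (n%:Z, 0) (x.1, 0) * lsubst (Theta gamma) 1 (0, 1) (0, x.2).
  by apply/funext => x; exact: lmul_XY.
by rewrite /F_t E. Qed.

Lemma Ft_termP v x : Ft_term v x = 0 \/ exists i j c : nat,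
  [/\ x = (n%:Z * i%:Z, j%:Z), v.1 + c%:Z = n%:Z * i%:Z, v.2 + c%:Z = j%:Z &
    Ft_term v x = Theta gamma i * Theta gamma j * (Theta gamma c * tbar ^+ c)].
Proof.
rewrite /Ft_term.
have [[i hi]|h] := pselect (exists i, (x.1, 0) = (n%:Z, 0 : int) *+ i); last first.
  by left; rewrite lsubst_off ?mul0r // => i e; apply: h; exists i.
have [[j hj]|h] := pselect (exists j, (0, x.2) = (0 : int, 1 : int) *+ j); last first.
  by left; rewrite [X in _ * X * _]lsubst_off ?mulr0 ?mul0r // => j e; apply: h; exists j.
have [[c hc]|h] := pselect (exists c, v - x = (-1 : int, -1 : int) *+ c); last first.
  by left; rewrite [X in _ * X]lsubst_off ?mulr0 // => c e; apply: h; exists c.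
right; exists i, j, c.
have n0 : (n%:Z, 0 : int) != 0 by apply/eqP => -[e]; move: n_gt0; rewrite e.
rewrite hi hj hc !lsubst_at // !expr1n !mulr1.
move: hi hj hc; rewrite !pairMn /= => -[e1] [e2] [e3 e4].
split=> //.
- by case: (x) e1 e2 => x1 x2 /= -> ->; rewrite mul1r.
- by lia.
- by lia.
Qed.

(** A term with c factors 1/(xy) has size at most r to the power wt v + (2n+1)(c - zexp v), so any
    lower bound [c0] for the excess c - zexp v can be added to the weight. The divisibility is due
    to x entering the first factor only as x^n. *)
Lemma Ft_term_le v x (c0 : nat) : (forall c : nat, (n %| `|(v.1 + c%:Z)%R|)%N ->
     x = (v.1 + c%:Z, v.2 + c%:Z) -> zexp v <= c%:Z -> zexp v + c0%:Z <= c%:Z) ->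
  pabs (Ft_term v x) <= r ^+ (wt n v + c0).
Proof.
move=> hc0; have [->|[i [j [c [ex e1 e2 ->]]]]] := Ft_termP v x.
  by rewrite pabs0 ?r_exp_ge0.
have zc : zexp v <= c%:Z by apply: zexp_le; rewrite ?e1 ?e2.
have cc : zexp v + c0%:Z <= c%:Z.
  by apply: hc0; rewrite ?e1 ?e2 // absz_nat -?PoszM ?abszM ?dvdn_mulr.
apply: (@le_trans _ _ (r ^+ (n * i) * r ^+ (n * j) * r ^+ (n * c))).
  rewrite !pabsM; apply: ler_pM; rewrite ?mulr_ge0 ?pabs_ge0 //.
    by apply: ler_pM; rewrite ?pabs_ge0 ?pabs_Theta_le.
  rewrite -[X in _ <= X]mulr1; apply: ler_pM; rewrite ?pabs_ge0 ?pabs_Theta_le //.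
  by rewrite pabsX exprn_ile1 ?pabs_ge0.
rewrite -!exprD; apply: r_mono; rewrite -lez_nat !PoszD wtE // !PoszM -e1 -e2.
have [h1 _ _ _] := zexpP v.
have := n_gt0; nia.
Qed.

Lemma Ft_null v : null_family (Ft_term v).
Proof.
move=> e e0; have [l hl] := pi_small e0.
exists [fset (v.1 + (i : nat)%:Z, v.2 + i%:Z)%R | i in iota 0 (l + `|zexp v|).+1]%fset => x hx.
apply: le_trans (ltW hl); apply: le_trans (r_mono (leq_addl (wt n v) l)).
apply: Ft_term_le => c _ ex zc; rewrite leNgt; apply/negP => h.
case/negP: hx; apply/imfsetP; exists c => //=; change (c \in iota 0 (l + `|zexp v|).+1);
  rewrite mem_iota.
by have [h1 _ _ _] := zexpP v; lia.
Qed.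

Lemma F_t_psum v : psum (Ft_term v) (F_t n gamma tbar v).
Proof. by rewrite F_tE; apply: null_psum => //; exact: Ft_null. Qed.

Lemma F_t_le v : pabs (F_t n gamma tbar v) <= r ^+ wt n v.
Proof.
apply: (psum_le p_prime _ (F_t_psum v)); first exact: r_exp_ge0.
move=> x; rewrite -[wt n v]addn0; apply: Ft_term_le => c _ _; lia.
Qed.

(** A term of full size would have c = zexp v, making v.1 + zexp v a multiple of n. *)
Lemma F_t_lt v : ~~ (n %| `|(v.1 + zexp v)%R|)%N ->
  pabs (F_t n gamma tbar v) <= r ^+ (wt n v).+1.
Proof.
move=> h; apply: (psum_le p_prime _ (F_t_psum v)); first exact: r_exp_ge0.
move=> x; rewrite -addn1; apply: Ft_term_le => c nc _ zc.
suff : zexp v != c%:Z by lia.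
by apply: contra h => /eqP ->.
Qed.

(** Only the term without 1/(xy) can have full size, and it has it since its indices k, b, 0 are
    below p. *)
Lemma F_t_unit (k b : nat) : (k < p)%N -> (b < p)%N ->
  pabs (F_t n gamma tbar (n%:Z * k%:Z, b%:Z)) = r ^+ (n * (k + b)).
Proof.
move=> kp bp; set v := (_, _).
have zv : zexp v = 0 by apply: zexp_unique => //=; rewrite ?addr0 ?mulr_ge0 //; exact: Or31.
have wv : wt n v = (n * (k + b))%N.
  by apply/eqP; rewrite -eqz_nat wtE // zv /= !addr0 -mulrDr.
have hT : pabs (Ft_term v v) = r ^+ (n * (k + b)).
  rewrite /Ft_term subrr /=.
  have -> : (n%:Z * k%:Z, 0) = (n%:Z, 0 : int) *+ k by rewrite pairMn /= mul0r.
  have -> : (0, b%:Z) = (0 : int, 1 : int) *+ b by rewrite pairMn /= mul0r mul1r.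
  have e3 : lsubst (Theta gamma) tbar (-1, -1) 0 = Theta gamma 0.
    by have := @lsubst_at (Theta gamma) tbar (-1, -1) 0 isT; rewrite mulr0n expr0 mulr1.
  have n0 : (n%:Z, 0 : int) != 0 by apply/eqP => -[e]; move: n_gt0; rewrite e.
  rewrite (lsubst_at _ _ k n0) (lsubst_at _ _ b) // e3 !expr1n !mulr1.
  by rewrite !pabsM !pabs_Theta_small ?prime_gt0 // muln0 expr0 mulr1 -exprD mulnDr.
have h : pabs (F_t n gamma tbar v - Ft_term v v) <= r ^+ (n * (k + b)).+1.
  apply: (psum_dominant p_prime _ (F_t_psum v)); first exact: r_exp_ge0.
  move=> x xv; rewrite -wv -addn1; apply: Ft_term_le => c _ ex _; rewrite zv.
  suff : c%:Z != 0 by lia.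
  by apply: contra xv => /eqP c0; rewrite ex c0 !addr0; case: (v).
rewrite -hT.
have -> : F_t n gamma tbar v = Ft_term v v + (F_t n gamma tbar v - Ft_term v v) by ring.
apply: pabs_dominant; apply: le_lt_trans h _; rewrite hT exprS.
by rewrite -[X in _ < X]mul1r ltr_pM2r ?r_exp_gt0.
Qed.

End FrobeniusSeries.

(** * The multiplier series of D_x and D_y *)

Section Hseries_facts.
Context {R : realType} {p : nat} {K : padicComplexType R p}.
Hypothesis p_prime : prime p.
Variables (n : nat) (gamma pi tbar : K) (sigma : K -> K).
Hypothesis n_gt0 : (0 < n)%N.
Hypothesis pi_gamma : pi ^+ n = gamma.
Hypothesis pi_gt0 : 0 < pabs pi.
Hypothesis pi_lt1 : pabs pi < 1.
Hypothesis gamma_bound : forall i, pabs (gamma_ gamma i * p%:R ^+ i) <=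
  pabs gamma ^+ (p ^ i + p.-1 * (p ^ i - 1)).
Hypothesis gamma_0 : gamma_ gamma 0 = gamma.
Hypothesis sigma_tbar : forall i, pabs (iter i sigma tbar) <= 1.
Local Notation r := (pabs pi).
Implicit Types u v : int * int.

Let p_gt1 := prime_gt1 p_prime.

Section OneSeries.
Variables (c : K) (w : int * int).
Hypothesis c_le1 : pabs c <= 1.
Hypothesis w_zexp : zexp w = 0.
Hypothesis w_wt : wt n w = n.

Let Z : int * int := (-1, -1).
Local Notation H := (Hseries gamma tbar sigma c w).
Let term v i := gamma_ gamma i * p%:R ^+ i *
    (c * lmonom (w *+ p ^ i) v - iter i sigma tbar * lmonom (Z *+ p ^ i) v).

Lemma wt_Z : wt n Z = n.
Proof.
have zZ : zexp Z = 1 by apply: zexp_unique => //; apply: Or32.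
by apply/eqP; rewrite -eqz_nat wtE // zZ /= add0r mulr1.
Qed.

Lemma term_cases v i : term v i = 0 \/
  [\/ v = w *+ p ^ i | v = Z *+ p ^ i].
Proof.
rewrite /term /lmonom; case: eqP => [->|_]; first by right; left.
case: eqP => [->|_]; first by right; right.
by left; rewrite !mulr0 subr0 mulr0.
Qed.

Lemma term_wt v i : term v i = 0 \/ wt n v = (n * p ^ i)%N.
Proof.
by have [|[->|->]] := term_cases v i; [left|right; rewrite wtMn // w_wt
  |right; rewrite wtMn // wt_Z].
Qed.

Lemma term_le v i : pabs (term v i) <= r ^+ (wt n v + p.-1 * (wt n v - n)).
Proof.
have [->|->] := term_wt v i; first by rewrite pabs0 // exprn_ge0 // ltW.
rewrite /term pabsM -[X in _ <= X]mulr1; apply: ler_pM; rewrite ?pabs_ge0 //.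
  apply: le_trans (gamma_bound i) _; rewrite -pi_gamma pabsX -exprM mulnDr.
  by rewrite mulnCA mulnBr muln1.
apply: pabsB_le; rewrite pabsM mulr_ile1 ?pabs_ge0 ?pabs_nat_le1 //.
Qed.

Lemma H_psum v : psum (term v) (H v).
Proof.
have h : psum (term v) (\sum_(i <- [fset i | i in iota 0 (wt n v).+1]%fset) term v i).
  apply: psum_finite => // i hi; have [//|e] := term_wt v i.
  case/negP: hi; apply/imfsetP; exists i => //=.
  change (i \in iota 0 (wt n v).+1); rewrite mem_iota add0n /= ltnS e.
  by apply: leq_trans (leq_pmull _ n_gt0); rewrite ltnW // ltn_expl.
have e := psum_usumE p_prime h.
by change (psum (term v) (usum (term v))); rewrite e.
Qed.

Lemma H_le v : pabs (H v) <= r ^+ (wt n v + p.-1 * (wt n v - n)).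
Proof.
apply: (psum_le p_prime _ (H_psum v)); first by rewrite exprn_ge0 // ltW.
by move=> i; exact: term_le.
Qed.

Lemma H_supp v : H v != 0 -> exists i, [\/ v = w *+ p ^ i | v = Z *+ p ^ i].
Proof.
move=> Hv; apply: contrapT => h; case/eqP: Hv.
apply: (psum_unique p_prime (H_psum v)); apply: psum_zero => // i.
by have [//|hi] := term_cases v i; case: h; exists i.
Qed.

Lemma H_zero_only v : (forall i, term v i.+1 = 0) -> H v = term v 0.
Proof.
move=> h; apply: psum_usumE => //; apply: psum_single => // -[|i] // _; exact: h.
Qed.

Lemma H_small_wt v : wt n v = n -> H v = term v 0.
Proof.
move=> hv; apply: H_zero_only => i; have [//|e] := term_wt v i.+1; move: e.
rewrite hv -{1}[n]muln1 => /eqP; rewrite eqn_pmul2l // eq_sym -[1%N](expn0 p).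
by rewrite eqn_exp2l.
Qed.

Lemma wZ_neq : w != Z.
Proof. by apply/eqP => e; move: w_zexp; rewrite e. Qed.

Lemma H_w : H w = c * gamma.
Proof.
rewrite H_small_wt // /term /lmonom expn0 !mulr1n eqxx (negbTE wZ_neq).
by rewrite gamma_0 expr0 mulr1 mulr0 subr0 mulr1 mulrC.
Qed.

Lemma H_Z : H Z = - (tbar * gamma).
Proof.
rewrite H_small_wt ?wt_Z // /term expn0 !mulr1n.
have -> : lmonom w Z = 0 :> K by rewrite /lmonom eq_sym (negbTE wZ_neq).
have -> : lmonom Z Z = 1 :> K by rewrite /lmonom eqxx.
by rewrite gamma_0 expr0 mulr1 mulr0 add0r /= mulr1 mulrN mulrC.
Qed.

End OneSeries.

Local Notation Hx := (Hseries gamma tbar sigma n%:R (n%:Z, 0)).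
Local Notation Hy := (Hseries gamma tbar sigma 1 (0, 1)).

Lemma zexp_X : zexp (n%:Z, 0) = 0.
Proof. by apply: zexp_unique => //=; apply: Or31. Qed.
Lemma zexp_Y : zexp (0, 1) = 0.
Proof. by apply: zexp_unique => //=; apply: Or31. Qed.
Lemma wt_X : wt n (n%:Z, 0) = n.
Proof. by apply/eqP; rewrite -eqz_nat wtE // zexp_X /= !addr0 mulr0 addr0. Qed.
Lemma wt_Y : wt n (0, 1) = n.
Proof. by apply/eqP; rewrite -eqz_nat wtE // zexp_Y /= !addr0 add0r mulr1. Qed.

(** Both series come from one: they are x d/dx and y d/dy of the sum of gamma_i (x^(n p^i) + y^(p^i)
    + sigma^i(tbar) (xy)^(-p^i)). This symmetry makes D_x and D_y commute. *)
Lemma H_sym v : v.1%:~R * Hy v = v.2%:~R * Hx v.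
Proof.
have hx := psumZ p_prime v.2%:~R (H_psum _ wt_X v).
have hy := psumZ p_prime v.1%:~R (H_psum _ wt_Y v).
apply/eqP; rewrite -subr_eq0; apply/eqP.
apply: (psum_unique p_prime (psumB p_prime (hy 1) (hx n%:R))); apply: psum_zero => // i.
set g := _ * _ ^+ i; set s := iter i sigma tbar.
have mon1 : v.1%:~R * lmonom ((0, 1) *+ p ^ i) v = 0 :> K.
  by rewrite /lmonom; case: eqP => [->|_]; rewrite ?mulr0 // pairMn /= ?mul0r ?mulr0z ?mul0r.
have mon2 : v.2%:~R * lmonom ((n%:Z, 0) *+ p ^ i) v = 0 :> K.
  by rewrite /lmonom; case: eqP => [->|_]; rewrite ?mulr0 // pairMn /= ?mul0r ?mulr0z ?mul0r.
have mon3 : v.1%:~R * lmonom ((-1, -1) *+ p ^ i) v = v.2%:~R * lmonom ((-1, -1) *+ p ^ i) v :> K.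
  by rewrite /lmonom; case: eqP => [->|_]; rewrite ?mulr0 // pairMn.
move: mon1 mon2 mon3.
move: (lmonom _ v) (lmonom _ v) (lmonom _ v) (v.1%:~R) (v.2%:~R) => X Y W a b hX hY hW.
transitivity (g * (a * W - n%:R * (b * Y) - s * (a * X - b * X))); first by ring.
by rewrite hX hY hW subrr !mulr0 !subr0 mulr0.
Qed.

End Hseries_facts.

(** * Functionals dual to the basis *)

Section Contraction.
Context {R : realType} {p : nat} {K : padicComplexType R p}.
Hypothesis p_prime : prime p.
Variables (I : choiceType) (M : I -> I -> K) (B S : I -> R) (kappa : R).
Hypothesis B_ge0 : forall v, 0 <= B v.
Hypothesis B_le : forall v, B v <= S v.
Hypothesis kappa_itv : 0 <= kappa < 1.
Hypothesis M_null : forall v e, 0 < e ->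
  exists A : {fset I}, forall x, x \notin A -> pabs (M v x) * B x <= e.
Hypothesis M_contr : forall v x, pabs (M v x) * S x <= kappa * S v.

Lemma S_ge0 v : 0 <= S v. Proof. exact: le_trans (B_ge0 v) (B_le v). Qed.

Lemma kappa_small v (e : R) : 0 < e -> exists k, kappa ^+ k * S v <= e.
Proof.
move=> e0; have S1 : 0 < S v + 1 by rewrite ltr_wpDl // S_ge0.
have [k0 k1] := andP kappa_itv.
have hk : `|kappa| < 1 by rewrite ger0_norm.
have /cvgrPdist_lt/(_ _ (divr_gt0 e0 S1)) [k _ /(_ k (leqnn k))] /= := cvg_expr hk.
rewrite sub0r normrN ger0_norm ?exprn_ge0 // ltr_pdivlMr // => h; exists k.
apply: le_trans (ltW h); rewrite ler_wpM2l ?exprn_ge0 //.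
by rewrite lerDl.
Qed.

Lemma row_psum (l : I -> K) v : (forall x, pabs (l x) <= B x) ->
  psum (fun x => M v x * l x) (usum (fun x => M v x * l x)).
Proof.
move=> hl; apply: null_psum => // e e0; have [A hA] := M_null v e0.
exists A => x /hA h; apply: le_trans h; rewrite pabsM.
by rewrite ler_wpM2l ?pabs_ge0.
Qed.

Lemma row_contr (l : I -> K) v c : 0 <= c -> (forall x, pabs (l x) <= B x) ->
  (forall x, pabs (l x) <= c * S x) ->
  pabs (usum (fun x => M v x * l x)) <= kappa * c * S v.
Proof.
move=> c0 hl hc; have [k0 _] := andP kappa_itv.
apply: (psum_le p_prime _ (row_psum v hl)); first by rewrite !mulr_ge0 ?S_ge0.
move=> x; rewrite pabsM.
apply: (@le_trans _ _ (c * (pabs (M v x) * S x))).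
  by rewrite mulrCA ler_wpM2l ?pabs_ge0.
by rewrite mulrAC [_ * c]mulrC ler_wpM2l.
Qed.

Lemma contraction_unique (l : I -> K) : (forall x, pabs (l x) <= B x) ->
  (forall v, l v = - usum (fun x => M v x * l x)) -> forall v, l v = 0.
Proof.
move=> hl hT; have [k0 _] := andP kappa_itv.
have h k : forall v, pabs (l v) <= kappa ^+ k * S v.
  elim: k => [|k IH] v; first by rewrite mul1r; exact: le_trans (hl v) (B_le v).
  by rewrite hT pabsN exprS; apply: row_contr => //; rewrite exprn_ge0.
move=> v; apply: (pabs_small_eq p_prime) => e e0; rewrite subr0.
by have [k hk] := kappa_small v e0; exact: le_trans (h k v) hk.
Qed.

(** The map preserves the ball given by [B] without any gain, and contracts by kappa for the larger
    weight [S]. The iterates stay in the ball and converge at the rate kappa^k S, so the limit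
    inherits the sharper bound [B]. *)
Lemma contraction_exists (d : I -> K) :
  (forall v, pabs (d v) <= B v) ->
  (forall v x, pabs (M v x) * B x <= B v) ->
  exists l : I -> K, (forall x, pabs (l x) <= B x) /\
    forall v, l v = d v - usum (fun x => M v x * l x).
Proof.
move=> hd hB; have [k0 _] := andP kappa_itv.
pose T (l : I -> K) v := d v - usum (fun x => M v x * l x).
pose L k := iter k T (fun=> 0).
have TB l : (forall x, pabs (l x) <= B x) -> forall x, pabs (T l x) <= B x.
  move=> hl v; apply: pabsB_le => //; apply: (psum_le p_prime _ (row_psum v hl)) => // x.
  by apply: le_trans (hB v x); rewrite pabsM ler_wpM2l ?pabs_ge0.
have LB k : forall x, pabs (L k x) <= B x.
  by elim: k => [|k IH] x; [rewrite pabs0|exact: TB].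
have Tdiff l l' c : 0 <= c -> (forall x, pabs (l x) <= B x) -> (forall x, pabs (l' x) <= B x) ->
    (forall x, pabs (l x - l' x) <= c * S x) ->
    forall v, pabs (T l v - T l' v) <= kappa * c * S v.
  move=> c0 hl hl' hll v.
  have -> : T l v - T l' v = - (usum (fun x => M v x * l x) - usum (fun x => M v x * l' x)).
    by rewrite /T; ring.
  have := psumB p_prime (row_psum v hl) (row_psum v hl').
  move=> /(psum_eq (g := fun x => M v x * (l x - l' x))) h.
  rewrite pabsN -(psum_usumE p_prime (h _)); last by move=> x; rewrite mulrBr.
  by apply: row_contr => // x; exact: pabsB_le.
have step k : forall v, pabs (L k.+1 v - L k v) <= kappa ^+ k * S v.
  elim: k => [|k IH] v.
    by rewrite subr0 mul1r; apply: le_trans (B_le v); exact: (LB 1%N).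
  by rewrite exprS; apply: (Tdiff (L k.+1) (L k)) IH _; [exact: exprn_ge0|exact: LB|exact: LB].
have k1 : kappa <= 1 by have /andP[_ /ltW] := kappa_itv.
have steps i j v : (i <= j)%N -> pabs (L j v - L i v) <= kappa ^+ i * S v.
  move=> /subnK <-; elim: (j - i)%N => [|m IH].
    by rewrite subrr pabs0 // mulr_ge0 ?exprn_ge0 ?S_ge0.
  have -> : L (m.+1 + i)%N v - L i v = (L (m + i).+1 v - L (m + i)%N v) + (L (m + i)%N v - L i v).
    by rewrite addSn; ring.
  apply: pabsD_le => //; apply: le_trans (step _ v) _; rewrite ler_wpM2r ?S_ge0 //.
  by apply: ler_wiXn2l; rewrite // leq_addl.
have /choice [l hl] : forall v, exists lv, forall i, pabs (lv - L i v) <= kappa ^+ i * S v.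
  move=> v; apply: (@cauchy_limit _ _ K (fun k => L k v) (fun i => kappa ^+ i * S v)).
    move=> e e0; have [k hk] := kappa_small v e0; exists k => m km.
    by apply: le_trans hk; rewrite ler_wpM2r ?S_ge0 //; apply: ler_wiXn2l.
  by move=> i j ij; exact: steps.
have lB x : pabs (l x) <= B x.
  (* An error kappa^k S x falls below [B x] only if the latter is positive; otherwise every iterate
     vanishes at x. *)
  have [Bx|Bx] := ltP 0 (B x); last first.
    have B0 : B x = 0 by apply/eqP; rewrite eq_le Bx B_ge0.
    rewrite B0 le_eqVlt; apply/orP; left; apply/eqP.
    apply: le_eps0 (pabs_ge0 _) _ => e e0; have [k hk] := kappa_small x e0.
    have L0 : L k x = 0.
      by apply/eqP; rewrite -(pabs_eq0E p_prime) eq_le pabs_ge0 andbT -B0 LB.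
    by have := hl x k; rewrite L0 subr0 => h; exact: le_trans h hk.
  have [k hk] := kappa_small x Bx.
  have -> : l x = (l x - L k x) + L k x by ring.
  by apply: pabsD_le => //; apply: le_trans (hl x k) hk.
exists l; split=> // v; apply: (pabs_small_eq p_prime) => e e0.
have [k hk] := kappa_small v e0; apply: le_trans hk.
have -> : l v - (d v - usum (fun x => M v x * l x)) = (l v - L k.+1 v) + - (T l v - T (L k) v).
  by rewrite /T /= /T; ring.
have kS : kappa ^+ k.+1 * S v <= kappa ^+ k * S v.
  by rewrite exprS -mulrA ler_piMl ?mulr_ge0 ?exprn_ge0 ?S_ge0.
apply: pabsD_le; first exact: le_trans (hl v k.+1) kS.
rewrite pabsN; apply: le_trans kS; rewrite exprS.
by apply: (Tdiff l (L k)) v; [exact: exprn_ge0|exact: lB|exact: LB|move=> x; exact: hl].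
Qed.

End Contraction.

(** * A dominant term for each exponent off the basis *)

Section Targets.
Variable n : nat.
Hypothesis n_gt1 : (1 < n)%N.
Implicit Types u v : int * int.
Local Notation wt := (wt n).

Definition vX : int * int := (n%:Z, 0).
Definition vY : int * int := (0, 1).
Definition vZ : int * int := (-1, -1).
Definition vXY (k : bool) := if k then vY else vX.

Let n_gt0 : (0 < n)%N := ltnW n_gt1.

Lemma zexp_vXY k : zexp (vXY k) = 0.
Proof. by case: k; [exact: zexp_Y|exact: zexp_X]. Qed.
Lemma wt_vXY k : wt (vXY k) = n.
Proof. by case: k; [exact: wt_Y|exact: wt_X]. Qed.
Lemma zexp_vZ : zexp vZ = 1. Proof. by apply: zexp_unique => //; apply: Or32. Qed.
Lemma wt_vZ : wt vZ = n. Proof. exact: wt_Z. Qed.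

Lemma wt_dichotomy u v : (zexp (u + v) = zexp u + zexp v /\ wt (u + v) = (wt u + wt v)%N) \/
  (wt (u + v)%R + (2 * n + 1) <= wt u + wt v)%N.
Proof.
have [h|h] := eqVneq (zexp (u + v)) (zexp u + zexp v); [left|right].
  by split => //; exact: wtD_eq.
exact: wtD_lt.
Qed.

(* For each exponent [v], the operator (D_y if [true], D_x if [false]) and the
   monomial [vt] such that the operator applied to the exponent [v - vt] has [v]
   as its dominant term; [None] for the exponents of the basis. *)
Definition gen v : option (bool * (int * int)) :=
  if (2 <= zexp v) || ((zexp v == 1) && (0 <= v.1)) then Some (true, vZ)
  else if zexp v == 1 then Some (false, vZ)
  else if v.1 == 0 then (if 1 <= v.2 then Some (true, vY) else None)
  else if 2 <= v.2 then Some (true, vY)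
  else if n%:Z < v.1 then Some (false, vX) else None.

(** On these half-axes the other entry of the equation has the same weight as the target and [zexp]
    equal to 1 instead of 0. The value 2 puts the target ahead. *)
Definition bonus u : int :=
  if ((u.2 == 0) && (n%:Z < u.1)) || ((u.1 == 0) && (1 <= u.2)) then 2 else 0.

(* [gen] picks its target so that, in the equation it comes from, every other
   entry lies at an exponent of smaller rank. *)
Definition rank u : int := 3 * (wt u)%:Z + zexp u + bonus u.

Lemma bonusP u : (bonus u = 2 /\ ((u.2 = 0 /\ n%:Z < u.1) \/ (u.1 = 0 /\ 1 <= u.2))) \/
  (bonus u = 0 /\ ~ ((u.2 = 0 /\ n%:Z < u.1) \/ (u.1 = 0 /\ 1 <= u.2))).
Proof.
rewrite /bonus; case: ifP => h; [left|right]; split => //.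
  by case/orP: h => /andP[/eqP h1 h2]; [left|right].
by case=> -[h1 h2]; move: h; rewrite h1 h2 eqxx //= orbT.
Qed.

Lemma genP v : match gen v with
  | Some (true, vt) => (vt = vZ /\ (2 <= zexp v \/ (zexp v = 1 /\ 0 <= v.1))) \/
      (vt = vY /\ zexp v = 0 /\ ((v.1 = 0 /\ 1 <= v.2) \/ (1 <= v.1 /\ 2 <= v.2)))
  | Some (false, vt) => (vt = vZ /\ zexp v = 1 /\ v.1 = -1) \/
      (vt = vX /\ zexp v = 0 /\ n%:Z < v.1 /\ 0 <= v.2 <= 1)
  | None => zexp v = 0 /\ ((0 <= v.1 <= n%:Z /\ v.2 = 0) \/ (1 <= v.1 <= n%:Z /\ v.2 = 1))
  end.
Proof.
rewrite /gen; have [h1 h2 h3 h4] := zexpP v.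
case: ifP => [/orP[h|/andP[/eqP h h']]|e1]; [by left; split=> //; left|by left; split=> //;
  right|].
case: ifP => [/eqP h|e2]; first by left; split=> //; split=> //; move: e1; lia.
have z0 : zexp v = 0 by move: e1 e2; lia.
case: ifP => [/eqP h|e3].
  case: ifP => e4; last by split=> //; left; move: e4; lia.
  by right; split=> //; split=> //; left.
case: ifP => e4; first by right; split=> //; split=> //; right; split=> //; lia.
case: ifP => e5; first by right; split=> //; split=> //; split=> //; lia.
by split=> //; have [e6|e6] := eqVneq v.2 0; [left|right]; lia.
Qed.

Lemma zexpL u : 0 <= zexp u /\ 0 <= u.1 + zexp u /\ 0 <= u.2 + zexp u /\
  (zexp u = 0 \/ u.1 + zexp u = 0 \/ u.2 + zexp u = 0).
Proof.
have [h1 h2 h3 h4] := zexpP u; do 3! split=> //.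
by case: h4 => h; [left|right; left|right; right].
Qed.

Lemma wt_target v vt : zexp v = zexp (v - vt) + zexp vt -> wt vt = n ->
  wt v = (wt (v - vt)%R + n)%N.
Proof.
move=> h1 h2; have := @wtD_eq n (v - vt) vt.
by rewrite subrK h2; apply.
Qed.

(** The margin 2n+1 at v - vt pays for dividing by the leading coefficient, whose size r^n is 2n
    half powers. The entry at v - vt + v' is as large as the leading one, so there a margin 1 is
    enough. Either that entry has the weight of the target, and [zexp] or [bonus] decides, or its
    weight is smaller by at least 2n+1. *)
Lemma gen_step v k vt : gen v = Some (k, vt) ->
  [/\ vt = vXY k \/ vt = vZ, wt v = (wt (v - vt)%R + n)%N, zexp (v - vt) <= zexp v,
   rank (v - vt) + 2 * n%:Z + 1 <= rank v &
   forall v', v' = vXY k \/ v' = vZ -> v' != vt -> rank (v - vt + v') + 1 <= rank v].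
Proof.
move=> e; have := genP v; rewrite e => {e}.
case: v => a b.
have [c1 [c2 [c3 c4]]] := zexpL (a, b); have bv := bonusP (a, b).
rewrite /= in c2 c3 c4 bv *.
have wX : wt vX = n := wt_vXY false; have wY : wt vY = n := wt_vXY true; have wZ := wt_vZ.
have zX : zexp vX = 0 := zexp_vXY false; have zY : zexp vY = 0 := zexp_vXY true;
  have zZ := zexp_vZ.
case: k => -[[-> h]|[-> h]].
- have [d1 [d2 [d3 d4]]] := zexpL ((a, b) - vZ); have bu := bonusP ((a, b) - vZ).
  rewrite /= in d2 d3 d4 bu.
  have hz : zexp (a, b) = zexp ((a, b) - vZ) + zexp vZ by rewrite zZ; lia.
  have hw := wt_target hz wZ; split=> //; [by right|lia|by rewrite /rank hw PoszD; lia|].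
  move=> v' [->|->]; last by rewrite eqxx.
  move=> _; have [f1 [f2 [f3 f4]]] := zexpL ((a, b) - vZ + vY);
    have bx := bonusP ((a, b) - vZ + vY).
  rewrite /= in f2 f3 f4 bx.
  have wd := wt_dichotomy ((a, b) - vZ) vY; rewrite /vXY zY wY in wd *.
  case: wd => [[wd1 wd2]|wd].
    suff bx0 : bonus ((a, b) - vZ + vY) = 0 by rewrite /rank hw bx0 wd2 PoszD; clear bx bu; lia.
    by case: bx => [[_ bx]|[]//]; clear bu bv; lia.
  have bx2 : bonus ((a, b) - vZ + vY) <= 2 by case: bx => -[->].
  have bv0 : 0 <= bonus (a, b) by case: bv => -[->].
  by rewrite /rank hw PoszD; clear bx bu bv; lia.
- have [d1 [d2 [d3 d4]]] := zexpL ((a, b) - vY); have bu := bonusP ((a, b) - vY).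
  rewrite /= in d2 d3 d4 bu.
  have hz : zexp (a, b) = zexp ((a, b) - vY) + zexp vY by rewrite zY; lia.
  have hw := wt_target hz wY; split=> //; [by left|lia|by rewrite /rank hw PoszD; lia|].
  move=> v' [->|->]; first by rewrite eqxx.
  move=> _; have [f1 [f2 [f3 f4]]] := zexpL ((a, b) - vY + vZ);
    have bx := bonusP ((a, b) - vY + vZ).
  rewrite /= in f2 f3 f4 bx.
  have wd := wt_dichotomy ((a, b) - vY) vZ; rewrite zZ wZ in wd.
  case: wd => [[wd1 wd2]|wd].
    suff bx0 : bonus ((a, b) - vY + vZ) = 0 by rewrite /rank hw bx0 wd2 PoszD; clear bx bu; lia.
    by case: bx => [[_ bx]|[]//]; clear bu bv; lia.
  have bx2 : bonus ((a, b) - vY + vZ) <= 2 by case: bx => -[->].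
  have bv0 : 0 <= bonus (a, b) by case: bv => -[->].
  by rewrite /rank hw PoszD; clear bx bu bv; lia.
- have [d1 [d2 [d3 d4]]] := zexpL ((a, b) - vZ); have bu := bonusP ((a, b) - vZ).
  rewrite /= in d2 d3 d4 bu.
  have hz : zexp (a, b) = zexp ((a, b) - vZ) + zexp vZ by rewrite zZ; lia.
  have hw := wt_target hz wZ; split=> //; [by right|lia|by rewrite /rank hw PoszD; lia|].
  move=> v' [->|->]; last by rewrite eqxx.
  move=> _; have [f1 [f2 [f3 f4]]] := zexpL ((a, b) - vZ + vX);
    have bx := bonusP ((a, b) - vZ + vX).
  rewrite /= in f2 f3 f4 bx.
  have wd := wt_dichotomy ((a, b) - vZ) vX; rewrite /vXY zX wX in wd *.
  case: wd => [[wd1 wd2]|wd].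
    suff bx0 : bonus ((a, b) - vZ + vX) = 0 by rewrite /rank hw bx0 wd2 PoszD; clear bx bu; lia.
    by case: bx => [[_ bx]|[]//]; clear bu bv; lia.
  have bx2 : bonus ((a, b) - vZ + vX) <= 2 by case: bx => -[->].
  have bv0 : 0 <= bonus (a, b) by case: bv => -[->].
  by rewrite /rank hw PoszD; clear bx bu bv; lia.
have [d1 [d2 [d3 d4]]] := zexpL ((a, b) - vX); have bu := bonusP ((a, b) - vX).
rewrite /= in d2 d3 d4 bu.
have hz : zexp (a, b) = zexp ((a, b) - vX) + zexp vX by rewrite zX; lia.
have hw := wt_target hz wX; split=> //; [by left|lia|by rewrite /rank hw PoszD; lia|].
move=> v' [->|->]; first by rewrite eqxx.
move=> _; have [f1 [f2 [f3 f4]]] := zexpL ((a, b) - vX + vZ);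
  have bx := bonusP ((a, b) - vX + vZ).
rewrite /= in f2 f3 f4 bx.
have wd := wt_dichotomy ((a, b) - vX) vZ; rewrite zZ wZ in wd.
case: wd => [[wd1 wd2]|wd].
  suff bx0 : bonus ((a, b) - vX + vZ) = 0 by rewrite /rank hw bx0 wd2 PoszD; clear bx bu; lia.
  by case: bx => [[_ bx]|[]//]; clear bu bv; lia.
have bx2 : bonus ((a, b) - vX + vZ) <= 2 by case: bx => -[->].
have bv0 : 0 <= bonus (a, b) by case: bv => -[->].
by rewrite /rank hw PoszD; clear bx bu bv; lia.
Qed.

(* The analogue of [gen] for the annihilator of the image of D_y alone. *)
Definition gen2 v : option (int * int) :=
  if 1 <= zexp v then Some vZ
  else if (1 <= v.1) && (2 <= v.2) then Some vY else None.

Definition rank2 u : int := 3 * (wt u)%:Z + zexp u.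

Lemma gen2_step v vt : gen2 v = Some vt ->
  [/\ vt = vY \/ vt = vZ, wt v = (wt (v - vt)%R + n)%N, zexp (v - vt) <= zexp v,
   rank2 (v - vt) + 2 * n%:Z + 1 <= rank2 v &
   forall v', v' = vY \/ v' = vZ -> v' != vt -> rank2 (v - vt + v') + 1 <= rank2 v].
Proof.
rewrite /gen2; case: v => a b.
have [c1 [c2 [c3 c4]]] := zexpL (a, b); rewrite /= in c2 c3 c4 *.
have wY : wt vY = n := wt_vXY true; have wZ := wt_vZ.
have zY : zexp vY = 0 := zexp_vXY true; have zZ := zexp_vZ.
case: ifP => [h [<-]|h].
  have [d1 [d2 [d3 d4]]] := zexpL ((a, b) - vZ).
  rewrite /= in d2 d3 d4.
  have hz : zexp (a, b) = zexp ((a, b) - vZ) + zexp vZ by rewrite zZ; lia.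
  have hw := wt_target hz wZ; split=> //; [by right|lia|by rewrite /rank2 hw PoszD; lia|].
  move=> v' [->|->]; last by rewrite eqxx.
  move=> _; have [f1 [f2 [f3 f4]]] := zexpL ((a, b) - vZ + vY).
  rewrite /= in f2 f3 f4.
  have wd := wt_dichotomy ((a, b) - vZ) vY; rewrite zY wY in wd.
  by rewrite /rank2 hw PoszD; lia.
case: ifP => // /andP[h2 h3] [<-].
have [d1 [d2 [d3 d4]]] := zexpL ((a, b) - vY).
rewrite /= in d2 d3 d4.
have hz : zexp (a, b) = zexp ((a, b) - vY) + zexp vY by rewrite zY; lia.
have hw := wt_target hz wY; split=> //; [by left|lia|by rewrite /rank2 hw PoszD; lia|].
move=> v' [->|->]; first by rewrite eqxx.
move=> _; have [f1 [f2 [f3 f4]]] := zexpL ((a, b) - vY + vZ).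
rewrite /= in f2 f3 f4.
have wd := wt_dichotomy ((a, b) - vY) vZ; rewrite zZ wZ in wd.
by rewrite /rank2 hw PoszD; lia.
Qed.

Lemma gen_true u : exists vt, gen (u + vt) = Some (true, vt).
Proof.
case: u => a b; have [c1 [c2 [c3 c4]]] := zexpL (a, b); rewrite /= in c2 c3 c4.
have [hZ|hZ] := pselect (1 <= zexp (a, b) \/ (1 <= a /\ b = 0)).
  exists vZ; have [d1 [d2 [d3 d4]]] := zexpL ((a, b) + vZ); rewrite /= in d2 d3 d4.
  by rewrite /gen ifT //=; apply/orP; lia.
exists vY; have [d1 [d2 [d3 d4]]] := zexpL ((a, b) + vY); rewrite /= in d2 d3 d4.
have z0 : zexp ((a, b) + vY) = 0 by lia.
rewrite /gen z0 /= addr0; case: eqP => [_|ha]; first by rewrite ifT //; lia.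
by rewrite ifT //; lia.
Qed.

(** Outside the range of [gen2] the D_x equation is among those solved; within it, vanishing has to
    come from commutation with D_y. *)
Lemma gen_false u : gen2 u = None -> exists vt, gen (u + vt) = Some (false, vt).
Proof.
rewrite /gen2; case: u => a b; have [c1 [c2 [c3 c4]]] := zexpL (a, b); rewrite /= in c2 c3 c4 *.
case: ifP => // h1; case: ifP => // h2 _.
have [a0|a0] := eqVneq a 0.
  exists vZ; have [d1 [d2 [d3 d4]]] := zexpL ((a, b) + vZ); rewrite /= in d2 d3 d4.
  have z1 : zexp ((a, b) + vZ) = 1 by lia.
  by rewrite /gen z1 /= ifF ?eqxx //; lia.
exists vX; have [d1 [d2 [d3 d4]]] := zexpL ((a, b) + vX); rewrite /= in d2 d3 d4.
have z0 : zexp ((a, b) + vX) = 0 by lia.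
rewrite /gen z0 /= addr0 ifF; last by lia.
by rewrite ifF ?ifT //; lia.
Qed.

Definition basis_exp (i : nat) : int * int :=
  if (i <= n)%N then (i%:Z, 0) else ((i - n)%N%:Z, 1).

Lemma zexp_basis i : zexp (basis_exp i) = 0.
Proof. by rewrite /basis_exp; case: ifP => _; apply: zexp_unique => //=; apply: Or31. Qed.

Lemma wt_basis i : wt (basis_exp i) = i.
Proof.
apply/eqP; rewrite -eqz_nat wtE // zexp_basis /basis_exp.
by case: ifP => h /=; rewrite ?addr0 ?mulr0 ?addr0 ?mulr1 //; lia.
Qed.

Lemma gen_basis i : (i <= 2 * n)%N -> gen (basis_exp i) = None.
Proof.
move=> h; rewrite /gen zexp_basis /= /basis_exp; case: leqP => hi /=.
  by case: ifP => // _; rewrite ifF //; lia.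
by rewrite ifF ?ifF //; lia.
Qed.

Lemma basis_inj i j : basis_exp i = basis_exp j -> i = j.
Proof. by move=> /(congr1 wt); rewrite !wt_basis. Qed.

End Targets.

(** * Functionals that kill the images of D_x and D_y *)

Section Functionals.
Context {R : realType} {p : nat} {K : padicComplexType R p}.
Hypothesis p_prime : prime p.
Hypothesis p_ge3 : (2 < p)%N.
Variables (n : nat) (pi : K) (Hx Hy : int * int -> K).
Hypothesis n_gt1 : (1 < n)%N.
Hypothesis pi_gt0 : 0 < pabs pi.
Hypothesis pi_lt1 : pabs pi < 1.
Hypothesis pi_small : forall e : R, 0 < e -> exists l, pabs pi ^+ l < e.
Local Notation r := (pabs pi).
Local Notation wt := (wt n).
Implicit Types u v x z : int * int.

Local Notation vX := (vX n).
Local Notation vXY := (vXY n).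

Definition Hs (k : bool) := if k then Hy else Hx.

Hypothesis H_bound : forall k v, pabs (Hs k v) <= r ^+ (wt v + p.-1 * (wt v - n)).
Hypothesis H_support : forall k v, Hs k v != 0 ->
  exists i, v = vXY k *+ p ^ i \/ v = vZ *+ p ^ i.
Hypothesis H_main : forall k, pabs (Hs k (vXY k)) = r ^+ n.
Hypothesis H_mainZ : forall k, pabs (Hs k vZ) = r ^+ n.
Hypothesis H_symm : forall v, v.1%:~R * Hy v = v.2%:~R * Hx v.

Definition coord (k : bool) u : int := if k then u.2 else u.1.

(* The matrix of the differential operator: the coefficient at [x] of the image
   of the monomial of exponent [u]. *)
Definition row (k : bool) u x : K := (coord k u)%:~R * (x == u)%:R + Hs k (x - u).

Let n_gt0 : (0 < n)%N := ltnW n_gt1.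
Let r_ge0 m : 0 <= r ^+ m. Proof. by rewrite exprn_ge0 // ltW. Qed.
Let rV_ge0 m : 0 <= (r ^+ m)^-1. Proof. by rewrite invr_ge0. Qed.

(* Half powers of [r] are needed: a strict drop of [rank] gains only one factor
   [sqrt r], while the weight [wt] is measured in powers of [r]. *)
Let s : R := Num.sqrt r.
Let s_gt0 : 0 < s. Proof. by rewrite sqrtr_gt0. Qed.
Let s_le1 : s <= 1. Proof. by rewrite -sqrtr1 ler_sqrt ?ltW. Qed.
Let s_lt1 : s < 1. Proof. by rewrite -sqrtr1 ltr_sqrt. Qed.
Let s_neq0 : s != 0. Proof. by rewrite gt_eqF. Qed.

Definition pw (z : int) : R := s ^ z.

Lemma pwD a b : pw (a + b) = pw a * pw b. Proof. exact: expfzDr. Qed.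
Lemma pw_gt0 a : 0 < pw a. Proof. exact: exprz_gt0. Qed.
Lemma pw_ge0 a : 0 <= pw a. Proof. exact: ltW (pw_gt0 a). Qed.
Lemma pw0 : pw 0 = 1. Proof. exact: expr0z. Qed.
Lemma pw_mono a b : a <= b -> pw b <= pw a.
Proof.
move=> ab; have -> : b = a + `|b - a|%N%:Z by lia.
rewrite pwD ler_piMr ?pw_ge0 // /pw -exprnP exprn_ile1 // ltW //.
Qed.
Lemma pw_nat k : r ^+ k = pw (2 * k%:Z).
Proof. by rewrite /pw -PoszM -exprnP exprM sqr_sqrtr // ltW. Qed.

Lemma H0 k : Hs k 0 = 0.
Proof.
apply/eqP; apply: contraT => /H_support [i hi].
have : wt (0 : int * int) = (n * p ^ i)%N.
  by case: hi => ->; rewrite wtMn // ?wt_vXY ?wt_vZ.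
have -> : wt (0 : int * int) = 0%N by apply/eqP;
  rewrite -(mulr0n (0 : int * int)) wtMn // muln0.
by move/esym/eqP; rewrite muln_eq0 expn_eq0 (gtn_eqF n_gt0) (gtn_eqF (prime_gt0 p_prime)).
Qed.

(* The general estimate: in the equation attached to the exponent [u], the entry
   at the target [u + vt] dominates all the others for the weights [pw (f x)]. *)
Lemma row_dominated k u vt (f : int * int -> int) (d : int) :
  (vt = vXY k \/ vt = vZ) ->
  f u - 2 * n%:Z >= d + f (u + vt) ->
  (forall v, v = vXY k \/ v = vZ -> v != vt -> f (u + v) >= d + f (u + vt)) ->
  (forall v i, (0 < i)%N -> v = vXY k *+ p ^ i \/ v = vZ *+ p ^ i ->
    f (u + v) + 2 * (wt v)%:Z + 2 * (p.-1%:Z * ((wt v)%:Z - n%:Z)) - 2 * n%:Z >= d + f (u + vt)) ->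
  forall x, pabs (row k u x / Hs k vt - (x == u + vt)%:R) * pw (f x) <= pw d * pw (f (u + vt)).
Proof.
move=> hvt h0 h1 h2 x; rewrite -pwD.
have Hn : pabs (Hs k vt) = r ^+ n by case: hvt => ->.
have Hpos : 0 < pabs (Hs k vt) by rewrite Hn exprn_gt0.
have Hne : Hs k vt != 0 by rewrite -(pabs_gt0 p_prime).
have vt0 : vt != 0 by apply/eqP => e; move: Hne; rewrite e H0 eqxx.
have key (y : K) (a : int) x' : pabs y <= pw a -> a - 2 * n%:Z + f x' >= d + f (u + vt) ->
    pabs (y / Hs k vt) * pw (f x') <= pw (d + f (u + vt)).
  move=> hy ha; apply: le_trans (pw_mono ha); rewrite pwD ler_wpM2r ?pw_ge0 //.
  rewrite pabs_div // Hn ler_pdivrMr ?exprn_gt0 // pw_nat -pwD subrK //.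
have [xe|xu] := eqVneq x (u + vt).
  have e1 : u + vt - u = vt by rewrite addrC addKr.
  have e2 : (u + vt == u) = false by rewrite -subr_eq0 e1; exact: negbTE.
  rewrite /row xe e1 e2.
  by rewrite mulr0 add0r divff // subrr pabs0 // mul0r pw_ge0.
rewrite subr0 /row; have [->|xu'] := eqVneq x u.
  rewrite mulr1 subrr H0 addr0; apply: (key _ 0 u); first by rewrite pw0 pabs_int_le1.
  by rewrite sub0r [- _ + _]addrC.
rewrite mulr0 add0r; have [->|Hv] := eqVneq (Hs k (x - u)) 0.
  by rewrite mul0r pabs0 // mul0r pw_ge0.
have xE : x = u + (x - u) by rewrite addrC subrK.
have [[|i] hi] := H_support Hv.
  have hv : x - u = vXY k \/ x - u = vZ by case: hi; rewrite expn0 mulr1n; [left|right].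
  apply: (key _ (2 * n%:Z)); last first.
    rewrite subrr add0r xE; apply: h1 => //; apply: contra xu => /eqP <-.
    by rewrite addrC subrK.
  by rewrite -pw_nat; case: hv => ->; rewrite ?H_main ?H_mainZ.
have wv : wt (x - u) = (n * p ^ i.+1)%N by case: hi => ->; rewrite wtMn // ?wt_vXY ?wt_vZ.
have wn : (n <= wt (x - u)%R)%N by rewrite wv leq_pmulr // expn_gt0 prime_gt0.
pose m := (wt (x - u)%R + p.-1 * (wt (x - u)%R - n))%N.
apply: (key (Hs k (x - u)) (2 * m%:Z) x).
  by rewrite -pw_nat; exact: H_bound.
rewrite /m; apply: le_trans (h2 (x - u) i.+1 (ltn0Sn i) hi) _.
rewrite -xE PoszD PoszM -subzn //.
by move: (f x) (_ * _ : int) (Posz _) (Posz _) => A B C D; clear; lia.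
Qed.

(** Decay of a row away from its diagonal once weights are normalised. The truncated subtraction
    caps it at 1. *)
Definition phi v : R := r ^+ (wt v - n).

Lemma phi_itv v : 0 <= phi v <= 1.
Proof. by rewrite exprn_ge0 ?exprn_ile1 // ltW. Qed.

Lemma phi_null u (e : R) : 0 < e ->
  exists A : {fset int * int}, forall x, x \notin A -> phi (x - u) <= e.
Proof.
move=> e0; have [l hl] := pi_small e0; have [A hA] := @wt_finite n n_gt0 (l + n)%N.
exists [fset (x + u)%R | x in A]%fset => x hx; apply: le_trans (ltW hl).
apply: ler_wiXn2l; rewrite ?(ltW pi_gt0) ?(ltW pi_lt1) //.
have /hA h : x - u \notin A.
  by apply: contra hx => h; apply/imfsetP; exists (x - u) => //=; rewrite subrK.
by apply: leq_trans (leq_sub2r n (ltnW h)); rewrite addnK.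
Qed.

Lemma row_le k u x : pabs (row k u x) / r ^+ wt x <= phi (x - u) / r ^+ wt u.
Proof.
have rp m : 0 < r ^+ m by rewrite exprn_gt0.
rewrite /row; have [->|xu] := eqVneq x u.
  rewrite mulr1 subrr H0 addr0 ler_wpM2r //.
  have -> : phi 0 = 1.
    rewrite /phi (_ : wt 0 = 0%N) ?sub0n //.
    by rewrite -(mulr0n (0 : int * int)) wtMn // muln0.
  exact: pabs_int_le1.
rewrite mulr0 add0r ler_pdivrMr // mulrAC ler_pdivlMr //.
have w1 : (wt x <= wt u + wt (x - u)%R)%N by rewrite -{1}(subrK u x) addrC wtD_le.
apply: (@le_trans _ _ (r ^+ (wt (x - u) + p.-1 * (wt (x - u) - n)) * r ^+ wt u)).
  by rewrite ler_wpM2r.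
rewrite /phi -!exprD; apply: ler_wiXn2l; rewrite ?(ltW pi_gt0) ?(ltW pi_lt1) //.
have := p_ge3; case: (p) => [|[|[|q]]] //= _.
have := leq_pmull (wt (x - u) - n) (ltn0Sn q.+1); lia.
Qed.

(** The growth for which a functional pairs with C_0, where coefficients are small compared with
    r^wt. *)
Definition tempered (l : int * int -> K) := forall x, pabs (l x) <= (r ^+ wt x)^-1.

Lemma row_tempered_le l k u x : tempered l ->
  pabs (row k u x * l x) <= (r ^+ wt u)^-1 * phi (x - u).
Proof.
move=> hl; rewrite pabsM [X in _ <= X]mulrC; apply: le_trans (row_le k u x).
by rewrite ler_wpM2l ?pabs_ge0.
Qed.

Lemma row_null l k u : tempered l -> null_family (fun x => row k u x * l x).
Proof.
move=> hl e e0; have rp : 0 < r ^+ wt u by rewrite exprn_gt0.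
have [A hA] := phi_null u (mulr_gt0 e0 rp); exists A => x /hA h.
apply: le_trans (row_tempered_le k u x hl) _.
by rewrite mulrC ler_pdivrMr.
Qed.

Definition apply_row (l : int * int -> K) k u := usum (fun x => row k u x * l x).

Lemma apply_row_psum l k u : tempered l ->
  psum (fun x => row k u x * l x) (apply_row l k u).
Proof. by move=> hl; apply: null_psum => //; exact: row_null. Qed.

Lemma apply_row_tempered l k : tempered l -> tempered (apply_row l k).
Proof.
move=> hl u; apply: (psum_le p_prime _ (apply_row_psum k u hl)).
  exact: rV_ge0.
move=> x; apply: le_trans (row_tempered_le k u x hl) _.
by rewrite ler_piMr //; case/andP: (phi_itv (x - u)).
Qed.

Lemma row_row_le k k' u x z :
  pabs (row k u x * row k' x z) <= r ^+ wt z / r ^+ wt u * (phi (x - u) * phi (z - x)).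
Proof.
have rp m : 0 < r ^+ m by rewrite exprn_gt0.
have h1 := row_le k u x; have h2 := row_le k' x z.
rewrite ler_pdivrMr // in h1; rewrite ler_pdivrMr // in h2.
rewrite pabsM; apply: le_trans (ler_pM (pabs_ge0 _) (pabs_ge0 _) h1 h2) _.
have rx : r ^+ wt x != 0 by rewrite gt_eqF.
rewrite le_eqVlt; apply/orP; left; apply/eqP.
transitivity (phi (x - u) * phi (z - x) * (r ^+ wt z / r ^+ wt u) * (r ^+ wt x / r ^+ wt x));
  first by ring.
by rewrite divff // mulr1 mulrC.
Qed.

Lemma row_row_psum k k' u z : exists s, psum (fun x => row k u x * row k' x z) s.
Proof.
exists (usum (fun x => row k u x * row k' x z)); apply: null_psum => // e e0.
have rp m : 0 < r ^+ m by rewrite exprn_gt0.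
have c0 : 0 < e / (r ^+ wt z / r ^+ wt u) by rewrite !divr_gt0.
have [A hA] := phi_null u c0; exists A => x /hA h.
apply: le_trans (row_row_le k k' u x z) _; rewrite mulrC -ler_pdivlMr ?divr_gt0 //.
apply: le_trans h; rewrite ler_piMr //; first by case/andP: (phi_itv (x - u)).
by case/andP: (phi_itv (z - x)).
Qed.

(** The substitution x -> u + z - x matches the products of two H coefficients. The difference of
    the two sums lives at x = u and x = z, and vanishes by [H_symm]. *)
Lemma row_comm u z t : psum (fun x => row true u x * row false x z) t ->
  psum (fun x => row false u x * row true x z) t.
Proof.
have [t' ht'] := row_row_psum false true u z => ht.
suff <- : t' = t by [].
have re := @psum_reindex _ _ _ _ _ (fun x => u + z - x) (fun x => u + z - x) _ _
   (subKr (u + z)) (subKr (u + z)) ht'.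
have hd := psumB p_prime ht re.
pose Df x : K := row true u x * row false x z - row false u (u + z - x) * row true (u + z - x) z.
have DfE x : Df x = (x == u)%:R * ((x == z)%:R * (u.2%:~R * z.1%:~R - u.1%:~R * z.2%:~R))
    + (x == u)%:R * (Hx (z - x) * (u.2%:~R - z.2%:~R))
    + (x == z)%:R * (Hy (x - u) * (z.1%:~R - u.1%:~R)).
  rewrite /Df /row /coord /Hs /=.
  have -> : (z == x) = (x == z) by rewrite eq_sym.
  have -> : (u + z - x == u) = (x == z)
    by rewrite -[X in _ == X]addr0 -addrA (inj_eq (addrI u)) subr_eq0 eq_sym.
  have -> : (z == u + z - x) = (x == u)
    by rewrite eq_sym [u + z]addrC -[X in _ == X]addr0 -addrA (inj_eq (addrI z)) subr_eq0 eq_sym.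
  have -> : u + z - x - u = z - x by rewrite addrAC [u + z]addrC addrK.
  have -> : z - (u + z - x) = x - u by rewrite opprB [u + z]addrC opprD addrCA addNKr.
  have e1 : x.1%:~R * (x == z)%:R = z.1%:~R * (x == z)%:R :> K by case: eqP => [->|];
    rewrite ?mulr0.
  have e2 : (u.2 + z.2 - x.2)%:~R * (x == u)%:R = z.2%:~R * (x == u)%:R :> K.
    by case: eqP => [->|]; rewrite ?mulr0 // [u.2 + _]addrC addrK.
  rewrite e1 e2; ring.
have D0 : psum Df 0.
  have f1 := @psum_single _ _ _ p_prime _ (fun x => (x == u)%:R * ((x == z)%:R *
    (u.2%:~R * z.1%:~R - u.1%:~R * z.2%:~R)) : K) u.
  have f2 := @psum_single _ _ _ p_prime _ (fun x => (x == u)%:R *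
    (Hx (z - x) * (u.2%:~R - z.2%:~R)) : K) u.
  have f3 := @psum_single _ _ _ p_prime _ (fun x => (x == z)%:R *
    (Hy (x - u) * (z.1%:~R - u.1%:~R)) : K) z.
  have := psumD (psumD (f1 _) (f2 _)) (f3 _); rewrite !eqxx !mul1r.
  have -> : (u == z)%:R * (u.2%:~R * z.1%:~R - u.1%:~R * z.2%:~R) = 0 :> K.
    by case: eqP => [->|_]; rewrite ?mul0r // mul1r [X in X - _]mulrC subrr.
  have hs : Hx (z - u) * (u.2%:~R - z.2%:~R) + Hy (z - u) * (z.1%:~R - u.1%:~R) = 0.
    have := H_symm (z - u); rewrite /= !intrB => h.
    transitivity ((z.1%:~R - u.1%:~R) * Hy (z - u) - (z.2%:~R - u.2%:~R) * Hx (z - u));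
      first by ring.
    by rewrite h subrr.
  rewrite add0r hs => hh;
    apply: psum_eq (hh _ _ _) => [x|x /negbTE ->|x /negbTE ->|x /negbTE ->].
  - by rewrite DfE.
  - by rewrite mul0r.
  - by rewrite mul0r.
  by rewrite mul0r.
have := psum_unique p_prime hd D0; move/eqP; rewrite subr_eq0 => /eqP //.
Qed.

Lemma psum_fubini2 (f : int * int -> int * int -> K) g h :
  null_family (fun w => f w.1 w.2) ->
  (forall x, psum (f x) (g x)) -> (forall z, psum (f^~ z) (h z)) ->
  exists t, psum g t /\ psum h t.
Proof.
move=> /(null_psum p_prime) hf hg hh; exists (usum (fun w => f w.1 w.2)); split.
  exact: psum_fubini hf hg.
have hf' : psum (fun w : (int * int) * (int * int) => f w.2 w.1) (usum (fun w => f w.1 w.2)).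
  apply: (@psum_reindex _ _ _ _ _ (fun w : (int * int) * (int * int) => (w.2, w.1))
    (fun w => (w.2, w.1)) (fun w => f w.1 w.2)) hf => // ; by case.
exact: (psum_fubini p_prime (f := fun z x => f x z) hf' hh).
Qed.

Lemma row_row_null l k k' u : tempered l ->
  null_family (fun w => row k u w.1 * row k' w.1 w.2 * l w.2).
Proof.
move=> hl.
apply: (@null_conv _ _ _ _ (fun x => phi (x - u)) phi
   (fun x z => row k u x * row k' x z * l z) ((r ^+ wt u)^-1)).
- exact: rV_ge0.
- by move=> x; exact: phi_itv.
- exact: phi_itv.
- exact: phi_null.
- move=> e e0; have [A hA] := phi_null 0 e0; exists A => x /hA; by rewrite subr0.
move=> x z; rewrite pabsM.
apply: le_trans (ler_pM (pabs_ge0 _) (pabs_ge0 _) (row_row_le k k' u x z) (hl z)) _.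
have rz : r ^+ wt z != 0 by rewrite gt_eqF // exprn_gt0.
rewrite le_eqVlt; apply/orP; left; apply/eqP.
transitivity ((r ^+ wt u)^-1 * (phi (x - u) * phi (z - x)) * (r ^+ wt z / r ^+ wt z));
  first by ring.
by rewrite divff // mulr1.
Qed.

(** Applied to the monomial of exponent u, the sum is l(D_x D_y) = l(D_y D_x) = 0. The work lies in
    exchanging the order of the double sums. *)
Lemma annihilator_comm l : tempered l ->
  (forall u, psum (fun x => row true u x * l x) 0) ->
  forall u, psum (fun x => row true u x * apply_row l false x) 0.
Proof.
move=> hl hk u.
have /choice [t ht] : forall z, exists s, psum (fun x => row true u x * row false x z) s.
  by move=> z; exact: row_row_psum.
pose h z := t z * l z.
have hh (k k' : bool) : (forall z, psum (fun x => row k u x * row k' x z) (t z)) ->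
    forall z, psum (fun x => row k u x * row k' x z * l z) (h z).
  move=> hz z; rewrite /h mulrC; apply: psum_eq (psumZ p_prime (l z) (hz z)) => x.
  by rewrite mulrC.
have hg (k k' : bool) x y : psum (fun z => row k' x z * l z) y ->
    psum (fun z => row k u x * row k' x z * l z) (row k u x * y).
  by move=> /(psumZ p_prime (row k u x)); apply: psum_eq => z; rewrite mulrA.
have [T [hT1 hT2]] := psum_fubini2 (row_row_null true false u hl)
  (fun x => hg true false x _ (apply_row_psum false x hl)) (hh true false ht).
have [T' [hT1' hT2']] := psum_fubini2 (row_row_null false true u hl)
  (fun x => hg false true x _ (hk x)) (hh false true (fun z => row_comm (ht z))).
have T0 : T' = 0.
  by apply: (psum_unique p_prime hT1'); apply: psum_zero => // x; rewrite mulr0.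
by rewrite -[X in psum _ X]T0 -(psum_unique p_prime hT2 hT2').
Qed.

(* The gain of the j-th dual functional over the trivial bound at weight [w]; the
   factor [p.-1] produces the entry bound [r ^+ (p.-1 * j)], and the extra 1 makes
   it strict below weight [j]. *)
Definition Nb (j w : nat) : nat := (p.-1 * (j - w) + (w < j)%N)%N.

Lemma Nb_mono j w w' : (w <= w')%N -> (Nb j w' <= Nb j w)%N.
Proof.
move=> h; rewrite /Nb; apply: leq_add; first by rewrite leq_mul2l leq_sub2l ?orbT.
by case: ltnP => // h1; rewrite (leq_ltn_trans h h1).
Qed.

Lemma Nb_le j w : (j <= 2 * n)%N -> (n <= w)%N -> (Nb j w <= p.-1 * (2 * n))%N.
Proof.
move=> hj hw; rewrite /Nb.
have h1 : (j - w <= n)%N by lia.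
have h2 : (p.-1 * (j - w) <= p.-1 * n)%N by rewrite leq_mul2l h1 orbT.
have h3 : (1 <= p.-1 * n)%N by rewrite muln_gt0 n_gt0 andbT -subn1 subn_gt0; exact: ltnW p_ge3.
by apply: leq_trans (leq_add h2 (leq_b1 _)) _; lia.
Qed.

Definition bd j u : int := 2 * ((Nb j (wt u))%:Z - (wt u)%:Z).

(** The exponents contributed by the terms i > 0 of the multiplier series; p >= 3 gives the first
    bound and n >= 2 the second. *)
Lemma far_wt k v i : (0 < i)%N -> v = vXY k *+ p ^ i \/ v = vZ *+ p ^ i ->
  (3 * n <= wt v)%N /\ 2 * zexp v <= (wt v)%:Z.
Proof.
move=> i0 hv.
have wv : wt v = (n * p ^ i)%N by case: hv => ->; rewrite wtMn // ?wt_vXY ?wt_vZ.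
have pi3 : (3 <= p ^ i)%N.
  by apply: leq_trans p_ge3 _; case: i i0 {hv wv} => // i _;
    rewrite expnS leq_pmulr // expn_gt0 prime_gt0.
split; first by rewrite wv mulnC leq_mul2l pi3 orbT.
have zv : zexp v <= (p ^ i)%N%:Z.
  by case: hv => ->; rewrite zexpMn ?zexp_vXY ?zexp_vZ // ?mul0r ?mul1r.
have h2 : (2 * p ^ i <= wt v)%N by rewrite wv leq_mul2r n_gt1 orbT.
by move: zv h2; move: (p ^ i)%N (zexp v) (wt v) => a b c; clear; lia.
Qed.

(** Near entries lose nothing, since [Nb] decreases with the weight. A far entry may lose all of
    [Nb], at most 2n(p-1), but carries the extra factor r^((p-1)(wt v - n)) with wt v >= 3n. *)
Lemma bd_dominated k u vt j : (j <= 2 * n)%N -> (vt = vXY k \/ vt = vZ) ->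
  wt (u + vt) = (wt u + n)%N ->
  forall x, pabs (row k u x / Hs k vt - (x == u + vt)%:R) * pw (bd j x) <= pw (bd j (u + vt)).
Proof.
move=> hj hvt hw x; rewrite -[X in _ <= X]mul1r -pw0.
apply: row_dominated => //; rewrite ?add0r.
- rewrite /bd hw; have := @Nb_mono j (wt u) (wt u + n) (leq_addr _ _).
  by move: (Nb j (wt u + n)%N) (Nb j (wt u)) (wt u); clear; lia.
- move=> v hv _; rewrite /bd hw.
  have h1 : (wt (u + v)%R <= wt u + n)%N.
    apply: leq_trans (wtD_le n_gt0 u v) _; case: hv => ->; by rewrite ?wt_vXY ?wt_vZ.
  have := @Nb_mono j _ _ h1.
  by move: (Nb j (wt u + n)%N) (Nb j (wt (u + v))) (wt u) (wt (u + v)) h1; clear; lia.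
move=> v i i0 hv; rewrite /bd hw.
have [w3 _] := far_wt i0 hv.
have h1 := wtD_le n_gt0 u v.
have h2 := @Nb_le j (wt u + n) hj (leq_addl _ _).
have h3 : p.-1%:Z * (2 * n%:Z) <= p.-1%:Z * ((wt v)%:Z - n%:Z).
  by apply: ler_wpM2l => //; move: w3; clear; lia.
have h4 : 0 <= (Nb j (wt (u + v)))%:Z by [].
have h5 : (Nb j (wt u + n))%:Z <= p.-1%:Z * (2 * n%:Z) by rewrite -!PoszM lez_nat.
move: h1 h3 h4 h5; move: (Nb j (wt (u + v)))%:Z (Nb j (wt u + n)%N)%:Z => A B.
move: (p.-1%:Z * ((wt v)%:Z - n%:Z)) (p.-1%:Z * (2 * n%:Z)) (wt u) (wt v) (wt (u + v)).
by clear; lia.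
Qed.

(** One unit of rank is one factor s, the square root of r. For far entries (p-1)(wt v - n) >= 2(wt
    v - n) outweighs the growth of the rank, which is 3 wt + zexp up to 2. *)
Lemma rank_dominated k u vt (f : int * int -> int) :
  (vt = vXY k \/ vt = vZ) -> wt (u + vt) = (wt u + n)%N -> zexp u <= zexp (u + vt) ->
  f u + 2 * n%:Z + 1 <= f (u + vt) ->
  (forall v, v = vXY k \/ v = vZ -> v != vt -> f (u + v) + 1 <= f (u + vt)) ->
  (forall v, 0 <= f v - 3 * (wt v)%:Z - zexp v <= 2) ->
  forall x, pabs (row k u x / Hs k vt - (x == u + vt)%:R) * pw (- f x) <= s * pw (- f (u + vt)).
Proof.
move=> hvt hw hz h0 h1 hf x; have -> : s = pw 1 by rewrite /pw expr1z.
apply: (@row_dominated k u vt (fun x => - f x)) => //.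
- by move: h0; move: (f u) (f (u + vt)); clear; lia.
- move=> v hv vvt; have := h1 v hv vvt; move: (f (u + v)) (f (u + vt)); clear; lia.
move=> v i i0 hv; have [w3 z2] := far_wt i0 hv.
have d1 := wtD_le n_gt0 u v; have d2 := zexpD u v.
have /andP[a1 a2] := hf (u + v); have /andP[a3 a4] := hf (u + vt).
have h3 : 2 * ((wt v)%:Z - n%:Z) <= p.-1%:Z * ((wt v)%:Z - n%:Z).
  by apply: ler_wpM2r; move: w3 p_ge3; clear; lia.
move: d1 d2 a1 a2 a3 a4 h3 w3 z2 hz; rewrite hw PoszD.
move: (p.-1%:Z * _) (f (u + v)) (f (u + vt)) (wt (u + v)) (zexp (u + v)) (zexp (u + vt)).
move: (wt u) (wt v) (zexp u) (zexp v) n_gt1; clear; lia.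
Qed.

(** The equation at v - vt, divided by its leading coefficient and with the unknown at v moved to
    the other side. The zero rows at basis exponents let the values there be prescribed. *)
Definition matrix1 v x : K := if gen n v is Some (k, vt) then
  row k (v - vt) x / Hs k vt - (x == v)%:R else 0.

Definition matrix2 v x : K := if gen2 v is Some vt then
  row true (v - vt) x / Hs true vt - (x == v)%:R else 0.

Lemma Hs_vt_neq0 k vt : vt = vXY k \/ vt = vZ -> Hs k vt != 0.
Proof.
by move=> h; rewrite -(pabs_gt0 p_prime); case: h => ->; rewrite ?H_main ?H_mainZ exprn_gt0.
Qed.

Lemma row_fixed k v vt l : tempered l -> vt = vXY k \/ vt = vZ ->
  l v = - usum (fun x => (row k (v - vt) x / Hs k vt - (x == v)%:R) * l x) <->
  psum (fun x => row k (v - vt) x * l x) 0.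
Proof.
move=> hl hvt; have Hn := Hs_vt_neq0 hvt.
have h1 := psumZ p_prime (Hs k vt)^-1 (apply_row_psum k (v - vt) hl).
have h2 : psum (fun x => (x == v)%:R * l x) (l v).
  have := @psum_single _ _ _ p_prime _ (fun x => (x == v)%:R * l x) v.
  by rewrite eqxx mul1r; apply => i /negbTE ->; rewrite mul0r.
have h3 := psumB p_prime h1 h2.
have -> : usum (fun x => (row k (v - vt) x / Hs k vt - (x == v)%:R) * l x)
    = (Hs k vt)^-1 * apply_row l k (v - vt) - l v.
  by apply: (psum_usumE p_prime); apply: psum_eq h3 => x; ring.
split=> [/eqP|h].
  rewrite -subr_eq0 opprK addrCA subrr addr0 mulf_eq0 invr_eq0 (negbTE Hn) /= => /eqP h.
  by rewrite -h; exact: apply_row_psum.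
by rewrite (psum_unique p_prime (apply_row_psum k (v - vt) hl) h) mulr0 sub0r opprK.
Qed.

Lemma pw_wt u : pw (- (2 * (wt u)%:Z)) = (r ^+ wt u)^-1.
Proof. by rewrite pw_nat /pw invr_expz. Qed.

Lemma bd_le j u : pw (bd j u) <= (r ^+ wt u)^-1.
Proof.
by rewrite -pw_wt; apply: pw_mono; rewrite /bd; move: (Nb j (wt u)) (wt u); clear; lia.
Qed.

Lemma tempered_bd j l : (forall x, pabs (l x) <= pw (bd j x)) -> tempered l.
Proof. by move=> h x; exact: le_trans (h x) (bd_le j x). Qed.

Lemma rank_range v : 0 <= rank n v - 3 * (wt v)%:Z - zexp v <= 2.
Proof.
by rewrite /rank; case: (bonusP n v) => -[-> _]; move: (wt v) (zexp v); clear; lia.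
Qed.

Lemma entry_null k u vt v (B : int * int -> R) (e : R) : vt = vXY k \/ vt = vZ ->
  (forall x, B x <= (r ^+ wt x)^-1) -> 0 < e ->
  exists A : {fset int * int}, forall x, x \notin A ->
    pabs (row k u x / Hs k vt - (x == v)%:R) * B x <= e.
Proof.
move=> hvt hB e0; have Hn := Hs_vt_neq0 hvt.
have Hp : 0 < pabs (Hs k vt) by rewrite pabs_gt0.
have rp m : 0 < r ^+ m by rewrite exprn_gt0.
have [A hA] := phi_null u (mulr_gt0 (mulr_gt0 e0 Hp) (rp (wt u))).
exists (v |` A)%fset => x; rewrite in_fset1U negb_or => /andP[/negbTE -> /hA h].
rewrite subr0 pabs_div //.
apply: (@le_trans _ _ (pabs (row k u x) / pabs (Hs k vt) * (r ^+ wt x)^-1)).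
  by rewrite ler_wpM2l ?divr_ge0 ?pabs_ge0.
rewrite mulrAC ler_pdivrMr //; apply: le_trans (row_le k u x) _.
by rewrite ler_pdivrMr.
Qed.

Lemma dual_functional j : (j <= 2 * n)%N -> exists l : int * int -> K,
  [/\ forall x, pabs (l x) <= r ^+ Nb j (wt x) / r ^+ wt x,
      forall i, (i <= 2 * n)%N -> l (basis_exp n i) = (i == j)%:R / pi ^+ j &
      forall k u, psum (fun x => row k u x * l x) 0].
Proof.
move=> hj; pose d v : K := (v == basis_exp n j)%:R / pi ^+ j.
have s01 : 0 <= s < 1 by rewrite ltW.
have [||||||l [lB lT]] := @contraction_exists _ _ K p_prime _ matrix1 (fun x => pw (bd j x))
    (fun x => pw (- rank n x)) s _ _ s01 _ _ d.
- by move=> v; exact: pw_ge0.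
- move=> v; apply: pw_mono; have := rank_range v; rewrite /bd.
  have [z0 _ _ _] := zexpP v.
  by move: z0; move: (Nb j (wt v)) (wt v) (zexp v) (rank n v); clear; lia.
- move=> v e e0; rewrite /matrix1; case E: (gen n v) => [[k vt]|].
    have [hvt _ _ _ _] := gen_step n_gt1 E.
    by apply: entry_null => // x; exact: bd_le.
  by exists fset0 => x _; rewrite pabs0 // mul0r ltW.
- move=> v x; rewrite /matrix1; case E: (gen n v) => [[k vt]|]; last first.
    by rewrite pabs0 // mul0r mulr_ge0 ?pw_ge0 // ltW.
  have [hvt hw hz hr1 hr2] := gen_step n_gt1 E.
  have := @rank_dominated k (v - vt) vt (rank n) hvt; rewrite subrK; apply => //.
  exact: rank_range.
(* At the j-th basis exponent [Nb] is 0, so the admissible size r^-j is exactly that of the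
   prescribed value. *)
- move=> v; rewrite /d; case: eqP => [->|_]; last by rewrite mul0r pabs0 // pw_ge0.
  rewrite mul1r pabsV // pabsX /bd wt_basis // /Nb subnn muln0 ltnn add0n sub0r.
  by rewrite mulrN pw_nat /pw invr_expz.
- move=> v x; rewrite /matrix1; case E: (gen n v) => [[k vt]|]; last first.
    by rewrite pabs0 // mul0r pw_ge0.
  have [hvt hw _ _ _] := gen_step n_gt1 E.
  by have := @bd_dominated k (v - vt) vt j hj hvt; rewrite subrK; apply.
have lt := tempered_bd lB.
have hgen k u vt : gen n (u + vt) = Some (k, vt) -> psum (fun x => row k u x * l x) 0.
  move=> E; have [hvt _ _ _ _] := gen_step n_gt1 E.
  have := row_fixed (u + vt) lt hvt; rewrite addrK => -[h _]; apply: h.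
  have d0 : d (u + vt) = 0.
    rewrite /d; case: eqP => [e|_]; last by rewrite mul0r.
    by move: E; rewrite e gen_basis.
  by rewrite lT d0 sub0r /matrix1 E addrK.
have ktrue u : psum (fun x => row true u x * l x) 0.
  by have [vt /hgen] := gen_true n_gt1 u.
pose E := apply_row l false.
(* As D_x and D_y commute, [E] is annihilated by D_y; and [E] vanishes where
   [gen] uses D_x, so it is the fixed point 0 of a contraction. *)
have Et : tempered E by exact: apply_row_tempered.
have E0 : forall v, E v = 0.
  apply: (@contraction_unique _ _ K p_prime _ matrix2 (fun x => (r ^+ wt x)^-1)
    (fun x => pw (- rank2 n x)) s) => //.
  - move=> v; rewrite -pw_wt; apply: pw_mono; rewrite /rank2; have [z0 _ _ _] := zexpP v.
    by move: z0; move: (wt v) (zexp v); clear; lia.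
  - move=> v e e0; rewrite /matrix2; case G: (gen2 v) => [vt|].
      have [hvt _ _ _ _] := gen2_step n_gt1 G.
      by apply: entry_null.
    by exists fset0 => x _; rewrite pabs0 // mul0r ltW.
  - move=> v x; rewrite /matrix2; case G: (gen2 v) => [vt|]; last first.
      by rewrite pabs0 // mul0r mulr_ge0 ?pw_ge0 // ltW.
    have [hvt hw hz hr1 hr2] := gen2_step n_gt1 G.
    have := @rank_dominated true (v - vt) vt (rank2 n) hvt; rewrite subrK; apply => //.
    by move=> y; rewrite /rank2; move: (wt y) (zexp y); clear; lia.
  move=> v; rewrite /matrix2; case G: (gen2 v) => [vt|].
    have [hvt _ _ _ _] := gen2_step n_gt1 G.
    apply/(@row_fixed true) => //; exact: annihilator_comm.
  have [vt /hgen h] := gen_false n_gt1 G.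
  rewrite /E /apply_row (psum_usumE p_prime h).
  have -> : usum (fun x => 0 * usum (fun x0 => row false x x0 * l x0)) = 0.
    by apply: psum_usumE => //; apply: psum_zero => // x; rewrite mul0r.
  by rewrite oppr0.
exists l; split.
- move=> x; apply: le_trans (lB x) _.
  by rewrite !pw_nat /bd mulrBr pwD /pw invr_expz.
- move=> i hi; rewrite lT /d; have -> : (basis_exp n i == basis_exp n j) = (i == j).
    by apply/eqP/eqP => [/(basis_inj n_gt1)|->].
  have -> : usum (fun x => matrix1 (basis_exp n i) x * l x) = 0.
    apply: psum_usumE => //; apply: psum_zero => // x.
    by rewrite /matrix1 gen_basis // mul0r.
  by rewrite subr0.
case=> u; first exact: ktrue.
by rewrite -[X in psum _ X](E0 u); exact: apply_row_psum.
Qed.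

Definition decaying (g : int * int -> K) := exists a : int * int -> R,
  [/\ forall u, 0 <= a u <= 1, forall u, pabs (g u) <= a u * r ^+ wt u &
    forall e, 0 < e -> exists A : {fset int * int}, forall u, u \notin A -> a u <= e].

Lemma row_col_psum k g x : decaying g ->
  psum (fun u => row k u x * g u) ((coord k x)%:~R * g x + lmul (Hs k) g x).
Proof.
move=> [a [a01 ga _]].
have h1 : null_family (fun u => Hs k (x - u) * g u).
  move=> e e0; have rp m : 0 < r ^+ m by rewrite exprn_gt0.
  have [A hA] := phi_null (- x) (divr_gt0 e0 (rp (wt x))).
  exists [fset (- u)%R | u in A]%fset => u hu.
  have /hA h : - u \notin A.
    by apply: contra hu => h; apply/imfsetP; exists (- u) => //=; rewrite opprK.
  have {}h : phi (x - u) <= e / r ^+ wt x by move: h; rewrite opprK addrC.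
  have [xu|xu] := eqVneq x u.
    by rewrite xu subrr H0 mul0r pabs0 // ltW.
  have hr := row_le k u x; rewrite /row (negbTE xu) mulr0 add0r in hr.
  have /andP[a0 a1] := a01 u.
  rewrite pabsM; apply: le_trans (ler_wpM2l (pabs_ge0 _) (ga u)) _.
  apply: (@le_trans _ _ (pabs (Hs k (x - u)) * r ^+ wt u)).
    by rewrite mulrCA ler_piMl // mulr_ge0 ?pabs_ge0.
  rewrite ler_pdivlMr // in h; apply: le_trans h.
  by rewrite ler_pdivrMr // mulrAC ler_pdivlMr // in hr.
have h2 := null_psum p_prime h1.
have h3 : lmul (Hs k) g x = usum (fun u => Hs k (x - u) * g u).
  apply: (psum_usumE p_prime).
  have := @psum_reindex _ _ _ _ _ (fun v => x - v) (fun v => x - v) _ _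
    (subKr x) (subKr x) h2.
  by apply: psum_eq => v; rewrite subKr.
have h4 : psum (fun u => (coord k u)%:~R * (x == u)%:R * g u) ((coord k x)%:~R * g x).
  have := @psum_single _ _ _ p_prime _ (fun u => (coord k u)%:~R * (x == u)%:R * g u) x.
  rewrite eqxx mulr1; apply => u; rewrite eq_sym => /negbTE ->; by rewrite mulr0 mul0r.
rewrite h3; apply: psum_eq (psumD h4 h2) => u.
by rewrite /row mulrDl.
Qed.

(** In the other order of summation the inner sums are the annihilated rows, so the total is 0. *)
Lemma decaying_pairing k g l : decaying g -> tempered l ->
  (forall u, psum (fun x => row k u x * l x) 0) ->
  psum (fun x => ((coord k x)%:~R * g x + lmul (Hs k) g x) * l x) 0.
Proof.
move=> hg hl hk; have [a [a01 ga na]] := hg.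
have nul : null_family (fun w : (int * int) * (int * int) => row k w.1 w.2 * g w.1 * l w.2).
  apply: (@null_conv _ _ _ _ a phi (fun u x => row k u x * g u * l x) 1) => //.
  - exact: phi_itv.
  - move=> e e0; have [A hA] := phi_null 0 e0; exists A => x /hA; by rewrite subr0.
  move=> u x; rewrite mul1r !pabsM; have rp m : 0 < r ^+ m by rewrite exprn_gt0.
  have hr := row_le k u x; have /andP[a0 a1] := a01 u.
  apply: (@le_trans _ _ (pabs (row k u x) * (a u * r ^+ wt u) * (r ^+ wt x)^-1)).
    by apply: ler_pM; rewrite ?mulr_ge0 ?pabs_ge0 ?ler_wpM2l ?pabs_ge0.
  rewrite mulrAC; apply: (@le_trans _ _ (phi (x - u) / r ^+ wt u * (a u * r ^+ wt u))).
    by rewrite ler_wpM2r // mulr_ge0.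
  rewrite mulrA [X in X * _]mulrAC divfK ?gt_eqF // mulrC //.
have h1 u : psum (fun x => row k u x * g u * l x) 0.
  have := psumZ p_prime (g u) (hk u); rewrite mulr0; apply: psum_eq => x.
  by rewrite mulrA [g u * _]mulrC.
have h2 x : psum (fun u => row k u x * g u * l x)
    (((coord k x)%:~R * g x + lmul (Hs k) g x) * l x).
  have := psumZ p_prime (l x) (row_col_psum k x hg); rewrite mulrC.
  by apply: psum_eq => u; rewrite mulrC.
have [t [ht1 ht2]] := psum_fubini2 nul h1 h2.
have t0 : t = 0 by apply: (psum_unique p_prime ht1); exact: psum_zero.
by rewrite t0 in ht2.
Qed.

End Functionals.

(** * Entries of the Frobenius matrix *)

Section Entries.
Context {R : realType} {p : nat} {K : padicComplexType R p}.
Hypothesis p_prime : prime p.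
Hypothesis p_odd : odd p.
Variables (n a : nat) (E : set K) (F : finFieldType) (red : K -> F).
Variables (tbar gamma pi zeta : K) (sigma : K -> K).
Hypothesis n_gt1 : (1 < n)%N.
Hypothesis n_lt_p : (n < p)%N.
Hypothesis a_gt0 : (0 < a)%N.
Hypothesis E_sub : is_subfield E.
Hypothesis E_Qp : Qp `<=` E.
Hypothesis E_unram : (@pabs R p K) @` E = (@pabs R p K) @` Qp.
Hypothesis F_card : #|F| = (p ^ a)%N.
Hypothesis E_red : is_reduction E red.
Hypothesis tbar_int : integers E tbar.
Hypothesis tbar_norm : pabs tbar = 1.
Hypothesis gamma_root : pcvg \oo (series (AH_term gamma)) 0.
Hypothesis gamma_ord : ordp gamma = ((p.-1)%:R^-1)%:E.
Hypothesis pi_gamma : pi ^+ n = gamma.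
Hypothesis sigma_frob : is_frobenius E zeta pi sigma.

Local Notation r := (pabs pi).
Local Notation N := (n * p.-1)%N.
Local Notation OE := (integers E).
Local Notation Zq := (Zq_adjoin E pi).
Local Notation F_t := (F_t n gamma tbar).
Local Notation wt := (wt n).

Let n_gt0 : (0 < n)%N := ltnW n_gt1.
Let p_gt0 : (0 < p)%N := prime_gt0 p_prime.
Let N_gt0 : (0 < N)%N.
Proof. by rewrite muln_gt0 n_gt0 -subn1 subn_gt0 prime_gt1. Qed.

Lemma pi_norm : pabs pi ^+ N = p%:R^-1.
Proof. by rewrite exprM -pabsX pi_gamma; exact: gamma_norm gamma_ord. Qed.

Lemma pi_pow_Qp : Qp (pi ^+ N).
Proof.
have p0 : (p%:R : K) != 0 by apply: natr_neq0.
rewrite exprM pi_gamma -[_ ^+ _](divfK p0); apply: QpM => //.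
  exact: y0_Qp.
by apply: Qp_rat => //; exact: israt_nat.
Qed.

Let pi0 : 0 < r := pi_gt0 p_prime N_gt0 pi_norm.
Let pi1 : r < 1 := pi_lt1 p_prime pi_norm.
Let pism (e : R) : 0 < e -> exists l, r ^+ l < e := pi_exp_small p_prime pi_norm (e := e).
Let r_ge0 m : 0 <= r ^+ m. Proof. by rewrite exprn_ge0 // ltW. Qed.
Let r_gt0 m : 0 < r ^+ m. Proof. by rewrite exprn_gt0. Qed.
Let pi_n0 : pi != 0. Proof. by rewrite -(pabs_gt0 p_prime). Qed.

Let tbar_le1 : pabs tbar <= 1. Proof. by rewrite tbar_norm. Qed.

Lemma clZq_F v : clZq E pi (F_t v).
Proof.
apply: (clZq_psum p_prime E_sub _ (F_t_psum p_prime p_odd n_gt0 pi_gamma pi0 pi1 pism _ v));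
  last by rewrite tbar_norm.
have Zth i : Zq (Theta gamma i).
  rewrite Theta_scale // -pi_gamma -exprM; apply: (Zq_piX p_prime E_sub); apply: Zq_int => //.
  apply: int_Qp => //; last exact: Theta1_le1.
  by apply: Qp_rat => //; exact: Theta1_rat.
move=> x;
  have [->|[i [j [c [_ _ _ ->]]]]] := Ft_termP p_prime p_odd gamma n_gt0 pi0 pi1 tbar_le1 v x.
  by apply: Zq_int => //; exact: int0.
apply: (ZqM p_prime E_sub); first exact: (ZqM p_prime E_sub).
apply: (ZqM p_prime E_sub) => //; apply: Zq_int => //; exact: intX.
Qed.

Lemma clZq_scale y k : clZq E pi y -> clZq E pi (y * pi ^+ k).
Proof.
move=> hy e e0; have [x hx yx] := hy _ e0; exists (pi ^+ k * x); first exact: Zq_piX.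
rewrite mulrC -mulrBr pabsM; apply: le_lt_trans yx.
by rewrite ler_piMl ?pabs_ge0 // pabsX exprn_ile1 ?pabs_ge0 // ltW.
Qed.

Lemma eps_basis i : eps n i = lmonom (basis_exp n i) :> (laurent K).
Proof. by rewrite /eps /basis_exp; case: ifP. Qed.

Local Notation alpha i := (alpha1 n E gamma pi zeta tbar sigma (epst n pi i)).

(** A single coefficient of F_t meets the monomial [eps] i. It lies in the closure of Z_q[pi], where
    the inverse of sigma exists and preserves norms. *)
Lemma alpha_norm i u : pabs (alpha i u) = r ^+ i * pabs (F_t (u *+ p - basis_exp n i)).
Proof.
have e : psi_p (lmul F_t (epst n pi i)) u = F_t (u *+ p - basis_exp n i) * pi ^+ i.
  rewrite /psi_p /lmul (@usum_single _ _ _ p_prime _ _ (u *+ p - basis_exp n i)).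
    by rewrite /epst eps_basis /lmonom subKr eqxx mulr1.
  move=> v hv; rewrite /epst eps_basis /lmonom (_ : _ == _ = false) ?mulr0 //.
  apply: contraNF hv => /eqP h; by rewrite -h subKr.
rewrite /alpha1 e.
rewrite (clZq_sigma_inv_norm p_prime E_sub E_Qp E_unram a_gt0
  F_card E_red N_gt0 pi_pow_Qp pi_norm sigma_frob).
  by rewrite pabsM pabsX mulrC.
by apply: clZq_scale; exact: clZq_F.
Qed.

Lemma sigma_tbar i : pabs (iter i sigma tbar) <= 1.
Proof.
suff : OE (iter i sigma tbar) by case.
elim: i => // i IH /=; exact: (sigma_OE p_prime E_sub sigma_frob).
Qed.

Local Notation Hx := (Hseries gamma tbar sigma n%:R (n%:Z, 0)).
Local Notation Hy := (Hseries gamma tbar sigma 1 (0, 1)).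
Let Hs' := Hs Hx Hy.

Let n_norm : pabs (n%:R : K) = 1.
Proof. by apply: pabs_nat_lt => //; rewrite n_gt0. Qed.

Lemma Hs_bound k v : pabs (Hs' k v) <= r ^+ (wt v + p.-1 * (wt v - n)).
Proof.
have hb := gamma_trunc_bound p_prime p_odd gamma_root gamma_ord.
have wx : wt (n%:Z, 0) = n := wt_vXY n false.
have wy : wt (0, 1) = n := wt_vXY n true.
have hn : pabs (n%:R : K) <= 1 by rewrite n_norm.
have h1 : pabs (1 : K) <= 1 by rewrite pabs1.
case: k; rewrite /Hs' /Hs.
  exact: (H_le p_prime n_gt0 pi_gamma pi0 hb sigma_tbar h1 wy).
exact: (H_le p_prime n_gt0 pi_gamma pi0 hb sigma_tbar hn wx).
Qed.

Lemma Hs_support k v : Hs' k v != 0 ->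
  exists i, v = vXY n k *+ p ^ i \/ v = vZ *+ p ^ i.
Proof.
have wx : wt (n%:Z, 0) = n := wt_vXY n false.
have wy : wt (0, 1) = n := wt_vXY n true.
by case: k; [exact: (H_supp p_prime n_gt0 wy)|exact: (H_supp p_prime n_gt0 wx)].
Qed.

Lemma Hs_main k : pabs (Hs' k (vXY n k)) = r ^+ n.
Proof.
have g0 : gamma_ gamma 0 = gamma := gamma_trunc0 gamma.
rewrite -pabsX pi_gamma; case: k; rewrite /Hs' /Hs /vXY.
  rewrite (H_w p_prime tbar sigma n_gt0 g0 1 zexp_Y (wt_vXY n true)).
  by rewrite mul1r.
rewrite (H_w p_prime tbar sigma n_gt0 g0 n%:R (zexp_X n) (wt_vXY n false)).
by rewrite pabsM n_norm mul1r.
Qed.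

Lemma Hs_mainZ k : pabs (Hs' k vZ) = r ^+ n.
Proof.
have g0 : gamma_ gamma 0 = gamma := gamma_trunc0 gamma.
rewrite -pabsX pi_gamma; case: k; rewrite /Hs' /Hs /vZ.
  rewrite (H_Z p_prime tbar sigma n_gt0 g0 1 zexp_Y (wt_vXY n true)).
  by rewrite pabsN pabsM tbar_norm mul1r.
rewrite (H_Z p_prime tbar sigma n_gt0 g0 n%:R (zexp_X n) (wt_vXY n false)).
by rewrite pabsN pabsM tbar_norm mul1r.
Qed.

Lemma C0_decaying g : C0 n E pi g -> decaying n pi g.
Proof.
case=> xi [hZ hs hg]; exists (fun u => pabs (xi u)); split.
- by move=> u; rewrite pabs_ge0 (Zq_le1 p_prime E_sub pi_norm (hZ u)).
- move=> u; rewrite hg pabsM n_omega_wt // -exprnP pabsX //.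
move=> e e0; have [M hM] := hs e e0.
have [A hA] := @wt_finite n n_gt0 (Num.bound (n%:R * M)).
exists A => u /hA h; apply: ltW; apply: hM.
have n0 : 0 < (n%:R : rat) by rewrite ltr0n.
rewrite -(ler_pM2l n0) -n_omegaE // n_omega_wt //.
apply: (@le_trans _ _ (Num.bound (n%:R * M))%:R).
  have [hle|hge] := lerP 0 (n%:R * M); first by rewrite ltW // archi_boundP.
  by apply: ltW; apply: lt_le_trans hge _; rewrite ler0n.
by rewrite -pmulrn ler_nat ltnW.
Qed.

Variable A : 'M[K]_((2 * n).+1).
Hypothesis A_frob : is_frobenius_matrix E gamma pi zeta tbar sigma A.

Lemma entry_formula (j : 'I_(2 * n).+1) : exists l : int * int -> K,
  [/\ forall x, pabs (l x) <= r ^+ @Nb p j (wt x) / r ^+ wt x,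
      l (basis_exp n j) = (pi ^+ j)^-1 &
      forall i : 'I_(2 * n).+1, psum (fun u => alpha i u * l u) (A i j)].
Proof.
have hj : (j <= 2 * n)%N by rewrite -ltnS.
have p3 := p_ge3 p_prime p_odd.
have Hsym v : v.1%:~R * Hy v = v.2%:~R * Hx v := H_sym p_prime gamma tbar sigma n_gt0 v.
have [l [lb lv lk]] := dual_functional p_prime p3 n_gt1 pi0 pi1 pism Hs_bound Hs_support
  Hs_main Hs_mainZ Hsym hj.
exists l; split=> //; first by rewrite lv // eqxx mul1r.
have lt : tempered n pi l.
  by move=> x; apply: le_trans (lb x) _; rewrite ler_piMl ?invr_ge0 // exprn_ile1 // ltW.
move=> i; have [_ /(_ i) [g [h [hg hh hA]]]] := A_frob.
have dg k f : C0 n E pi f -> psum (fun x => ((coord k x)%:~R * f x + lmul (Hs' k) f x) * l x) 0.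
  move=> hf; exact: (decaying_pairing p_prime p3 n_gt1 pi0 pi1 pism Hs_bound Hs_support
    (C0_decaying hf) lt (lk k)).
have hsingle (j' : 'I_(2 * n).+1) :
    psum (fun u => A i j' * epst n pi j' u * l u) (A i j' * (j' == j)%:R).
  have hs : psum (fun u => A i j' * epst n pi j' u * l u)
      (A i j' * epst n pi j' (basis_exp n j') * l (basis_exp n j')).
    apply: (psum_single p_prime) => u /negbTE ub.
    by rewrite /epst eps_basis /lmonom ub !mulr0 mul0r.
  have ev : l (basis_exp n j') = (j' == j)%:R / pi ^+ j by rewrite lv // -ltnS.
  suff e : A i j' * epst n pi j' (basis_exp n j') * l (basis_exp n j') = A i j' * (j' == j)%:R.
    by rewrite -e.
  rewrite /epst eps_basis /lmonom eqxx mulr1 ev -mulrA; congr (_ * _).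
  case: eqP => [->|_]; last by rewrite !mul0r mulr0.
  by rewrite mulrCA divff ?mulr1 // expf_neq0.
have hbase := psum_sum p_prime (index_enum 'I_(2 * n).+1) hsingle.
have e : \sum_(j' < (2 * n).+1) A i j' * (j' == j)%:R = A i j.
  rewrite (bigD1 j) //= eqxx mulr1 big1 ?addr0 // => j' /negbTE ->.
  by rewrite mulr0.
have := psumD hbase (psumD (dg false g hg) (dg true h hh)).
rewrite e !addr0; apply: psum_eq => u; rewrite hA !mulrDl -!mulr_suml.
congr (_ + (_ + _)); by rewrite mulr_suml; apply: eq_bigr.
Qed.

Local Notation T l i u := (alpha i u * l u).

Lemma wt_shift i u : (i <= 2 * n)%N ->
  (wt u * p <= wt (u *+ p - basis_exp n i)%R + i)%N.
Proof.
move=> hi; rewrite -[X in (_ + X)%N](wt_basis n_gt1) -wtMn //.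
by rewrite -[X in (wt X <= _)%N](subrK (basis_exp n i)); exact: wtD_le.
Qed.

Lemma term_le_exp (l : int * int -> K) i j u e X :
  pabs (l u) <= r ^+ @Nb p j (wt u) / r ^+ wt u ->
  pabs (F_t (u *+ p - basis_exp n i)) <= r ^+ (wt (u *+ p - basis_exp n i)%R + e) ->
  (wt u + X <= i + (wt (u *+ p - basis_exp n i)%R + e) + @Nb p j (wt u))%N ->
  pabs (T l i u) <= r ^+ X.
Proof.
move=> hl hF hX; rewrite pabsM alpha_norm.
have h := ler_pM (pabs_ge0 _) (pabs_ge0 _) hF hl.
rewrite -mulrA; apply: le_trans (ler_wpM2l (r_ge0 i) h) _.
rewrite mulrA -exprD mulrA -exprD ler_pdivrMr // -exprD.
by apply: ler_wiXn2l; rewrite ?(ltW pi0) ?(ltW pi1) // addnC.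
Qed.

(* The rank of the block of [i] among {0}, {1..n} and {n+1..2n}. *)
Definition lev i : nat := ((0 < i) + (n < i))%N.

(** By [wt_shift], i + wt v - wt u is at least (p-1) wt u, and adding [Nb] exceeds (p-1) j unless wt
    u = j. For the same reason no cancellation is possible in v + basis_exp i = p u, so zexp v = p
    zexp u. The divisibility then reads p (u.1 + zexp u) = i mod n, and u.1 + zexp u = j mod n by
    the formula for the weight. Positivity comes from v.1 + zexp v and v.2 + zexp v being
    nonnegative. *)
Lemma critical_index i j u (v := u *+ p - basis_exp n i) : (i <= 2 * n)%N ->
  (i + wt v + @Nb p j (wt u) < wt u + (p.-1 * j).+1)%N ->
  (n %| `|(v.1 + zexp v)%R|)%N ->
  [/\ wt u = j, p * j = i %[mod n], (0 < i)%N -> 0 < u.1 + zexp u &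
      (n < i)%N -> 0 < u.2 + zexp u].
Proof.
move=> hi hs hd; have h := wt_shift u hi; rewrite -/v in h.
have p2 := prime_gt1 p_prime.
have [p' ep] : exists p', p = p'.+2 by exists p.-2; lia.
have wj : wt u = j.
  by move: hs h; rewrite /Nb ep /=; set w := wt u; case: ltnP => hw; nia.
have zv : zexp v = zexp u * p%:Z.
  rewrite -zexpMn; apply/eqP; apply: contraTT hs => zn; rewrite -leqNgt.
  have hb := zexp_basis n i.
  have e : v + basis_exp n i = u *+ p by rewrite /v subrK.
  have : zexp (v + basis_exp n i) != zexp v + zexp (basis_exp n i).
    by rewrite e hb addr0 eq_sym.
  move=> /(wtD_lt n_gt0); rewrite e wtMn // wt_basis // wj /Nb ltnn subnn ep /=.
  by lia.
have [z0 z1 z2 _] := zexpP v; have [u0 u1 u2 _] := zexpP u.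
have v1 : v.1 = u.1 * p%:Z - (basis_exp n i).1 by rewrite /v pairMn.
have v2 : v.2 = u.2 * p%:Z - (basis_exp n i).2 by rewrite /v pairMn.
have wu := wtE n u.
move: z1 z2 hd; rewrite v1 v2 zv => z1 z2 hd; split=> //; last 1 first.
- move=> ni; have e2 : (basis_exp n i).2 = 1 by rewrite /basis_exp leqNgt ni.
  by rewrite -(pmulr_lgt0 _ (_ : 0 < p%:Z)) ?ltz_nat // mulrDl; move: z2; rewrite e2; lia.
- have [a0 ea] : exists a0 : nat, u.1 + zexp u = a0%:Z 
    by exists `|(u.1 + zexp u)%R|%N; rewrite gez0_abs.
  have [b eb] : exists b : nat, u.2 + zexp u + zexp u = b%:Z.
    by exists `|(u.2 + zexp u + zexp u)%R|%N; rewrite gez0_abs // addr_ge0.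
  have ej : j = (a0 + n * b)%N by apply/eqP; rewrite -eqz_nat -wj wu ea eb.
  have -> : (p * j)%N = (p * a0 + p * b * n)%N by rewrite ej; ring.
  have [k ek] : exists k, (p * a0 = (if (i <= n)%N then i else i - n) + k * n)%N.
    have /dvdnP[k ek] := hd; exists k.
    have eb1 : (basis_exp n i).1 = (if (i <= n)%N then i else i - n)%N by rewrite /basis_exp;
      case: ifP.
    apply/eqP; rewrite -eqz_nat PoszM PoszD -ek gez0_abs // -ea -eb1; apply/eqP; ring.
  rewrite ek -addnA -mulnDl addnC modnMDl; case: leqP => // hn.
  by rewrite -[in RHS](subnK (ltnW hn)) modnDr.
- move=> i0; have e1 : 0 < (basis_exp n i).1 by rewrite /basis_exp; case: leqP => hn /=; lia.
  by rewrite -(pmulr_lgt0 _ (_ : 0 < p%:Z)) ?ltz_nat // mulrDl; move: z1 e1; lia.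
Qed.

(** A factor x in the shortest monomial gives weight at least 1, factors x and y together at least
    n+1. *)
Lemma lev_le j i u : wt u = j -> ((0 < i)%N -> 0 < u.1 + zexp u) ->
  ((n < i)%N -> 0 < u.2 + zexp u) -> (lev i <= lev j)%N.
Proof.
move=> wj; have := wtE n u; rewrite wj; have [u0 u1 u2 _] := zexpP u.
move: (u.1 + zexp u) (u.2 + zexp u) (zexp u) u0 u1 u2 => x y c u0 u1 u2 e h1 h2.
rewrite /lev; case: (ltnP n i) => hn.
  have i0 := leq_ltn_trans (leq0n n) hn.
  move: (h1 i0) (h2 hn) => {}h1 {}h2; have jn : (n < j)%N by nia.
  by rewrite i0 jn (leq_ltn_trans (leq0n n) jn).
case: (posnP i) h1 => // _ /(_ isT) h1; have j0 : (0 < j)%N by nia.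
by rewrite j0.
Qed.

(** In the last block, weight at most 2n with both x and y present leaves room for one y and no
    1/(xy). In the others there is room for neither. *)
Lemma lev_eq_basis j i u : (j <= 2 * n)%N -> wt u = j -> lev i = lev j ->
  ((0 < i)%N -> 0 < u.1 + zexp u) -> ((n < i)%N -> 0 < u.2 + zexp u) ->
  u = basis_exp n j.
Proof.
move=> hj wj; have := wtE n u; rewrite wj; have [u0 u1 u2 u3] := zexpP u.
move=> {wj}; case: u u0 u1 u2 u3 => x y /=; set c := zexp _ => u0 u1 u2 u3.
rewrite /lev /basis_exp; case: (ltnP n j) => hn.
  rewrite (leq_ltn_trans (leq0n n) hn) => e el h1 h2.
  have {}h1 : 0 < x + c by apply: h1; lia.
  have {}h2 : 0 < y + c by apply: h2; lia.
  have e1 : y + c + c = 1 by nia.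
  by rewrite e1 in e; congr (_, _); lia.
move=> e el h1 _.
have e1 : y + c + c = 0.
  case: (posnP j) => j0; first by nia.
  have {}h1 : 0 < x + c by apply: h1; lia.
  nia.
by rewrite e1 in e; congr (_, _); lia.
Qed.

Lemma term_noncritical (l : int * int -> K) i j u : (i <= 2 * n)%N ->
  pabs (l u) <= r ^+ @Nb p j (wt u) / r ^+ wt u ->
  [/\ wt u = j, p * j = i %[mod n], (0 < i)%N -> 0 < u.1 + zexp u &
      (n < i)%N -> 0 < u.2 + zexp u] \/ pabs (T l i u) <= r ^+ (p.-1 * j).+1.
Proof.
move=> hi hl; set v := u *+ p - basis_exp n i.
have [hd|hd] := boolP (n %| `|(v.1 + zexp v)%R|)%N; last first.
  right; apply: (term_le_exp (e := 1) hl).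
    rewrite addn1; exact: (F_t_lt p_prime p_odd n_gt0 pi_gamma pi0 pi1 pism tbar_le1).
  have := wt_shift u hi; rewrite /Nb; set w := wt u.
  have [p' ep] : exists p', p = p'.+2 by have := prime_gt1 p_prime; exists p.-2; lia.
  by rewrite -/v ep /=; case: ltnP => hw; nia.
have [hs|hs] := leqP (wt u + (p.-1 * j).+1) (i + wt v + @Nb p j (wt u)).
  right; apply: (term_le_exp (e := 0) hl); last by rewrite addn0.
  rewrite addn0; exact: (F_t_le p_prime p_odd n_gt0 pi_gamma pi0 pi1 pism tbar_le1).
by left; exact: critical_index hi hs hd.
Qed.

Lemma term_basis (l : int * int -> K) i j : (i <= 2 * n)%N -> (j <= 2 * n)%N ->
  l (basis_exp n j) = (pi ^+ j)^-1 -> p * j = i %[mod n] -> lev i = lev j ->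
  pabs (T l i (basis_exp n j)) = r ^+ (p.-1 * j).
Proof.
move=> hi hj hl hm he; rewrite pabsM alpha_norm hl pabsV // pabsX.
(* In the last block b = p-1, otherwise b = 0; and nk is the difference of the x-exponents, below pn
   because i > 0 or i = j = 0. Thus [F_t_unit] applies. *)
suff [k [b [kp bp ev ew]]] : exists k b, [/\ (k < p)%N, (b < p)%N,
    basis_exp n j *+ p - basis_exp n i = (n%:Z * k%:Z, b%:Z) &
    (i + n * (k + b) = p.-1 * j + j)%N].
  rewrite ev (F_t_unit p_prime p_odd n_gt0 pi_gamma pi0 pi1 pism tbar_le1 kp bp).
  by rewrite -exprD ew exprD mulfK // gt_eqF.
have p2 := prime_gt1 p_prime.
have pj : (p.-1 * j + j = p * j)%N by rewrite -mulSnr prednK.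
rewrite pj pairMn /basis_exp; move: he; rewrite /lev.
have hle (x y : nat) : x = y %[mod n] -> (y <= x)%N -> exists k, x = (y + k * n)%N.
  move=> e yx; have : (n %| x - y)%N by rewrite -eqn_mod_dvd // e.
  by case/dvdnP => k hk; exists k; rewrite -hk subnKC.
case: (ltnP n i) => hi1; case: (ltnP n j) => hj1; [| lia | lia |].
- move=> _; have hm' : p * (j - n) = i - n %[mod n].
    apply/eqP; rewrite -(eqn_modDr (p * n)) -mulnDr subnK ?(ltnW hj1) //.
    by rewrite [(i - n + _)%N]addnC modnMDl hm -{1}(subnK (ltnW hi1)) modnDr.
  have hge : (i - n <= p * (j - n))%N.
    apply: (@leq_trans p); first lia.
    by rewrite leq_pmulr // subn_gt0.
  have [k hk] := hle _ _ hm' hge.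
  have jn : (p * (j - n) <= p * n)%N by rewrite leq_mul2l; lia.
  exists k, p.-1; split; rewrite ?prednK //.
  - have : (k * n < p * n)%N by lia.
    by rewrite ltn_mul2r => /andP[].
  - by congr (_, _) => /=; lia.
  have e1 : (p * j = p * (j - n) + p * n)%N by rewrite -mulnDr subnK // ltnW.
  have e2 : (p * n = p.-1 * n + n)%N by rewrite -mulSnr prednK.
  by rewrite mulnDr [(n * k)%N]mulnC [(n * _.-1)%N]mulnC; lia.
- move=> e; have jp : (0 < i)%N -> (p <= p * j)%N by move=> i0; rewrite leq_pmulr //; lia.
  have hge : (i <= p * j)%N by case: (posnP i) jp => [-> //|_] /(_ isT); lia.
  have [k hk] := hle _ _ hm hge.
  have jn : (p * j <= p * n)%N by rewrite leq_mul2l hj1 orbT.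
  exists k, 0%N; split => //.
  - case: (posnP i) => i0.
      have j0 : j = 0%N by lia.
      by move: hk; rewrite j0 i0 muln0 add0n => /esym/eqP; rewrite muln_eq0; lia.
    have : (k * n < p * n)%N by lia.
    by rewrite ltn_mul2r => /andP[].
  - by congr (_, _) => /=; lia.
  by rewrite addn0 [(n * k)%N]mulnC; lia.
Qed.

Lemma entry_le (i j : 'I_(2 * n).+1) : pabs (A i j) <= r ^+ (p.-1 * j).
Proof.
have [l [hl lb hA]] := entry_formula j.
apply: (psum_le p_prime (r_ge0 _) (hA i)) => u.
apply: (term_le_exp (e := 0) (hl u)); rewrite addn0.
  exact: (F_t_le p_prime p_odd n_gt0 pi_gamma pi0 pi1 pism tbar_le1).
have hi : (i <= 2 * n)%N by rewrite -ltnS.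
have := wt_shift u hi; rewrite /Nb; set w := wt u.
have [p' ep] : exists p', p = p'.+2 by have := prime_gt1 p_prime; exists p.-2; lia.
by rewrite ep /=; case: ltnP => hw; nia.
Qed.

Lemma entry_lt (i j : 'I_(2 * n).+1) : ~ (p * j = i %[mod n] /\ (lev i <= lev j)%N) ->
  pabs (A i j) <= r ^+ (p.-1 * j).+1.
Proof.
move=> hn; have hi : (i <= 2 * n)%N by rewrite -ltnS.
have [l [hl lb hA]] := entry_formula j.
apply: (psum_le p_prime (r_ge0 _) (hA i)) => u.
have [[wj hm h1 h2]|//] := term_noncritical hi (hl u).
by case: hn; split=> //; exact: lev_le wj h1 h2.
Qed.

Lemma entry_eq (i j : 'I_(2 * n).+1) : p * j = i %[mod n] -> lev i = lev j ->
  pabs (A i j) = r ^+ (p.-1 * j).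
Proof.
move=> hm he; have hi : (i <= 2 * n)%N by rewrite -ltnS.
have hj : (j <= 2 * n)%N by rewrite -ltnS.
have [l [hl lb hA]] := entry_formula j.
rewrite -(term_basis hi hj lb hm he) -[A i j](subrK (T l i (basis_exp n j))) addrC.
apply: pabs_dominant; rewrite (term_basis hi hj lb hm he).
apply: (@le_lt_trans _ _ (r ^+ (p.-1 * j).+1)); last by rewrite exprS gtr_pMl.
apply: (psum_dominant p_prime (r_ge0 _) (hA i)) => u.
have [[wj _ h1 h2]|//] := term_noncritical hi (hl u).
by rewrite (lev_eq_basis hj wj he h1 h2) eqxx.
Qed.

End Entries.

(** * Coefficients of the characteristic series *)

Section DetCoefficients.
Local Open Scope set_scope.
Variables (K : comNzRingType) (N : nat) (A : 'M[K]_N).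

(** J is the set of columns where the entry of -AT is taken in the Leibniz expansion; elsewhere the
    entry of the identity is taken. *)
Definition minor_term m (sJ : 'S_N * {set 'I_N}) : K :=
  (-1) ^+ sJ.1 * ((#|sJ.2| == m)%:R *
    \prod_j (if j \in sJ.2 then - A (sJ.1 j) j else (sJ.1 j == j)%:R)).

Lemma coef_det_one_sub m :
  (\det (1%:M - 'X *: map_mx polyC A))`_m = \sum_sJ minor_term m sJ.
Proof.
rewrite -det_tr /determinant coef_sum -(pair_bigA _ (fun s J => minor_term m (s, J))) /=.
apply: eq_bigr => s _.
have e j : (1%:M - 'X *: map_mx polyC A)^T j (s j) =
    (- A (s j) j)%:P * 'X + (s j == j)%:R%:P.
  by rewrite !mxE polyCN mulNr addrC [_%:P * 'X]mulrC rmorph_nat.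
under eq_bigr do rewrite e.
rewrite bigA_distr -(rmorph_sign (@polyC K)) mul_polyC coefZ coef_sum mulr_sumr.
apply: eq_bigr => J _; rewrite /minor_term /=; congr (_ * _).
have -> : \prod_j (if j \in J then (- A (s j) j)%:P * 'X else (s j == j)%:R%:P) =
    (\prod_j (if j \in J then - A (s j) j else (s j == j)%:R))%:P * 'X^#|J|.
  rewrite rmorph_prod /= -prodr_const [\prod_(i in J) _]big_mkcond -big_split /=.
  by apply: eq_bigr => j _; case: ifP; rewrite ?mulr1.
by rewrite coefCM coefXn eq_sym mulrC.
Qed.

End DetCoefficients.

Lemma sum_ord_double m : (2 * \sum_(i < m) i = m * (m - 1))%N.
Proof.
elim: m => [|m IH]; first by rewrite big_ord0.
by rewrite big_ord_recr /= mulnDr IH subSS subn0; case: m {IH} => // m; rewrite subSS subn0;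
  ring.
Qed.

Section Subsets.
Local Open Scope set_scope.

(** Passing from the initial segment to J replaces indices at most m-1 by as many indices at least
    m. *)
Lemma sum_subset_ge N m (J : {set 'I_N}) (J0 := [set j : 'I_N | (j < m)%N]) : #|J| = #|J0| ->
  (\sum_(j in J0) j + #|J :\: J0| <= \sum_(j in J) j)%N.
Proof.
move=> hc;
  rewrite (big_setID J) [X in (_ <= X)%N](big_setID J0) /= finset.setIC -addnA leq_add2l.
have hD : #|J0 :\: J| = #|J :\: J0|.
  by apply/eqP; rewrite -(eqn_add2l #|J0 :&: J|) cardsID finset.setIC cardsID hc.
have h1 : (\sum_(j in J0 :\: J) (j + 1) <= \sum_(j in J0 :\: J) m)%N.
  by apply: leq_sum => j; rewrite !inE addn1 => /andP[].
have h2 : (\sum_(j in J :\: J0) m <= \sum_(j in J :\: J0) j)%N.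
  by apply: leq_sum => j; rewrite !inE -leqNgt => /andP[].
by move: h1 h2; rewrite big_split /= !sum_nat_const muln1 hD; exact: leq_trans.
Qed.

End Subsets.

(** * Multiplication by p modulo n inside the blocks *)

Section Residues.
Variables (n p : nat).
Hypothesis n_gt1 : (1 < n)%N.
Hypothesis p_prime : prime p.
Hypothesis n_lt_p : (n < p)%N.

Let n_gt0 : (0 < n)%N := ltnW n_gt1.

Lemma lev_mod_inj i j : (i <= 2 * n)%N -> (j <= 2 * n)%N ->
  i = j %[mod n] -> lev n i = lev n j -> i = j.
Proof.
wlog ij : i j / (i <= j)%N => [W hi hj e l|].
  by case: (leqP i j) => h; [exact: W|apply/esym/W => //; exact: ltnW].
move=> hi hj e l.
have /dvdnP[k hk] : (n %| j - i)%N by rewrite -eqn_mod_dvd // e.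
case: k hk => [|k]; first lia.
rewrite mulSn => hk; have : (n <= j - i)%N by rewrite hk leq_addr.
by move: l; rewrite /lev; lia.
Qed.

Lemma mod_mul_inj i j : p * i = p * j %[mod n] -> i = j %[mod n].
Proof.
have cop : coprime n p.
  by rewrite coprime_sym prime_coprime // gtnNdvd.
wlog ij : i j / (i <= j)%N => [W e|].
  by case: (leqP i j) => h; [exact: W|apply/esym/W => //; exact: ltnW].
move=> e; apply/esym/eqP; rewrite eqn_mod_dvd // -(Gauss_dvdr _ cop) mulnBr.
by rewrite -eqn_mod_dvd ?leq_mul2l ?ij ?orbT // e.
Qed.

(** The residue of p j is represented in {1..n}, shifted by n in the last block. The predecessor
    followed by + 1 replaces the residue 0 by n and so keeps the block. *)
Definition frob_index j : nat :=
  if j == 0%N then 0%N else ((p * j).-1 %% n + 1 + (if (j <= n)%N then 0 else n))%N.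

Lemma frob_index_mod j : p * j = frob_index j %[mod n].
Proof.
rewrite /frob_index; case: eqP => [->|/eqP j0]; first by rewrite muln0.
have e : ((p * j).-1 %% n + 1 = p * j %[mod n])%N.
  by rewrite modnDml addn1 prednK // muln_gt0 prime_gt0 // lt0n.
by case: ifP => _; rewrite ?addn0 ?modnDr e.
Qed.

Lemma frob_index_bound j : (j <= 2 * n)%N ->
  lev n (frob_index j) = lev n j /\ (frob_index j <= 2 * n)%N.
Proof.
rewrite /frob_index /lev; case: eqP => [->|/eqP j0] // hj.
have := ltn_pmod (p * j).-1 n_gt0; move: (_ %% _)%N => z hz.
by case: (leqP j n) => h; lia.
Qed.

Lemma frob_index_unique i j : (i <= 2 * n)%N -> (j <= 2 * n)%N ->
  p * j = i %[mod n] -> lev n i = lev n j -> i = frob_index j.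
Proof.
move=> hi hj e l; have [l' b] := frob_index_bound hj.
by apply: lev_mod_inj => //; [rewrite -e frob_index_mod|rewrite l'].
Qed.

Lemma frob_index_inj i j : (i <= 2 * n)%N -> (j <= 2 * n)%N ->
  frob_index i = frob_index j -> i = j.
Proof.
move=> hi hj e; have [li _] := frob_index_bound hi; have [lj _] := frob_index_bound hj.
apply: lev_mod_inj => //; last by rewrite -li -lj e.
by apply: mod_mul_inj; rewrite !frob_index_mod e.
Qed.

Lemma frob_index_fix k : (k == n) || (k == 2 * n)%N -> frob_index k = k.
Proof.
move=> hk; apply/esym/frob_index_unique => //.
- by case/orP: hk => /eqP ->; lia.
- by case/orP: hk => /eqP ->; lia.
by case/orP: hk => /eqP ->; rewrite ?mulnA ?modnMl ?modnn.
Qed.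

(** For m = 1, n+1, 2n+1 the initial segment is a union of blocks. For m = n, 2n its complement in
    such a union is the single index n or 2n, a fixed point of an injective map. *)
Lemma frob_index_lt m j : m \in [:: 1; n; n.+1; 2 * n; (2 * n).+1]%N ->
  (j < m)%N -> (frob_index j < m)%N.
Proof.
move=> hm jm.
have hj : (j <= 2 * n)%N.
  by move: hm jm; rewrite !inE => /or4P[| | |/orP[]] /eqP ->; lia.
have [l b] := frob_index_bound hj.
have hfix k : (k == n) || (k == 2 * n)%N -> (j < k)%N -> frob_index j != k.
  move=> hk jk; apply/eqP => e; have := ltn_neqAle j k; rewrite jk => /esym/andP[/eqP]; case.
  by apply: frob_index_inj => //; [lia|rewrite e frob_index_fix].
have hn := hfix n; have h2n := hfix (2 * n)%N; move: hn h2n; rewrite !eqxx ?orbT /=.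
move=> /(_ isT) hn /(_ isT) h2n.
by move: hm jm l; rewrite !inE => /or4P[| | |/orP[]] /eqP -> jm; rewrite /lev;
  [|have := hn jm| | have := h2n jm|]; lia.
Qed.

End Residues.

(** * The dominant term of the m-th coefficient *)

Section DetNorm.
Local Open Scope set_scope.
Context {R : realType} {p : nat} {K : padicComplexType R p}.
Hypothesis p_prime : prime p.
Variables (n : nat) (r : R) (A : 'M[K]_((2 * n).+1)).
Hypothesis n_gt1 : (1 < n)%N.
Hypothesis n_lt_p : (n < p)%N.
Hypothesis r_gt0 : 0 < r.
Hypothesis r_lt1 : r < 1.
Hypothesis A_le : forall i j, pabs (A i j) <= r ^+ (p.-1 * j).
Hypothesis A_lt : forall i j : 'I_(2 * n).+1,
  ~ (p * j = i %[mod n] /\ (lev n i <= lev n j)%N) ->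
  pabs (A i j) <= r ^+ (p.-1 * j).+1.
Hypothesis A_eq : forall i j : 'I_(2 * n).+1, p * j = i %[mod n] -> lev n i = lev n j ->
  pabs (A i j) = r ^+ (p.-1 * j).
Variable m : nat.
Hypothesis m_break : m \in [:: 1; n; n.+1; 2 * n; (2 * n).+1]%N.

Local Notation N := (2 * n).+1.
Let r_ge0 k : 0 <= r ^+ k. Proof. by rewrite exprn_ge0 // ltW. Qed.
Let ord_le (j : 'I_N) : (j <= 2 * n)%N. Proof. by rewrite -ltnS. Qed.
Let J0 := [set j : 'I_N | (j < m)%N].

Let m_le : (m <= N)%N.
Proof. by move: m_break; rewrite !inE => /or4P[| | |/orP[]] /eqP ->; lia. Qed.

Let J0_card : #|J0| = m.
Proof.
rewrite cardsE -sum1_card -[RHS]card_ord -sum1_card (big_ord_widen N (fun=> 1%N) m_le).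
exact: eq_bigl.
Qed.

Let J0_sum : (\sum_(j in J0) j = \sum_(i < m) i)%N.
Proof.
rewrite (big_ord_widen N (fun i => i) m_le); apply: eq_bigl => j; by rewrite inE.
Qed.

(** Multiplication by p on the first m indices, extended by the identity as a nonzero term
    requires. *)
Let f0 (j : 'I_N) : 'I_N := if (j < m)%N then inord (frob_index n p j) else j.

Let f0E (j : 'I_N) : f0 j = (if (j < m)%N then frob_index n p j else j) :> nat.
Proof.
rewrite /f0; case: ifP => // jm; rewrite inordK // ltnS.
by have [] := frob_index_bound n_gt1 p_prime n_lt_p (ord_le j).
Qed.

Let f0_inj : injective f0.
Proof.
move=> i j /(congr1 val); rewrite /= !f0E.
case: ifP => hi; case: ifP => hj e; apply: val_inj => //=.
- exact: (frob_index_inj n_gt1 p_prime n_lt_p (ord_le i) (ord_le j)).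
- by move: (frob_index_lt n_gt1 p_prime n_lt_p m_break hi); rewrite e hj.
- by move: (frob_index_lt n_gt1 p_prime n_lt_p m_break hj); rewrite -e hi.
Qed.

Let s0 : {perm 'I_N} := perm f0_inj.

Let t (sJ : {perm 'I_N} * {set 'I_N}) : K := minor_term A m sJ.

Let pabs_prod (f : 'I_N -> K) : pabs (\prod_j f j) = \prod_j pabs (f j).
Proof. by apply: (big_morph _ (@pabsM _ _ _)); exact: pabs1. Qed.

Let pabs_sign b : pabs ((-1) ^+ b : K) = 1.
Proof. by rewrite pabsX pabsN pabs1 expr1n. Qed.

Let t_norm_le (s : {perm 'I_N}) (J : {set 'I_N}) (e : 'I_N -> nat) : #|J| = m -> 
  (forall j, j \in J -> pabs (A (s j) j) <= r ^+ (p.-1 * j + e j)) ->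
  pabs (t (s, J)) <= r ^+ (p.-1 * (\sum_(j in J) j) + \sum_(j in J) e j).
Proof.
move=> cJ hA; rewrite /t /minor_term /= cJ eqxx mul1r pabsM pabs_sign mul1r pabs_prod.
rewrite big_distrr -big_split /= -prodrXr [X in _ <= X]big_mkcond /=.
apply: ler_prod => j _; rewrite pabs_ge0 /=; case: ifP => jJ; first by rewrite pabsN hA.
by case: eqP => _; rewrite ?pabs1 ?pabs0 // ler01.
Qed.

(** A factor r is lost if some column of J carries a non-critical entry, or if J is not the initial
    segment, whose index sum is minimal. Otherwise s preserves levels as well as the congruence,
    which determines it as [s0]. *)
Let t_other sJ : sJ != (s0, J0) -> pabs (t sJ) <= r ^+ (p.-1 * (\sum_(i < m) i)).+1.
Proof.
case: sJ => s J hne.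
have [cJ|cJ] := eqVneq #|J| m; last first.
  by rewrite /t /minor_term /= (negbTE cJ) mul0r mulr0 pabs0.
have [/forallP hs|] := boolP [forall j, (j \in J) || (s j == j)]; last first.
  rewrite negb_forall => /existsP[j]; rewrite negb_or => /andP[jJ sj].
  rewrite /t /minor_term (bigD1 j) //= (negbTE jJ) (negbTE sj) mul0r !mulr0 pabs0 //.
have hcard : #|J| = #|J0| by rewrite cJ.
have hsum := sum_subset_ge hcard; rewrite -/J0 J0_sum in hsum.
have r_mono a b : (b <= a)%N -> r ^+ a <= r ^+ b.
  by move=> ab; apply: ler_wiXn2l => //; exact: ltW.
have p1 : (0 < p.-1)%N by have := prime_gt1 p_prime; lia.
pose good (j : 'I_N) := (p * j == s j %[mod n]) && (lev n (s j) <= lev n j)%N.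
have [/existsP[j /andP[jJ nj]]|/existsPn hgood] := boolP [exists j, (j \in J) && ~~ good j].
  have h : forall i, i \in J -> pabs (A (s i) i) <= r ^+ (p.-1 * i + (i == j)).
    move=> i iJ; case: eqP => [->|_]; last by rewrite addn0.
    rewrite addn1; apply: A_lt => -[h1 h2].
    by move: nj; rewrite /good h2 andbT => /eqP.
  apply: le_trans (t_norm_le cJ h) _; apply: r_mono.
  rewrite [X in (_ < _ + X)%N](bigD1 j) //= eqxx.
  have h2 : (p.-1 * (\sum_(i < m) i) <= p.-1 * (\sum_(j in J) j))%N.
    by rewrite leq_mul2l (leq_trans (leq_addr _ _) hsum) orbT.
  by apply: leq_ltn_trans h2 _; rewrite -[X in (X < _)%N]addn0 ltn_add2l.
have [eJ|nJ] := eqVneq J J0; last first.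
  have h : forall i, i \in J -> pabs (A (s i) i) <= r ^+ (p.-1 * i + 0).
    by move=> i _; rewrite addn0.
  apply: le_trans (t_norm_le (e := fun=> 0%N) cJ h) _; apply: r_mono.
  have hD : (0 < #|J :\: J0|)%N.
    rewrite card_gt0; apply: contra_neq nJ => /eqP; rewrite finset.setD_eq0 => JJ0.
    by apply/eqP; rewrite eqEcard JJ0 hcard leqnn.
  have h2 := leq_mul (leqnn p.-1) hsum.
  apply: leq_trans (leq_trans _ h2) (leq_addr _ _).
  by rewrite mulnDr -addn1 leq_add2l muln_gt0 p1.
have hle j : (lev n (s j) <= lev n j)%N.
  have := hgood j; have /orP[->|/eqP ->//] := hs j.
  by rewrite /= negbK => /andP[].
(* A permutation which never raises the level preserves it. *)
have hl j : lev n (s j) = lev n j.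
  have e : (\sum_(j : 'I_N) (lev n j - lev n (s j)) = 0)%N.
    rewrite sumnB // -(reindex_inj (@perm_inj _ s) (P := xpredT) (F := fun i : 'I_N => lev n i)).
    exact: subnn.
  move/eqP: e; rewrite sum_nat_eq0 => /forallP/(_ j)/eqP h.
  by apply/eqP; rewrite eqn_leq hle /= -subn_eq0 h.
case/eqP: hne; rewrite eJ; congr (_, _); apply/permP => j; rewrite permE; apply: val_inj.
rewrite /= f0E; case: ifP => jm.
  apply: (frob_index_unique n_gt1 p_prime n_lt_p (ord_le _) (ord_le _)) => //.
  have := hgood j; rewrite eJ inE jm /= negbK => /andP[/eqP].
  by [].
by have := hs j; rewrite eJ inE jm => /eqP ->.
Qed.

Let t_main : pabs (t (s0, J0)) = r ^+ (p.-1 * (\sum_(i < m) i)).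
Proof.
rewrite /t /minor_term /= J0_card eqxx mul1r pabsM pabs_sign mul1r pabs_prod -J0_sum.
rewrite big_distrr /= -prodrXr [X in _ = X]big_mkcond /=; apply: eq_bigr => j _.
have e := f0E j; rewrite permE !inE; case: ifP e => jm e.
  rewrite pabsN; apply: A_eq; rewrite e; first exact: frob_index_mod.
  by have [] := frob_index_bound n_gt1 p_prime n_lt_p (ord_le j).
by rewrite -val_eqE /= e eqxx pabs1.
Qed.

Lemma pabs_det_coef :
  pabs (\det (1%:M - 'X *: map_mx polyC A))`_m = r ^+ (p.-1 * \sum_(i < m) i).
Proof.
rewrite coef_det_one_sub (bigD1 (s0, J0)) //= -t_main; apply: pabs_dominant.
rewrite t_main; apply: (@le_lt_trans _ _ (r ^+ (p.-1 * (\sum_(i < m) i)).+1)).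
  by apply: pabs_sum_le => // sJ; exact: t_other.
by rewrite exprS gtr_pMl // exprn_gt0.
Qed.

End DetNorm.

Theorem theorem3p1 (R : realType) (p : nat) (K : padicComplexType R p)
    (n a : nat) (Qq : set K) (F : finFieldType) (red : K -> F)
    (t : F) (tbar gamma gammat zeta : K) (sigma : K -> K)
    (A : 'M[K]_((2 * n).+1)) :
  (1 < n)%N -> prime p -> odd p -> (n < p)%N -> (0 < a)%N ->
  is_unramified_ext a Qq ->
  #|F| = (p ^ a)%N -> is_reduction Qq red ->
  t != 0 -> is_teichmuller (p ^ a) Qq red t tbar ->
  pcvg \oo (series (AH_term gamma)) 0 ->
  ordp gamma = ((p.-1)%:R^-1)%:E ->
  gammat ^+ n = gamma ->
  p.-primitive_root zeta ->
  is_frobenius Qq zeta gammat sigma ->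
  is_frobenius_matrix Qq gamma gammat zeta tbar sigma A ->
  forall m, m \in [:: 1; n; n.+1; 2 * n; (2 * n).+1]%N ->
    ordp (\det (1%:M - 'X *: map_mx polyC A))`_m =
      ((m * (m - 1))%:R / (2 * n)%:R)%:E.
Proof.
move=> n_gt1 p_prime p_odd n_lt_p a_gt0 [E_sub E_Qp _ E_unram]
  F_card E_red t0 [tbar_int tbar_q tbar_t].
move=> gamma_root gamma_ord pi_gamma _ sigma_frob A_frob m hm.
set r := pabs gammat.
have p2 := prime_gt1 p_prime; have n_gt0 : (0 < n)%N := ltnW n_gt1.
have tbar0 : tbar != 0 by apply: contra_neq t0 => tb; rewrite -tbar_t tb; exact: red0 E_red.
have tbar_norm : pabs tbar = 1.
  have q1 : (1 < p ^ a)%N by rewrite -{1}(expn0 p) ltn_exp2l.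
  have q0 : (p ^ a = (p ^ a).-1.+1)%N by rewrite prednK // ltnW.
  have : tbar ^+ (p ^ a).-1 = 1.
    by apply: (mulfI tbar0); rewrite -exprS -q0 tbar_q mulr1.
  move/(congr1 pabs)/eqP; rewrite pabsX pabs1 pexpr_eq1 ?pabs_ge0 ?pabs1 //; last lia.
  by move/eqP.
have rN : r ^+ (n * p.-1) = p%:R^-1 := pi_norm p_prime gamma_ord pi_gamma.
have r_ge0 : 0 <= r := pabs_ge0 _.
have pR : 0 < p%:R :> R by rewrite ltr0n ltnW.
have pR1 : 1 < p%:R :> R by rewrite ltr1n.
have N0 : (0 < n * p.-1)%N by rewrite muln_gt0 n_gt0 -subn1 subn_gt0.
have r_gt0 : 0 < r.
  rewrite lt_neqAle r_ge0 andbT eq_sym; apply/eqP => r0; move/eqP: rN.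
  by rewrite r0 expr0n gtn_eqF // eq_sym invr_eq0 gt_eqF.
have r_lt1 : r < 1 by rewrite -(@expr_lt1 _ (n * p.-1)) // rN invf_lt1.
have hb : pabs (\det (1%:M - 'X *: map_mx polyC A))`_m = r ^+ (p.-1 * \sum_(i < m) i).
  apply: pabs_det_coef => //.
  - exact: (entry_le p_prime p_odd n_gt1 n_lt_p a_gt0 E_sub E_Qp E_unram
      F_card E_red tbar_int tbar_norm
      gamma_root gamma_ord pi_gamma sigma_frob A_frob).
  - exact: (entry_lt p_prime p_odd n_gt1 n_lt_p a_gt0 E_sub E_Qp E_unram
      F_card E_red tbar_int tbar_norm
      gamma_root gamma_ord pi_gamma sigma_frob A_frob).
  - exact: (entry_eq p_prime p_odd n_gt1 n_lt_p a_gt0 E_sub E_Qp E_unram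
      F_card E_red tbar_int tbar_norm
      gamma_root gamma_ord pi_gamma sigma_frob A_frob).
rewrite /ordp -(pabs_eq0E p_prime) hb expf_eq0 gt_eqF // andbF; congr (_%:E).
(* The relation r^(n(p-1)) = 1/p converts the exponent (p-1) m(m-1)/2 of r into the order
   m(m-1)/(2n). *)
have lnr : (n * p.-1)%:R * ln r = - ln p%:R :> R.
  by rewrite mulr_natl -lnXn // rN lnV // posrE.
have lnp : 0 < ln (p%:R : R) by rewrite ln_gt0.
rewrite lnXn // -[ln r *+ _]mulr_natl -sum_ord_double.
have n0 : (n%:R : R) != 0 by rewrite pnatr_eq0 -lt0n.
have p1 : (p.-1%:R : R) != 0 by rewrite pnatr_eq0 -lt0n -subn1 subn_gt0.
have -> : ln r = - ln p%:R / (n%:R * p.-1%:R) :> R.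
  by rewrite -lnr natrM [_ * ln r]mulrC mulfK // mulf_neq0.
rewrite !natrM; field; rewrite n0 p1 (gt_eqF lnp) //.
Qed.
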